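(* Let $N\in\mathbf{Z}\setminus\{0\}$, let $\mathcal{Y}$ be a scheme locally of finite type over $\mathbf{Z}[1/N]$ with non-empty generic fibre, and let $Y$ be its analytification; suppose $\mathrm{pr}(Y)=\mathcal{U}_{N_Y}$ with $N_Y$ a nonzero integer. Let $\mathcal{E},f_1\colon Y\to\mathbf{R}_{\ge0}$, $f_2\colon Y\to\mathbf{R}$ and $g_1\colon Y\to\mathbf{R}\cup\{-\infty\}$ be continuous $\log$-floating functions. For $s,t\in\mathbf{R}_{>0}$, put $V_s=\{y\in Y:f_1(y)\le s\}$ and $W_t=\{y\in Y:g_1(y)\le tf_2(y)\}$. Suppose that: (a) for all $s,t\in\mathbf{R}_{>0}$, the map $\mathrm{pr}_{|V_s\cap W_t}\colon V_s\cap W_t\to\mathcal{U}_{N_Y}$ is proper; (b) there exist $A\in\mathbf{R}_{>0}$ and a family $(B_v)_{v\in M_{\mathbf{Q}}}$ of real numbers, almost all zero, such that for all $v\in M_{\mathbf{Q}}$ and $y\in\mathrm{pr}^{-1}(a_v)$, $g_1(y)\le Af_1(y)+B_v$; (c) there exist $r_0\in\mathbf{R}_{>0}$ and $\tau\colon\mathbf{R}_{>0}\to\mathbf{R}_{>0}$ with $\lim_{+\infty}\tau=+\infty$ such that for all $r\ge r_0$ and $y\in W_{\tau(r)}\cap\mathrm{pr}^{-1}(a_0)$, $\mathcal{E}(y)\ge\frac1rf_2(y)$. Then: (i) Suppose that there is a finite non-empty family $F_1=(F_{1,i})_{i\in I_1}$ of invertible elements of $\mathcal{O}(\mathcal{Y})$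 such that $f_1=\max_{i\in I_1}\big|\log|F_{1,i}|\big|$. Then, for every $\varepsilon\in\mathbf{R}_{>0}$, there exist $C\in\mathbf{R}_{>0}$ and $D\in\mathbf{R}$ such that, for every $Q\in\mathcal{Y}(\overline{\mathbf{Q}})$, $$h_{\mathcal{E}}(Q)\ge C\Big(\sum_{q\in L_{f_1}(Q)}N_qf_2(q)-\varepsilon\,h(F_1(Q))\Big)+D.$$ (ii) Suppose moreover that there is a finite non-empty family $F_2=(F_{2,i})_{i\in I_2}$ of invertible elements of $\mathcal{O}(\mathcal{Y})$ such that $f_2=\max_{i\in I_2}\big|\log|F_{2,i}|\big|$ and that, for every $y\in Y$, if $|F_{1,i}(y)|=1$ for all $i\in I_1$, then $|F_{2,i}(y)|=1$ for all $i\in I_2$. Then, for every $\varepsilon\in\mathbf{R}_{>0}$, there exist $C\in\mathbf{R}_{>0}$ and $D\in\mathbf{R}$ such that, for every $Q\in\mathcal{Y}(\overline{\mathbf{Q}})$, $$h_{\mathcal{E}}(Q)\ge C\big(h(F_2(Q))-\varepsilon\,h(F_1(Q))\big)+D.$$ (iii) Suppose moreover that $F_1=F_2$. Then there exist $C\in\mathbf{R}_{>0}$ and $D\in\mathbf{R}$ such that, for every $Q\in\mathcal{Y}(\overline{\mathbf{Q}})$, $$h_{\mathcal{E}}(Q)\ge C\,h(F_2(Q))+D.$$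
   Context: $\mathcal{M}(\mathbf{Z})$ is the set of multiplicative seminorms on $\mathbf{Z}$ bounded by the usual absolute value, with the topology of pointwise convergence; $a_0$ is the trivial absolute value; for $v\in M_{\mathbf{Q}}$ (the set of places of $\mathbf{Q}$), $a_v$ is the normalized absolute value ($|p|_p=1/p$, or the usual one). For $M\neq0$, $\mathcal{U}_M$ is the open set of seminorms not vanishing at $M$. Analytification: $Y$ is the set of pairs $y=(x,|\cdot|_y)$ with $x\in\mathcal{Y}$ and $|\cdot|_y$ an absolute value (archimedean or not, possibly trivial) on $\kappa(x)$, with the coarsest topology making $Y\to\mathcal{Y}$ continuous and $y\mapsto|f(y)|:=|f(x)|_y$ continuous on the preimage of $U$ for each open $U\subset\mathcal{Y}$, $f\in\mathcal{O}(U)$. The map $\mathrm{pr}$ sends $y$ to the induced seminorm on $\mathbf{Z}$. For $\varepsilon\in(0,1]$, $y^\varepsilon:=(x,|\cdot|_y^\varepsilon)$. A function $f$ on $Y$ is $\log$-floating if $f(y^\varepsilon)=\varepsilon f(y)$ for all $y\in Y$, $\varepsilon\in(0,1]$ (with $\varepsilon\cdot(-\infty)=-\infty$). For $Q\in\mathcal{Y}(\overline{\mathbf{Q}})$, let $\kappa(Q)$ be the residue field of the image point of $Q$ in $\mathcal{Y}$ (a number field). For each place $w$ of $\kappa(Q)$, with $|\cdot|_w$ extending the normalized absolute value of the place $v$ of $\mathbf{Q}$ below $w$, let $q_w\in Y$ be that image point together with $|\cdot|_w$. $L(Q)=\{q_w\}$, indexed by all places $w$ of $\kappa(Q)$; $N_{q_w}=[\kappa(Q)_w:\mathbf{Q}_v]/[\kappa(Q):\mathbf{Q}]$;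 $L_{f_1}(Q)=\{q\in L(Q):f_1(q)>0\}$; $h_{\mathcal{E}}(Q)=\sum_{q\in L(Q)}N_q\mathcal{E}(q)\in[0,+\infty]$. For $F=(F_i)_{i\in I}$, $h(F(Q))$ is the absolute logarithmic height of the tuple $(F_i(Q))_i$: $h(x_1,\dots,x_n)=\sum_{v\in M_K}N_v\log^+\max_i|x_i|_v$ for any number field $K$ containing the $x_i$, with $N_v=[K_v:\mathbf{Q}_{v_{|\mathbf{Q}}}]/[K:\mathbf{Q}]$, $|\cdot|_v$ extending the normalized absolute value of $\mathbf{Q}$ and $\log^+=\max(\log,0)$. Infinite sums are understood in the extended reals, as limits superior of partial sums over finite sets of places directed by inclusion. *)

(* Defs.v *)
From HB Require Import structures.
From mathcomp Require Import all_boot all_order all_algebra all_field.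
From mathcomp Require Import ring_quotient finmap ring.
From mathcomp Require Import all_classical all_reals all_analysis.
Import Order.TTheory GRing.Theory Num.Theory.
Import numFieldNormedType.Exports.

Set Implicit Arguments.
Unset Strict Implicit.
Unset Printing Implicit Defensive.

Local Open Scope classical_set_scope.
Local Open Scope ring_scope.
Local Open Scope quotient_scope.

Section QuotField.
Context (A : comNzRingType) (I : idealr A).
Hypothesis Imax : forall a, a \notin I -> exists b, a * b - 1 \in I.

Definition quot_inv (x : {ideal_quot I}) : {ideal_quot I} :=
  xget 0 [set y | x != 0 /\ y * x = 1].

Lemma quot_mulVf x : x != 0 -> quot_inv x * x = 1.
Proof.
move=> x0; rewrite /quot_inv; case: xgetP => [y _ []//|/= nex].
have aI : repr x \notin I.
  by apply: contra x0; rewrite -[x in X in _ -> X]reprK piE Quotient.equivE subr0.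
have [b ab] := Imax aI; exfalso; apply: (nex (\pi b)); split=> //.
apply/eqP; rewrite -[x]reprK mulrC -[1](@rmorph1 _ _ (\pi_{ideal_quot I})).
by rewrite -rmorphM piE Quotient.equivE.
Qed.

Lemma quot_inv0 : quot_inv 0 = 0.
Proof. by rewrite /quot_inv; case: xgetP => // y _ []; rewrite eqxx. Qed.

End QuotField.

Record opens (T : topologicalType) :=
  Opens { opens_set :> set T; opens_open : open opens_set }.

Definition opensT (T : topologicalType) : opens T := Opens (@openT T).
Definition opensI (T : topologicalType) (U V : opens T) : opens T :=
  Opens (openI (opens_open U) (opens_open V)).

Lemma opensIl (T : topologicalType) (U V : opens T) : opensI U V `<=` U.
Proof. by move=> ? []. Qed.
Lemma opensIr (T : topologicalType) (U V : opens T) : opensI U V `<=` V.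
Proof. by move=> ? []. Qed.

(* The zero ring has to be allowed: it is the ring of sections over the empty
   set. *)
Record ringed_space := RingedSpace {
  rs_space :> topologicalType;
  sections : opens rs_space -> comPzRingType;
  res : forall U V : opens rs_space,
    V `<=` U -> {rmorphism sections U -> sections V};
  res_id : forall (U : opens rs_space) (h : U `<=` U) (s : sections U),
    res h s = s;
  res_comp : forall (U V W : opens rs_space)
    (hVU : V `<=` U) (hWV : W `<=` V) (hWU : W `<=` U) (s : sections U),
    res hWV (res hVU s) = res hWU s;
  sheaf_local : forall (U : opens rs_space) (I : Type)
    (V : I -> opens rs_space) (hV : forall i, V i `<=` U),
    U `<=` \bigcup_i V i ->
    forall s t : sections U,
      (forall i, res (hV i) s = res (hV i) t) -> s = t;
  sheaf_glue : forall (U : opens rs_space) (I : Type)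
    (V : I -> opens rs_space) (hV : forall i, V i `<=` U),
    U `<=` \bigcup_i V i ->
    forall s : (forall i, sections (V i)),
      (forall i j (W : opens rs_space) (hi : W `<=` V i) (hj : W `<=` V j),
        res hi (s i) = res hj (s j)) ->
      exists t : sections U, forall i, res (hV i) t = s i
}.
Arguments res {r U V}.

Definition global_sections (X : ringed_space) : comPzRingType :=
  sections (opensT X).

Section Stalk.
Context (X : ringed_space) (x : X).

Record pregerm := PreGerm {
  germ_dom : opens X;
  germ_mem : opens_set germ_dom x;
  germ_sec : sections germ_dom }.

HB.instance Definition _ := gen_eqMixin pregerm.
HB.instance Definition _ := gen_choiceMixin pregerm.

Definition germ_eqP (s t : pregerm) : Prop :=
  exists (W : opens X) (hs : W `<=` germ_dom s) (ht : W `<=` germ_dom t),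
    opens_set W x /\ res hs (germ_sec s) = res ht (germ_sec t).

Definition germ_eq (s t : pregerm) : bool := `[< germ_eqP s t >].

Lemma res_irr (U V : opens X) (h h' : V `<=` U) (s : sections U) :
  res h s = res h' s.
Proof. by rewrite (Prop_irrelevance h h'). Qed.

Lemma germ_eq_equiv : equiv_class_of germ_eq.
Proof.
split=> [s|s t|t s u].
- by apply/asboolP; exists (germ_dom s), (@subset_refl _ _), (@subset_refl _ _);
    split=> //; apply: germ_mem.
- by apply/asboolP/asboolP => -[W [h1 [h2 [Wx e]]]]; exists W, h2, h1.
- move=> /asboolP[W [hs [ht [Wx e]]]] /asboolP[W' [ht' [hu [W'x e']]]].
  have iW : opensI W W' `<=` W by move=> ? [].
  have iW' : opensI W W' `<=` W' by move=> ? [].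
  apply/asboolP; exists (opensI W W').
  exists (subset_trans iW hs), (subset_trans iW' hu); split=> //.
  rewrite -(res_comp hs iW) e -(res_comp hu iW') -e'.
  by rewrite (res_comp _ _ (subset_trans iW ht)) (res_comp _ _ (subset_trans iW ht)).
Qed.

Canonical germ_equiv_rel := EquivRelPack germ_eq_equiv.
Canonical germ_encModRel := defaultEncModRel germ_eq.

Definition stalk := {eq_quot germ_eq}.
HB.instance Definition _ : EqQuotient pregerm germ_eq stalk :=
  EqQuotient.on stalk.
HB.instance Definition _ := Choice.on stalk.

Definition germ (U : opens X) (h : opens_set U x) (s : sections U) : stalk :=
  \pi_stalk (PreGerm h s).

Lemma germ_eqE (U V : opens X) (hU : opens_set U x) (hV : opens_set V x) s t :
  germ hU s = germ hV t <-> germ_eqP (PreGerm hU s) (PreGerm hV t).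
Proof.
by split=> [/eqP|h]; [|apply/eqP]; rewrite /germ piE => //;
  [move/asboolP|apply/asboolP].
Qed.

Lemma germ_res (U V : opens X) (h : V `<=` U) (hU : opens_set U x) (hV : opens_set V x) s :
  germ hV (res h s) = germ hU s.
Proof.
apply/germ_eqE; exists V, (@subset_refl _ _), h; split=> //.
by rewrite /= res_id.
Qed.

Lemma germ_surj (a : stalk) : exists (U : opens X) (h : opens_set U x) s, a = germ h s.
Proof.
rewrite -[a]reprK; case: (repr a) => U h s; by exists U, h, s.
Qed.

Lemma germ_surj2 (a b : stalk) : exists (U : opens X) (h : opens_set U x) s t,
  a = germ h s /\ b = germ h t.
Proof.
have [U [hU [s ->]]] := germ_surj a; have [V [hV [t ->]]] := germ_surj b.
have iU : opensI U V `<=` U by move=> ? [].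
have iV : opensI U V `<=` V by move=> ? [].
exists (opensI U V), (conj hU hV), (res iU s), (res iV t).
by rewrite !germ_res.
Qed.

Lemma germ_surj3 (a b c : stalk) : exists (U : opens X) (h : opens_set U x) s t u,
  [/\ a = germ h s, b = germ h t & c = germ h u].
Proof.
have [U [hU [s [t [-> ->]]]]] := germ_surj2 a b.
have [V [hV [u ->]]] := germ_surj c.
have iU : opensI U V `<=` U by move=> ? [].
have iV : opensI U V `<=` V by move=> ? [].
exists (opensI U V), (conj hU hV), (res iU s), (res iU t), (res iV u).
by rewrite !germ_res.
Qed.

Definition germ_op (op : forall U : opens X, sections U -> sections U -> sections U)
    (a b : stalk) : stalk :=
  let s := repr a in let t := repr b in
  germ (U := opensI (germ_dom s) (germ_dom t))
    (conj (germ_mem s) (germ_mem t))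
    (op _ (res (@opensIl _ _ _) (germ_sec s)) (res (@opensIr _ _ _) (germ_sec t))).

Lemma germ_opE op (hop : forall (U V : opens X) (h : V `<=` U) s t,
    res h (op U s t) = op V (res h s) (res h t))
  (U : opens X) (h : opens_set U x) s t : germ_op op (germ h s) (germ h t) = germ h (op U s t).
Proof.
rewrite /germ_op.
have: germ (germ_mem (repr (germ h s))) (germ_sec (repr (germ h s))) = germ h s.
  by rewrite -[RHS]reprK; case: (repr _).
have: germ (germ_mem (repr (germ h t))) (germ_sec (repr (germ h t))) = germ h t.
  by rewrite -[RHS]reprK; case: (repr _).
case: (repr (germ h s)) (repr (germ h t)) => [V hV s'] [W hW t'] /=.
move=> /germ_eqE[B [h3 [h4 [Bx /= e2]]]] /germ_eqE[A [h1 [h2 [Ax /= e1]]]].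
have iA : opensI A B `<=` A by move=> ? [].
have iB : opensI A B `<=` B by move=> ? [].
have iVW : opensI A B `<=` opensI V W by move=> ? [] /h1 ? /h3.
have iU : opensI A B `<=` U by move=> ? [] /h2.
apply/germ_eqE; exists (opensI A B), iVW, iU; split=> //=.
rewrite !hop; congr (op _ _ _).
  rewrite (res_comp _ _ (subset_trans iA h1)) -(res_comp h1 iA) e1.
  exact: res_comp.
rewrite (res_comp _ _ (subset_trans iB h3)) -(res_comp h3 iB) e2.
exact: res_comp.
Qed.

Definition stalk_add := germ_op (fun U => +%R).
Definition stalk_mul := germ_op (fun U => *%R).
Definition stalk_zero : stalk := germ (U := opensT X) Logic.I 0.
Definition stalk_one : stalk := germ (U := opensT X) Logic.I 1.
Definition stalk_opp (a : stalk) : stalk :=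
  germ (germ_mem (repr a)) (- germ_sec (repr a)).

Lemma stalk_addE (U : opens X) (h : opens_set U x) s t :
  stalk_add (germ h s) (germ h t) = germ h (s + t).
Proof. by apply: germ_opE => *; rewrite rmorphD. Qed.

Lemma stalk_mulE (U : opens X) (h : opens_set U x) s t :
  stalk_mul (germ h s) (germ h t) = germ h (s * t).
Proof. by apply: germ_opE => *; rewrite rmorphM. Qed.

Lemma stalk_zeroE (U : opens X) (h : opens_set U x) : stalk_zero = germ h 0.
Proof. by rewrite /stalk_zero -(@germ_res (opensT X) U (@subsetT _ _) Logic.I h) rmorph0. Qed.

Lemma stalk_oneE (U : opens X) (h : opens_set U x) : stalk_one = germ h 1.
Proof. by rewrite /stalk_one -(@germ_res (opensT X) U (@subsetT _ _) Logic.I h) rmorph1. Qed.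

Lemma stalk_oppE (U : opens X) (h : opens_set U x) s : stalk_opp (germ h s) = germ h (- s).
Proof.
rewrite /stalk_opp.
have: germ (germ_mem (repr (germ h s))) (germ_sec (repr (germ h s))) = germ h s.
  by rewrite -[RHS]reprK; case: (repr _).
case: (repr (germ h s)) => [V hV s'] /= /germ_eqE[A [h1 [h2 [Ax /= e1]]]].
by apply/germ_eqE; exists A, h1, h2; split=> //=; rewrite !rmorphN e1.
Qed.

Lemma stalk_addA : associative stalk_add.
Proof.
move=> a b c; have [U [h [s [t [u [-> -> ->]]]]]] := germ_surj3 a b c.
by rewrite !stalk_addE addrA.
Qed.
Lemma stalk_addC : commutative stalk_add.
Proof.
move=> a b; have [U [h [s [t [-> ->]]]]] := germ_surj2 a b.
by rewrite !stalk_addE addrC.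
Qed.
Lemma stalk_add0 : left_id stalk_zero stalk_add.
Proof.
move=> a; have [U [h [s ->]]] := germ_surj a.
by rewrite (stalk_zeroE h) stalk_addE add0r.
Qed.
Lemma stalk_addN : left_inverse stalk_zero stalk_opp stalk_add.
Proof.
move=> a; have [U [h [s ->]]] := germ_surj a.
by rewrite stalk_oppE stalk_addE addNr (stalk_zeroE h).
Qed.

HB.instance Definition _ :=
  GRing.isZmodule.Build stalk stalk_addA stalk_addC stalk_add0 stalk_addN.

Lemma stalk_mulA : associative stalk_mul.
Proof.
move=> a b c; have [U [h [s [t [u [-> -> ->]]]]]] := germ_surj3 a b c.
by rewrite !stalk_mulE mulrA.
Qed.
Lemma stalk_mulC : commutative stalk_mul.
Proof.
move=> a b; have [U [h [s [t [-> ->]]]]] := germ_surj2 a b.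
by rewrite !stalk_mulE mulrC.
Qed.
Lemma stalk_mul1 : left_id stalk_one stalk_mul.
Proof.
move=> a; have [U [h [s ->]]] := germ_surj a.
by rewrite (stalk_oneE h) stalk_mulE mul1r.
Qed.
Lemma stalk_mulD : left_distributive stalk_mul +%R.
Proof.
move=> a b c; have [U [h [s [t [u [-> -> ->]]]]]] := germ_surj3 a b c.
rewrite -[_ + _]/(stalk_add _ _) -[RHS]/(stalk_add _ _).
by rewrite !(stalk_addE, stalk_mulE) mulrDl.
Qed.

HB.instance Definition _ := GRing.Zmodule_isComPzRing.Build stalk
  stalk_mulA stalk_mulC stalk_mul1 stalk_mulD.

End Stalk.

Definition invertible (A : comPzRingType) (a : A) : Prop :=
  exists b, a * b = 1.

Definition local_ring (A : comPzRingType) : Prop :=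
  (1 : A) <> 0 /\
  forall a b : A, ~ invertible a -> ~ invertible b -> ~ invertible (a + b).

Record locally_ringed_space := LocallyRingedSpace {
  lrs_ringed :> ringed_space;
  lrs_local : forall x : lrs_ringed, local_ring (stalk x)
}.

Section ResidueField.
Context (X : locally_ringed_space) (x : X).

Lemma stalk_1neq0 : (1 : stalk x) != 0.
Proof. by apply/eqP; case: (lrs_local x). Qed.

HB.instance Definition _ := GRing.PzSemiRing_isNonZero.Build (stalk x) stalk_1neq0.

Definition nonunit (a : stalk x) : bool := `[< ~ invertible a >].

Lemma nonunit_idealr : idealr_closed nonunit.
Proof.
split.
- apply/asboolP => -[b]; rewrite mul0r => /esym/eqP.
  by rewrite (negbTE stalk_1neq0).
- by apply/asboolP; apply; exists 1; rewrite mulr1.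
- move=> a u v /asboolP hu /asboolP hv; apply/asboolP.
  apply: (lrs_local x).2 => // -[b aub]; apply: hu; exists (a * b).
  by rewrite mulrA [u * a]mulrC.
Qed.

HB.instance Definition _ := isIdealr.Build (stalk x) nonunit nonunit_idealr.

Lemma nonunit_max a : a \notin nonunit -> exists b, a * b - 1 \in nonunit.
Proof.
move=> /asboolPn/contrapT[b ab]; exists b; rewrite ab subrr.
by case: nonunit_idealr.
Qed.

Definition max_ideal : idealr (stalk x) := nonunit.
Definition residue_field := {ideal_quot max_ideal}.

HB.instance Definition _ := GRing.ComNzRing.on residue_field.
HB.instance Definition _ := GRing.ComNzRing_isField.Build residue_field
  (@quot_mulVf _ max_ideal nonunit_max) (@quot_inv0 _ max_ideal).

Definition value (U : opens X) (h : opens_set U x) (s : sections U) : residue_field :=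
  \pi_residue_field (germ h s).

End ResidueField.

Definition gvalue (X : locally_ringed_space) (s : global_sections X) (x : X) :
  residue_field x := value (U := opensT X) Logic.I s.

Section Spec.
Context (A : comPzRingType).

Record prime_ideal := PrimeIdeal {
  pideal :> set A;
  pideal0 : pideal 0;
  pidealD : forall a b, pideal a -> pideal b -> pideal (a + b);
  pidealM : forall a b, pideal b -> pideal (a * b);
  pideal1 : ~ pideal 1;
  pideal_prime : forall a b, pideal (a * b) -> pideal a \/ pideal b
}.

HB.instance Definition _ := gen_eqMixin prime_ideal.
HB.instance Definition _ := gen_choiceMixin prime_ideal.

Definition zariski_open : set_system prime_ideal :=
  [set W | exists S : set A, W = [set p | ~ S `<=` pideal p]].

Lemma zariski_openT : zariski_open setT.
Proof.
exists setT; apply/seteqP; split=> // p _ /= /(_ 1 Logic.I).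
exact: pideal1.
Qed.

Lemma zariski_openI : setI_closed zariski_open.
Proof.
move=> _ _ [S ->] [T ->]; exists [set s * t | s in S & t in T].
apply/seteqP; split=> [p [/= nS nT] ST|p /= ST]; last first.
  split=> sub; apply: ST => _ [s Ss [t Tt <-]].
    by rewrite mulrC; apply: pidealM; exact: sub.
  by apply: pidealM; exact: sub.
apply: nS => s Ss; have [//|ns] := pselect (pideal p s).
exfalso; apply: nT => t Tt; have : pideal p (s * t).
  by apply: ST; exists s => //; exists t.
by case/pideal_prime.
Qed.

Lemma zariski_open_bigU (I : Type) (f : I -> set prime_ideal) :
  (forall i, zariski_open (f i)) -> zariski_open (\bigcup_i f i).
Proof.
move=> /choice[S fS]; exists (\bigcup_i S i).
apply/seteqP; split=> [p [i _]|p /= nS].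
  by rewrite fS /= => nS sub; apply: nS => s Ss; apply: sub; exists i.
have [//|nU] := pselect ((\bigcup_i f i) p); exfalso.
apply: nS => s [i _ Ss]; have [//|np] := pselect (pideal p s).
by exfalso; apply: nU; exists i => //; rewrite fS /= => /(_ s Ss).
Qed.

HB.instance Definition _ := isOpenTopological.Build prime_ideal
  zariski_openT zariski_openI zariski_open_bigU.

Definition basic_open (f : A) : set prime_ideal := [set p | ~ pideal p f].

End Spec.

(* [g : A -> B] identifies [B] with the localization [A_f]. *)
Definition is_localization_away (A B : comPzRingType) (f : A)
    (g : {rmorphism A -> B}) : Prop :=
  [/\ invertible (g f),
      forall b, exists a n, g f ^+ n * b = g a
    & forall a, g a = 0 -> exists n, f ^+ n * a = 0].

(* [U], with the restriction of the structure sheaf, is isomorphic to the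
   spectrum of [A]: [phi] is a homeomorphism from [Spec A] onto [U] and, for
   every [f], [rho] induces an isomorphism between [A_f], the ring of sections
   of the structure sheaf of [Spec A] over [D(f)], and the ring of sections
   over [phi (D(f))]. *)
Definition is_spec (X : ringed_space) (U : opens X) (A : comPzRingType)
    (phi : prime_ideal A -> X) (rho : {rmorphism A -> sections U}) : Prop :=
  [/\ injective phi, range phi = U,
      forall W : set (prime_ideal A), open W <-> open (phi @` W)
    & forall (f : A) (V : opens X) (h : V `<=` U),
        phi @` basic_open f = V ->
        is_localization_away f (res h \o rho : {rmorphism A -> sections V})].

Definition affine_open (X : ringed_space) (U : opens X) : Prop :=
  exists A phi rho, @is_spec X U A phi rho.

Record scheme := Scheme {
  scheme_lrs :> locally_ringed_space;
  scheme_affine : forall x : scheme_lrs,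
    exists U : opens scheme_lrs, opens_set U x /\ affine_open U
}.

(* [B] is generated as an [A]-algebra by finitely many elements. *)
Definition finite_type_algebra (A B : comPzRingType) (g : {rmorphism A -> B}) :
    Prop :=
  exists n (b : 'I_n -> B), forall S : set B,
    range g `<=` S -> range b `<=` S ->
    (forall s t, S s -> S t -> S (s + t)) ->
    (forall s t, S s -> S t -> S (s * t)) ->
    S = setT.

(* A morphism of schemes [X -> Spec A] amounts to a ring morphism [str] from [A]
   to the ring of global sections of [X]. *)
Definition locally_of_finite_type (A : comPzRingType) (X : scheme)
    (str : {rmorphism A -> global_sections X}) : Prop :=
  forall x : X, exists U : opens X,
    [/\ opens_set U x, affine_open U
      & finite_type_algebra
          (res (U := opensT X) (V := U) (@subsetT _ _) \o str
            : {rmorphism A -> sections U})].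

Section Zinv.
Context (N : int).

Definition Zinv_pred (x : rat) : bool :=
  `[< exists (k : nat) (m : int), x * N%:~R ^+ k = m%:~R >].

Lemma Zinv_subring : subring_closed Zinv_pred.
Proof.
split.
- by apply/asboolP; exists 0%N, 1%R; rewrite expr0 mulr1.
- move=> x y /asboolP[k [m xm]] /asboolP[l [n yn]]; apply/asboolP.
  exists (k + l)%N, (m * N ^+ l - n * N ^+ k).
  by rewrite rmorphB /= !rmorphM /= -xm -yn !rmorphXn /= exprD mulrBl !mulrA
    [in X in _ - X]mulrAC.
- move=> x y /asboolP[k [m xm]] /asboolP[l [n yn]]; apply/asboolP.
  by exists (k + l)%N, (m * n); rewrite rmorphM /= -xm -yn exprD mulrACA.
Qed.

HB.instance Definition _ := GRing.isSubringClosed.Build rat Zinv_pred Zinv_subring.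

Record Zinv := MkZinv { Zinv_val :> rat; _ : Zinv_val \in Zinv_pred }.

HB.instance Definition _ := [isSub for Zinv_val].
HB.instance Definition _ := [Choice of Zinv by <:].
HB.instance Definition _ := [SubChoice_isSubComNzRing of Zinv by <:].

End Zinv.

Record absval (R : realType) (K : fieldType) := AbsVal {
  absval_fun :> K -> R;
  absval_ge0 : forall a, 0 <= absval_fun a;
  absval_eq0 : forall a, absval_fun a = 0 <-> a = 0;
  absvalM : forall a b, absval_fun (a * b) = absval_fun a * absval_fun b;
  absvalD : forall a b, absval_fun (a + b) <= absval_fun a + absval_fun b
}.

Section AbsvalTheory.
Context (R : realType) (K : fieldType) (w : absval R K).

Lemma absval0 : w 0 = 0. Proof. exact/absval_eq0. Qed.

Lemma absval_neq0 a : a != 0 -> w a != 0.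
Proof. by move=> a0; apply/eqP => /absval_eq0/eqP; rewrite (negbTE a0). Qed.

Lemma absval1 : w 1 = 1.
Proof.
have w1 : w 1 != 0 by apply: absval_neq0; rewrite oner_eq0.
by apply: (mulfI w1); rewrite -absvalM !mulr1.
Qed.

Lemma absvalN a : w (- a) = w a.
Proof.
rewrite -mulN1r absvalM; suff -> : w (-1) = 1 by rewrite mul1r.
apply/eqP; rewrite -(@eqrXn2 _ 2) ?absval_ge0 //.
by rewrite expr2 -absvalM mulrNN mulr1 absval1 expr1n.
Qed.

Lemma absvalB a b : w (a - b) <= w a + w b.
Proof. by apply: le_trans (absvalD _ _ _) _; rewrite absvalN. Qed.

Lemma absvalV a : a != 0 -> w a^-1 = (w a)^-1.
Proof.
move=> a0; apply: (mulfI (absval_neq0 a0)).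
by rewrite -absvalM !mulfV ?absval1 ?absval_neq0.
Qed.

Section Power.
Context (e : R) (e01 : 0 < e <= 1).

Lemma absval_pow_eq0 a : w a `^ e = 0 <-> a = 0.
Proof.
split=> [/powR_eq0_eq0/absval_eq0//|->].
by rewrite absval0 powR0 // gt_eqF //; case/andP: e01.
Qed.

Lemma absval_powM a b : w (a * b) `^ e = w a `^ e * w b `^ e.
Proof. by rewrite absvalM powRM ?absval_ge0. Qed.

Lemma powR_subadd (x y : R) : 0 <= x -> 0 <= y ->
  (x + y) `^ e <= x `^ e + y `^ e.
Proof.
have [e0 e1] := andP e01 => x0 y0.
have [xy0|xy0] := eqVneq (x + y) 0.
  by rewrite xy0 powR0 ?gt_eqF // addr_ge0 ?powR_ge0.
have xyp : 0 < x + y by rewrite lt_neqAle eq_sym xy0 addr_ge0.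
have key z : 0 <= z -> z <= x + y -> z / (x + y) * (x + y) `^ e <= z `^ e.
  move=> z0 zxy; have [->|zn] := eqVneq z 0; first by rewrite !mul0r powR_ge0.
  have zp : 0 < z by rewrite lt_neqAle eq_sym zn.
  have t01 : 0 < z / (x + y) <= 1 by rewrite divr_gt0 //= ler_pdivrMr // mul1r.
  have -> : z `^ e = (z / (x + y)) `^ e * (x + y) `^ e.
    by rewrite -powRM ?divfK // ?divr_ge0 // ltW.
  rewrite ler_wpM2r ?powR_ge0 //.
  by rewrite -[leLHS]powRr1 ?(ltW (andP t01).1) // ger_powR.
have := lerD (key x x0 _) (key y y0 _).
by rewrite -mulrDl -mulrDl mulfV // mul1r; apply; rewrite ?lerDl ?lerDr.
Qed.

Lemma absval_powD a b : w (a + b) `^ e <= w a `^ e + w b `^ e.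
Proof.
apply: le_trans (powR_subadd (absval_ge0 _ _) (absval_ge0 _ _)).
apply: ge0_ler_powR; rewrite ?nnegrE ?absval_ge0 ?addr_ge0 ?absval_ge0 ?absvalD //.
by rewrite ltW //; case/andP: e01.
Qed.

Definition absval_pow : absval R K :=
  AbsVal (fun a => powR_ge0 (w a) e) absval_pow_eq0 absval_powM absval_powD.

End Power.

Definition is_cauchy (c : nat -> K) : bool :=
  `[< forall e : R, 0 < e -> exists n0, forall m n,
        (n0 <= m)%N -> (n0 <= n)%N -> w (c m - c n) < e >].

Lemma cauchy_bounded c : is_cauchy c -> exists2 M : R, 0 < M & forall n, w (c n) <= M.
Proof.
move=> /asboolP/(_ 1 ltr01)[n0 hn0].
exists (1 + \sum_(i < n0.+1) w (c i)) => [|n].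
  by rewrite ltr_pwDl // sumr_ge0 // => i _; apply: absval_ge0.
have [nn0|nn0] := ltnP n n0.+1.
  rewrite (bigD1 (Ordinal nn0)) //= addrCA lerDl addr_ge0 //.
  by rewrite sumr_ge0 // => i _; apply: absval_ge0.
rewrite -[c n](subrK (c n0)); apply: le_trans (absvalD _ _ _) _.
apply: lerD; first by apply/ltW/hn0 => //; apply: ltnW.
by rewrite (bigD1 ord_max) //= lerDl sumr_ge0 // => i _; apply: absval_ge0.
Qed.

Lemma cauchy_subring : subring_closed is_cauchy.
Proof.
split.
- by apply/asboolP => e e0; exists 0%N => m n _ _; rewrite subrr absval0.
- move=> c d /asboolP hc /asboolP hd; apply/asboolP => e e0.
  have e20 : 0 < e / 2 by rewrite divr_gt0.
  have [n1 h1] := hc _ e20; have [n2 h2] := hd _ e20.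
  exists (maxn n1 n2) => m n; rewrite !geq_max => /andP[m1 m2] /andP[k1 k2].
  have -> : (c - d) m - (c - d) n = (c m - c n) - (d m - d n).
    by rewrite -[LHS]/(c m - d m - (c n - d n)); ring.
  by apply: le_lt_trans (absvalB _ _) _; rewrite [e]splitr ltrD ?h1 ?h2.
- move=> c d hc hd; apply/asboolP => e e0.
  have [M M0 hM] := cauchy_bounded hc; have [L L0 hL] := cauchy_bounded hd.
  move: hc hd => /asboolP hc /asboolP hd.
  have e1 : 0 < e / 2 / L by rewrite !divr_gt0.
  have e2 : 0 < e / 2 / M by rewrite !divr_gt0.
  have [n1 h1] := hc _ e1; have [n2 h2] := hd _ e2.
  exists (maxn n1 n2) => m n; rewrite !geq_max => /andP[m1 m2] /andP[k1 k2].
  have -> : (c * d) m - (c * d) n = (c m - c n) * d m + c n * (d m - d n).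
    by rewrite -[LHS]/(c m * d m - c n * d n); ring.
  apply: le_lt_trans (absvalD _ _ _) _; rewrite [e]splitr !absvalM ltr_leD //.
    apply: le_lt_trans (ler_wpM2l (absval_ge0 _ _) (hL m)) _.
    by rewrite -ltr_pdivlMr // h1.
  apply: le_trans (ler_wpM2r (absval_ge0 _ _) (hM n)) _.
  by rewrite mulrC -ler_pdivlMr // ltW // h2.
Qed.

HB.instance Definition _ :=
  GRing.isSubringClosed.Build (nat -> K) is_cauchy cauchy_subring.

Record cauchy_seq := CauchySeq {
  cauchy_val :> nat -> K; cauchy_valP : cauchy_val \in is_cauchy }.

HB.instance Definition _ := [isSub for cauchy_val].
HB.instance Definition _ := [Choice of cauchy_seq by <:].
HB.instance Definition _ := [SubChoice_isSubComNzRing of cauchy_seq by <:].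

Definition null_seq (c : cauchy_seq) : bool :=
  `[< forall e : R, 0 < e -> exists n0, forall n, (n0 <= n)%N -> w (c n) < e >].

Lemma null_idealr : idealr_closed null_seq.
Proof.
split.
- by apply/asboolP => e e0; exists 0%N => n _; rewrite absval0.
- apply/asboolP => /(_ 1 ltr01)[n0 /(_ n0 (leqnn _))].
  by rewrite absval1 ltxx.
- move=> a u v /asboolP hu /asboolP hv; apply/asboolP => e e0.
  have [M M0 hM] := cauchy_bounded (cauchy_valP a).
  have e1 : 0 < e / 2 / M by rewrite !divr_gt0.
  have e2 : 0 < e / 2 by rewrite divr_gt0.
  have [n1 h1] := hu _ e1; have [n2 h2] := hv _ e2.
  exists (maxn n1 n2) => n; rewrite !geq_max => /andP[k1 k2].
  have -> : (a * u + v : cauchy_seq) n = a n * u n + v n by [].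
  apply: le_lt_trans (absvalD _ _ _) _; rewrite [e]splitr absvalM ler_ltD ?h2 //.
  apply: le_trans (ler_wpM2r (absval_ge0 _ _) (hM n)) _.
  by rewrite mulrC -ler_pdivlMr // ltW // h1.
Qed.

HB.instance Definition _ := isIdealr.Build cauchy_seq null_seq null_idealr.

Definition null_ideal : idealr cauchy_seq := null_seq.

Lemma null_max a : a \notin null_ideal -> exists b, a * b - 1 \in null_ideal.
Proof.
move=> /asboolPn/existsNP[e /not_implyP[e0 /forallNP ne]].
have e20 : 0 < e / 2 by rewrite divr_gt0.
have /asboolP ca := cauchy_valP a.
have [n0 h0] := ca _ e20.
have /existsNP[n1 /not_implyP[n01 /negP]] := ne n0; rewrite -leNgt => en1.
have low n : (n0 <= n)%N -> e / 2 <= w (a n).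
  move=> n0n; have := h0 _ _ n01 n0n => d.
  have : w (a n1) <= w (a n1 - a n) + w (a n).
    by rewrite -{1}[a n1](subrK (a n)) absvalD.
  move=> /(le_trans en1) h; rewrite -(lerD2l (e / 2)) -splitr.
  by apply: le_trans h _; rewrite lerD2r ltW.
have a0 n : (n0 <= n)%N -> a n != 0.
  move=> /low h; apply: contraTneq h => ->.
  by rewrite absval0 -ltNge.
have cb : (fun n => (a n)^-1) \in is_cauchy.
  apply/asboolP => d d0.
  have d1 : 0 < d * (e / 2) * (e / 2) by rewrite !mulr_gt0.
  have [n2 h2] := ca _ d1.
  exists (maxn n0 n2) => m n; rewrite !geq_max => /andP[k1 k2] /andP[l1 l2].
  have -> : (a m)^-1 - (a n)^-1 = (a n - a m) / (a m) / (a n).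
    by rewrite !mulrBl mulfV ?a0 // [a n / a m / a n]mulrAC mulfV ?a0 //
      mul1r mul1r.
  rewrite !absvalM !absvalV ?a0 //.
  have pm : 0 < w (a m) by apply: lt_le_trans e20 (low _ k1).
  have pn : 0 < w (a n) by apply: lt_le_trans e20 (low _ l1).
  rewrite !ltr_pdivrMr //; apply: lt_le_trans (h2 _ _ l2 k2) _.
  by apply: ler_pM; rewrite ?low ?ler_wpM2l ?low ?mulr_ge0 // ltW.
exists (CauchySeq cb); apply/asboolP => d d0; exists n0 => n n0n.
have -> : (a * CauchySeq cb - 1 : cauchy_seq) n = a n / a n - 1 by [].
by rewrite mulfV ?a0 // subrr absval0.
Qed.

Definition completion := {ideal_quot null_ideal}.

HB.instance Definition _ := GRing.ComNzRing.on completion.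
HB.instance Definition _ := GRing.ComNzRing_isField.Build completion
  (@quot_mulVf _ null_ideal null_max) (@quot_inv0 _ null_ideal).

End AbsvalTheory.

Section Analytification.
Context (R : realType) (X : scheme).

Record analytification := AnPoint {
  an_pt : X;
  an_abs : absval R (residue_field an_pt) }.

HB.instance Definition _ := gen_eqMixin analytification.
HB.instance Definition _ := gen_choiceMixin analytification.

(* A subbase of the coarsest topology for which [an_pt] is continuous and, for
   [f] in [O(U)], [y |-> |f(y)|] is continuous on the (then open) preimage of
   [U]. *)
Definition an_subbase : set (set analytification) :=
  [set P | (exists U : opens X, P = [set y | opens_set U (an_pt y)]) \/
    (exists (U : opens X) (f : sections U) (W : set R), open W /\
       P = [set y | exists h : opens_set U (an_pt y),
                      W (an_abs y (value h f))])].

HB.instance Definition _ :=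
  @isSubBaseTopological.Build analytification _ an_subbase id.

Definition an_pow (y : analytification) (e : R) (e01 : 0 < e <= 1) :
  analytification := AnPoint (absval_pow (an_abs y) e01).

Definition log_floating (f : analytification -> R) : Prop :=
  forall y e (e01 : 0 < e <= 1), f (an_pow y e01) = e * f y.

Definition log_floatinge (f : analytification -> \bar R) : Prop :=
  forall y e (e01 : 0 < e <= 1), f (an_pow y e01) = (e%:E * f y)%E.

Definition pr (y : analytification) : {ptws int -> R} :=
  fun n => an_abs y n%:~R.

End Analytification.

Section SpectrumZ.
Context (R : realType).

(* M(Z), as a subset of the space of functions [int -> R] with the topology of
   pointwise convergence. *)
Definition berkovich_Z : set {ptws int -> R} :=
  [set a | [/\ a 0 = 0 /\ a 1 = 1,
      forall m n, a (m * n) = a m * a n,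
      forall m n, a (m + n) <= a m + a n
    & forall n, 0 <= a n <= `|n|%:~R]].

Definition nonvanishing (M : int) : set {ptws int -> R} :=
  [set a | berkovich_Z a /\ a M <> 0].

Definition trivial_abs : {ptws int -> R} := fun n => (n != 0)%:R.

Inductive place_Q := infinite_place | finite_place (p : nat) of prime p.

Definition normalized_abs (v : place_Q) : {ptws int -> R} :=
  match v with
  | infinite_place => fun n => `|n|%:~R
  | finite_place p _ => fun n => if n == 0 then 0 else p%:R ^- logn p `|n|%N
  end.

End SpectrumZ.
Arguments berkovich_Z R : clear implicits.
Arguments nonvanishing R M : clear implicits.
Arguments trivial_abs R : clear implicits.
Arguments normalized_abs R v : clear implicits.

(* [f] restricts to a proper map from [A] to [B]; for [B] locally compact and
   Hausdorff, this condition on compact subsets amounts to [f] being universally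
   closed. *)
Definition proper_on (S T : topologicalType) (A : set S) (B : set T)
    (f : S -> T) : Prop :=
  [/\ {within A, continuous f}, f @` A `<=` B
    & forall K, K `<=` B -> compact K -> compact (A `&` f @^-1` K)].

(* The dimension of [L] over [F], when [F] is a subfield of [L] over which [L]
   is finite. *)
Definition has_basis (L : fieldType) (F : set L) (n : nat) : Prop :=
  exists b : 'I_n -> L, forall y : L,
    exists! a : {ffun 'I_n -> L}, (forall i, F (a i)) /\ y = \sum_i a i * b i.

Definition degree_over (L : fieldType) (F : set L) : nat :=
  xget 0%N [set n | has_basis F n].

(* The prime field, when the characteristic is zero. *)
Definition rationals (K : fieldType) : set K := range (@ratr K).
Arguments rationals K : clear implicits.

Section Places.
Context (R : realType) (K : fieldType).

(* A place is represented by the absolute value in its equivalence class that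
   extends a normalized absolute value of [Q]. *)
Record place := Place {
  place_abs :> absval R K;
  place_normalized : exists v : place_Q,
    forall n : int, place_abs n%:~R = normalized_abs R v n }.

HB.instance Definition _ := gen_eqMixin place.
HB.instance Definition _ := gen_choiceMixin place.

(* The completion of the field of rational numbers, inside that of [K]. *)
Definition rational_completion (w : place) : set (completion w) :=
  [set z | exists c : cauchy_seq w,
     (forall n, rationals K (c n)) /\ z = \pi_(completion w) c].
Arguments rational_completion w : clear implicits.

Definition local_weight (w : place) : R :=
  (degree_over (rational_completion w))%:R / (degree_over (rationals K))%:R.

End Places.

(* The limit superior of the sums over the finite subsets of [P], directed by
   inclusion. *)
Definition limsup_sum (R : realType) (I : choiceType) (P : set I)
    (a : I -> R) : \bar R :=
  ereal_inf [set ereal_sup [set (\sum_(i <- J | i \in P) a i)%:E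
                           | J in [set J : {fset I} | (J0 `<=` J)%fset]]
            | J0 in [set: {fset I}]].

Definition lnp (R : realType) (x : R) : R := Num.max (ln x) 0.

Definition height (R : realType) (K : fieldType) (I : finType) (x : I -> K) :
    \bar R :=
  limsup_sum [set: place R K]
    (fun w => local_weight w * lnp (\big[Num.max/0]_i w (x i))).

(* A morphism from [Spec Qbar] to [X] amounts to a point of [X] together with an
   embedding of its residue field into [Qbar]. *)
Record Qbar_point (X : scheme) := QbarPoint {
  Qpt : X;
  Qemb : {rmorphism residue_field Qpt -> algC} }.

Section AlgebraicPoints.
Context (R : realType) (X : scheme) (Q : Qbar_point X).

Definition an_place (w : place R (residue_field (Qpt Q))) :
  analytification R X := AnPoint w.

Definition height_of (E : analytification R X -> R) : \bar R :=
  limsup_sum [set: place R (residue_field (Qpt Q))]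
    (fun w => local_weight w * E (an_place w)).

(* The sum of [N_q f2(q)] over the [q] in [L(Q)] such that [f1 q > 0]. *)
Definition positive_sum (f1 f2 : analytification R X -> R) : \bar R :=
  limsup_sum [set w : place R (residue_field (Qpt Q)) | 0 < f1 (an_place w)]
    (fun w => local_weight w * f2 (an_place w)).

End AlgebraicPoints.

Record unit_family (X : scheme) := UnitFamily {
  fam_idx : finType;
  fam :> fam_idx -> global_sections X;
  fam_nonempty : (0 < #|fam_idx|)%N;
  fam_invertible : forall i, invertible (fam i) }.

Section UnitFamilies.
Context (R : realType) (X : scheme) (F : unit_family X).

Definition abs_at (s : global_sections X) (y : analytification R X) : R :=
  an_abs y (gvalue s (an_pt y)).

Definition max_abs_log (y : analytification R X) : R :=
  \big[Num.max/0]_i `|ln (abs_at (F i) y)|.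

(* The coordinates of [F(Q)] lie in the number field [residue_field (Qpt Q)]. *)
Definition family_height (Q : Qbar_point X) : \bar R :=
  height R (fun i => gvalue (F i) (Qpt Q)).

End UnitFamilies.
Arguments family_height R {X} F Q.

(* Main.v *)
Require Import Defs.
From HB Require Import structures.
From mathcomp Require Import all_boot all_order all_algebra all_field.
From mathcomp Require Import ring_quotient finmap perm ring lra.
From mathcomp Require Import all_classical all_reals all_analysis.
Import Order.TTheory GRing.Theory Num.Theory.
Import numFieldNormedType.Exports.

(** The proof compares [E], [f1] and [f2] at each point [y] above a place [v] of
    the rational numbers, then sums over the places of the residue field of [Q].

    Local inequality ([key_inequality]). For every [d > 0] there are [r > 0] and
    constants [D v >= 0], almost all zero, such that
    [f2 y <= r * E y + d * f1 y + D v] whenever [y] lies above [v] and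
    [f1 y > 0]. All functions are log-floating, so [y] may be replaced by its
    power [y'] with [f1 y' = 1], at the price of moving [v] along its branch of
    the spectrum of Z. If [f2 y' < d] there is nothing to prove. Otherwise the
    bound on [g1] puts [y'] in some [V 1 `&` W t]; above the trivial absolute
    value, [r * E >= f2] holds there, and properness over a compact neighbourhood
    of the trivial absolute value spreads [r * E > f2 - d] to a neighbourhood of
    that fibre ([near_trivial_fibre]). Such a neighbourhood contains all powers
    of all but finitely many places, and the small powers of the others: it
    catches [y'] unless [v] is one of finitely many places and [f1 y] is bounded,
    and then [f2 y] is bounded too ([f2_bounded]). Since [f1 y] may be less than
    1, a non-archimedean absolute value has to be raised to a power greater than
    1 ([scale_point]).

    Summation. Weighted by the local degrees, the constants add up to at most the
    sum of the [D v], because the weights of the places above [v] add up to 1.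
    The sum of [f1], that is of the maxima of the [|log|F1_i||], is bounded by a
    multiple of the height of [F1], because the negative parts of the logarithms
    of a nonzero element are compensated by the positive parts: this is the
    product formula ([has_norm_all], [negative_part_le]). Taking [d] small
    compared with [eps] gives the first inequality. For the second one, the
    height of [F2] is at most the sum of [f2] over the places where [f1 > 0],
    because [F2] has absolute values 1 where [f1 = 0]. For the third one,
    [d = 1/2] lets the sum of [f1] be absorbed in the left side, place by place.
    If the residue field is not finite over the rational numbers, then all
    weights vanish and the sums are zero.

    Product formula. Let [x0] be a primitive element with minimal polynomial [P]
    over the rational numbers, and let [k] be the completion of the rational
    numbers at [v]. The places above [v] correspond to the irreducible factors
    [p] of [P] over [k]: the local degree is the degree of [p], and [x0] has
    local norm [|p(0)|] ([local_places]). So the product of the local norms of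
    [x0] above [v] is [|P(0)|], and the product formula for [x0] is that of the
    rational number [P(0)]. Every nonzero element is a quotient of two elements
    that are primitive or rational. The absolute value on [k[X]/(p)] is
    [|det|^(1/d)], where [det] is the determinant of a multiplication
    ([ext_abs]); local compactness of [k] bounds the coordinates of an element by
    this function ([modnorm_lower]), and the triangle inequality follows by
    comparing high powers ([ext_absD]). *)

Set Implicit Arguments.
Unset Strict Implicit.
Unset Printing Implicit Defensive.

Local Open Scope classical_set_scope.
Local Open Scope ring_scope.

(** * Absolute values and completions *)

Section AbsvalGeneral.
Context (R : realType).

Lemma absval_ext (K : fieldType) (w1 w2 : absval R K) :
  (forall x, w1 x = w2 x) -> w1 = w2.
Proof.
case: w1 w2 => [f1 a1 b1 c1 d1] [f2 a2 b2 c2 d2] /= /funext ff; subst f2.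
by rewrite (Prop_irrelevance a1 a2) (Prop_irrelevance b1 b2)
  (Prop_irrelevance c1 c2) (Prop_irrelevance d1 d2).
Qed.

Context (K : fieldType) (w : absval R K).

Lemma absval_gt0 x : x != 0 -> 0 < w x.
Proof. by move=> x0; rewrite lt_neqAle absval_ge0 eq_sym absval_neq0. Qed.

Lemma absvalX x n : w (x ^+ n) = w x ^+ n.
Proof. by elim: n => [|n IH]; rewrite ?expr0 ?absval1 // !exprS absvalM IH. Qed.

Lemma absval_sum (I : Type) (r : seq I) (P : pred I) (f : I -> K) :
  w (\sum_(i <- r | P i) f i) <= \sum_(i <- r | P i) w (f i).
Proof.
elim/big_ind2 : _ => [|x a y b xa yb|//]; first by rewrite absval0.
by apply: le_trans (absvalD _ _ _) _; exact: lerD.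
Qed.

Lemma absval_prod (I : Type) (r : seq I) (P : pred I) (f : I -> K) :
  w (\prod_(i <- r | P i) f i) = \prod_(i <- r | P i) w (f i).
Proof. by elim/big_rec2 : _ => [|i y x _ <-]; rewrite ?absval1 ?absvalM. Qed.

Lemma absval_nat n : w n%:R <= n%:R.
Proof.
elim: n => [|n IH]; first by rewrite absval0.
by rewrite -natr1 -natr1 (le_trans (absvalD _ _ _)) // lerD // absval1.
Qed.

Lemma absval_distl x y : `|w x - w y| <= w (x - y).
Proof.
rewrite ler_norml; apply/andP; split.
  rewrite lerNl opprB lerBlDr -{1}[y](subrK x) -[x - y]opprB absvalN.
  exact: absvalD.
by rewrite lerBlDr -{1}[x](subrK y) absvalD.
Qed.

End AbsvalGeneral.

Lemma bernoulli (R : realType) (t : R) (m : nat) : 0 <= t ->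
  1 + m%:R * t <= (1 + t) ^+ m.
Proof.
move=> t0; elim: m => [|j IH]; first by rewrite mul0r addr0 expr0.
have t1 : 0 <= 1 + t by rewrite addr_ge0.
have jt : 0 <= j%:R * t * t by rewrite !mulr_ge0 ?ler0n.
rewrite exprSr; apply: (le_trans _ (ler_wpM2r t1 IH)); rewrite -natr1; nra.
Qed.

Lemma inv_succ_lt (R : realType) (e : R) : 0 < e ->
  exists n0, forall n, (n0 <= n)%N -> n.+1%:R^-1 < e.
Proof.
move=> e0; exists (Num.bound e^-1) => n h; rewrite invf_plt ?posrE //.
apply: lt_le_trans (archi_boundP _) _; first by rewrite invr_ge0 ltW.
by rewrite ler_nat ltnW.
Qed.

(** Comparing all powers at once kills multiplicative constants. *)
Lemma ler_of_powers (R : realType) (x y C : R) : 0 <= x -> 0 <= y ->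
  (forall m : nat, x ^+ m <= C * y ^+ m) -> x <= y.
Proof.
move=> x0 y0 H; rewrite leNgt; apply/negP => yx.
have xp : 0 < x by apply: le_lt_trans yx.
have [y00|yp] := eqVneq y 0.
  by have := H 1%N; rewrite y00 !expr1 mulr0 leNgt xp.
have {}yp : 0 < y by rewrite lt_neqAle eq_sym yp.
have [t tE] : exists t, t = x / y - 1 by exists (x / y - 1).
have t0 : 0 < t by rewrite tE subr_gt0 ltr_pdivlMr // mul1r.
have [m Cm] : exists m : nat, C < m%:R * t.
  exists (Num.bound `|C / t|); rewrite -ltr_pdivrMr //.
  exact: le_lt_trans (ler_norm _) (archi_boundP (normr_ge0 _)).
have bern := bernoulli m (ltW t0); rewrite (_ : 1 + t = x / y) in bern; last by rewrite tE; ring.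
have := H m; rewrite -ler_pdivrMr ?exprn_gt0 // -expr_div_n => h.
have := le_trans bern h; lra.
Qed.

Lemma ler_of_powers_linear (R : realType) (x y : R) : 0 <= x -> 0 <= y ->
  (forall m : nat, x ^+ m <= m.+1%:R * y ^+ m) -> x <= y.
Proof.
move=> x0 y0 h.
have eta t : 0 < t -> x <= (1 + t) * y.
  move=> t0; have t1 : 0 <= 1 + t by rewrite addr_ge0 ?ltW.
  (* By Bernoulli's inequality, [m + 1 <= (1 + 1/t) * (1 + t)^m]. *)
  apply: (@ler_of_powers _ _ _ (1 + t^-1)) => // [|m]; first exact: mulr_ge0.
  apply: le_trans (h m) _; rewrite exprMn mulrA ler_wpM2r ?exprn_ge0 //.
  have t2 : 0 <= 1 + t^-1 by rewrite addr_ge0 // invr_ge0 ltW.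
  apply: le_trans (ler_wpM2l t2 (bernoulli m (ltW t0))).
  have -> : (1 + t^-1) * (1 + m%:R * t) = m.+1%:R + m%:R * t + t^-1.
    by rewrite -natr1; field; rewrite gt_eqF.
  by rewrite -addrA lerDl addr_ge0 ?mulr_ge0 ?invr_ge0 ?ler0n ?ltW.
apply/ler_addgt0Pr => e e0.
have y1 : 0 < y + 1 by rewrite ltr_wpDl.
apply: le_trans (eta (e / (y + 1)) _) _; first by rewrite divr_gt0.
rewrite mulrDl mul1r lerD2l mulrAC ler_pdivrMr // ler_wpM2l ?(ltW e0) //.
by rewrite lerDl.
Qed.

Section Convergence.
Context (R : realType) (K : fieldType) (w : absval R K).

(** Convergence of sequences for [w], which is not attached to [K] as a topology. *)
Definition cvgs (u : nat -> K) (l : K) :=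
  forall e : R, 0 < e -> exists n0, forall n, (n0 <= n)%N -> w (u n - l) < e.

Definition complete_absval := forall u : nat -> K, u \in is_cauchy w ->
  exists l, cvgs u l.

Lemma absval_eq0_small x : (forall e : R, 0 < e -> w x < e) -> x = 0.
Proof.
move=> h; apply/eqP; apply: contraT => /(absval_gt0 w) /[dup] p /h.
by rewrite ltxx.
Qed.

End Convergence.

Section Completion.
Local Open Scope quotient_scope.
Context (R : realType) (K : fieldType) (w : absval R K).
Local Notation Kw := (completion w).

Lemma cst_cauchy (x : K) : (fun=> x) \in is_cauchy w.
Proof.
by apply/asboolP => e e0; exists 0%N => m n _ _; rewrite subrr absval0.
Qed.

Definition cst_seq (x : K) : cauchy_seq w := CauchySeq (cst_cauchy x).

Lemma cauchy_seqP (c d : cauchy_seq w) : (forall n, c n = d n) -> c = d.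
Proof. by move=> cd; apply: val_inj; apply/funext. Qed.

Definition compl_emb (x : K) : Kw := \pi_Kw (cst_seq x).

Lemma compl_emb_zmod : zmod_morphism compl_emb.
Proof.
move=> x y; rewrite /compl_emb -rmorphB; congr (\pi_Kw _).
exact: cauchy_seqP.
Qed.

Lemma compl_emb_monoid : monoid_morphism compl_emb.
Proof.
split; first by rewrite -[RHS](@rmorph1 _ _ (\pi_Kw)); congr (\pi_Kw _);
  exact: cauchy_seqP.
move=> x y; rewrite /compl_emb -rmorphM; congr (\pi_Kw _).
exact: cauchy_seqP.
Qed.

HB.instance Definition _ := GRing.isZmodMorphism.Build K Kw compl_emb compl_emb_zmod.
HB.instance Definition _ := GRing.isMonoidMorphism.Build K Kw compl_emb compl_emb_monoid.

Lemma compl_eqP (c d : cauchy_seq w) : \pi_Kw c = \pi_Kw d <->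
  forall e : R, 0 < e -> exists n0, forall n, (n0 <= n)%N -> w (c n - d n) < e.
Proof.
split=> [/eqP|h]; last apply/eqP; rewrite piE Quotient.equivE; last exact/asboolP.
by move/asboolP.
Qed.

Lemma compl_surj (z : Kw) : exists c, z = \pi_Kw c.
Proof. by exists (repr z); rewrite reprK. Qed.


Lemma abs_seq_cvg (c : cauchy_seq w) : cvgn (fun n => w (c n)).
Proof.
apply/cauchy_cvgP/cauchy_exP => e e0.
have /asboolP/(_ _ e0)[n0 hn0] := cauchy_valP c.
exists (w (c n0)), n0 => // n /= n0n.
by apply: le_lt_trans (absval_distl _ _ _) _; apply: hn0.
Qed.

(** The extension of [w] to the completion by continuity. *)
Definition compl_abs_fun (z : Kw) : R := limn (fun n => w ((repr z : cauchy_seq w) n)).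

Lemma compl_absE (c : cauchy_seq w) : w (c n) @[n --> \oo] --> compl_abs_fun (\pi_Kw c).
Proof.
have : \pi_Kw (repr (\pi_Kw c)) = \pi_Kw c by rewrite reprK.
rewrite /compl_abs_fun; move: (repr _) => d /compl_eqP dc.
have /cvg_ex[l dl] := @abs_seq_cvg d; rewrite (cvg_lim _ dl) //.
apply/cvgrPdist_lt => e e0; have e20 : 0 < e / 2 by rewrite divr_gt0.
have [n0 hn0] := dc _ e20.
move/cvgrPdist_lt : dl => /(_ _ e20); apply: filter_app.
exists n0 => // n /= n0n h.
rewrite -[l](subrK (w (d n))) -addrA (le_lt_trans (ler_normD _ _)) //.
rewrite [e]splitr ltrD //; apply: le_lt_trans (absval_distl _ _ _) _; exact: hn0.
Qed.

Lemma compl_abs_unique (c : cauchy_seq w) (l : R) :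
  w (c n) @[n --> \oo] --> l -> compl_abs_fun (\pi_Kw c) = l.
Proof. by move=> cl; rewrite -(cvg_lim _ cl) // (cvg_lim _ (@compl_absE c)). Qed.


Lemma compl_abs_ge0 z : 0 <= compl_abs_fun z.
Proof.
have [c ->] := compl_surj z; apply: (cvgr_to_ge (@compl_absE c)).
by near do exact: absval_ge0.
Unshelve. all: by end_near. Qed.

Lemma compl_abs_eq0 z : compl_abs_fun z = 0 <-> z = 0.
Proof.
have pi0 : \pi_Kw 0 = 0 := rmorph0 _.
have [c ->] := compl_surj z; split=> [c0|->].
  rewrite -pi0.
  apply/compl_eqP => e e0; have := @compl_absE c; rewrite c0 => /cvgrPdist_lt/(_ _ e0).
  move=> [n0 _ hn0]; exists n0 => n n0n; have := hn0 n n0n.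
  by rewrite /= sub0r normrN ger0_norm ?absval_ge0 // -[_ - _]/(c n - 0) subr0.
rewrite -pi0; apply: compl_abs_unique; under eq_fun do rewrite absval0.
exact: cvg_cst.
Qed.

Lemma compl_absM x y : compl_abs_fun (x * y) = compl_abs_fun x * compl_abs_fun y.
Proof.
have [c ->] := compl_surj x; have [d ->] := compl_surj y; rewrite -rmorphM.
apply: compl_abs_unique; under eq_fun do rewrite absvalM.
by apply: cvgM; apply: compl_absE.
Qed.

Lemma compl_absD x y : compl_abs_fun (x + y) <= compl_abs_fun x + compl_abs_fun y.
Proof.
have [c ->] := compl_surj x; have [d ->] := compl_surj y; rewrite -rmorphD.
apply: (ler_cvg_to (@compl_absE (c + d)) (cvgD (@compl_absE c) (@compl_absE d))).
by near do exact: absvalD.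
Unshelve. all: by end_near. Qed.

Definition compl_abs : absval R Kw := AbsVal compl_abs_ge0 compl_abs_eq0 compl_absM compl_absD.

Lemma compl_abs_emb x : compl_abs (compl_emb x) = w x.
Proof.
change (compl_abs_fun (\pi_Kw (cst_seq x)) = w x).
apply: compl_abs_unique => /=.
exact: (@cvg_cst _ (w x)).
Qed.

Lemma compl_abs_approx (c : cauchy_seq w) : cvgs compl_abs (fun n => compl_emb (c n)) (\pi_Kw c).
Proof.
move=> e e0; have e20 : 0 < e / 2 by rewrite divr_gt0.
have /asboolP/(_ _ e20)[n0 hn0] := cauchy_valP c; exists n0 => n n0n.
change (compl_abs (\pi_Kw (cst_seq (c n)) - \pi_Kw c) < e).
rewrite -rmorphB; apply: (@le_lt_trans _ _ (e / 2)); last by rewrite ltr_pdivrMr //; lra.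
apply: (cvgr_to_le (@compl_absE _)); exists n0 => // m /= n0m; exact/ltW/hn0.
Qed.

Lemma compl_emb_dense z e : 0 < e -> exists x, compl_abs (z - compl_emb x) < e.
Proof.
have [c ->] := compl_surj z => /(compl_abs_approx c)[n /(_ n (leqnn n)) cn].
by exists (c n); rewrite -opprB absvalN.
Qed.

(** A Cauchy sequence of the completion is followed, up to [1/(n+1)], by a
    sequence of [K]; the class of the latter is the limit. *)
Lemma compl_abs_complete : complete_absval compl_abs.
Proof.
move=> u /asboolP uc.
have /choice[x hx] n : exists x, compl_abs (u n - compl_emb x) < n.+1%:R^-1.
  by apply: compl_emb_dense; rewrite invr_gt0.
have xc : x \in is_cauchy w.
  apply/asboolP => e e0; have e30 : 0 < e / 3 by rewrite divr_gt0.
  have [n1 h1] := inv_succ_lt e30; have [n2 h2] := uc _ e30.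
  exists (maxn n1 n2) => m n; rewrite !geq_max => /andP[m1 m2] /andP[k1 k2].
  rewrite -compl_abs_emb rmorphB.
  have -> : compl_emb (x m) - compl_emb (x n) =
    - (u m - compl_emb (x m)) + ((u m - u n) + (u n - compl_emb (x n))) by ring.
  have := absvalD compl_abs (- (u m - compl_emb (x m))) ((u m - u n) + (u n - compl_emb (x n))).
  have := absvalD compl_abs (u m - u n) (u n - compl_emb (x n)).
  have := lt_trans (hx m) (h1 _ m1); have := lt_trans (hx n) (h1 _ k1).
  have := h2 _ _ m2 k2; rewrite [compl_abs (- _)]absvalN; lra.
exists (\pi_Kw (CauchySeq xc)) => e e0.
have e20 : 0 < e / 2 by rewrite divr_gt0.
have [n1 h1] := inv_succ_lt e20; have [n2 h2] := compl_abs_approx (CauchySeq xc) e20.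
exists (maxn n1 n2) => n; rewrite !geq_max => /andP[k1 k2].
have -> (l : Kw) : u n - l = (u n - compl_emb (x n)) + (compl_emb (x n) - l) by ring.
apply: le_lt_trans (absvalD _ _ _) _.
by rewrite [e]splitr ltrD ?h2 // (lt_trans (hx n)) ?h1.
Qed.

End Completion.

Section CompletionMap.
Local Open Scope quotient_scope.
Context (R : realType) (K1 K2 : fieldType) (w1 : absval R K1) (w2 : absval R K2).
Context (f : {rmorphism K1 -> K2}) (fw : forall x, w2 (f x) = w1 x).

Lemma map_cauchy (c : cauchy_seq w1) : (fun n => f (c n)) \in is_cauchy w2.
Proof.
apply/asboolP => e e0; have /asboolP/(_ _ e0)[n0 h] := cauchy_valP c.
by exists n0 => m n m0 n0n; rewrite -rmorphB fw h.
Qed.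

(** The map between completions that extends an isometric embedding of fields. *)
Definition compl_map_fun (z : completion w1) : completion w2 :=
  \pi_(completion w2) (CauchySeq (map_cauchy (repr z))).

Lemma compl_mapE (c : cauchy_seq w1) :
  compl_map_fun (\pi_(completion w1) c) = \pi_(completion w2) (CauchySeq (map_cauchy c)).
Proof.
apply/compl_eqP => e e0.
have : \pi_(completion w1) (repr (\pi_(completion w1) c)) = \pi_(completion w1) c.
  by rewrite reprK.
move=> /compl_eqP/(_ _ e0)[n0 h]; exists n0 => n /h.
by rewrite -fw rmorphB.
Qed.

Lemma compl_map_zmod : zmod_morphism compl_map_fun.
Proof.
move=> x y; have [c ->] := compl_surj x; have [d ->] := compl_surj y.
rewrite -rmorphB !compl_mapE -rmorphB; congr (\pi_(completion w2) _).
by apply: cauchy_seqP => n /=; exact: rmorphB.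
Qed.

Lemma compl_map_monoid : monoid_morphism compl_map_fun.
Proof.
split.
  have pi1 : \pi_(completion w1) 1 = 1 := rmorph1 _.
  have pi2 : \pi_(completion w2) 1 = 1 := rmorph1 _.
  rewrite -pi1 compl_mapE -[RHS]pi2; congr (\pi_(completion w2) _).
  by apply: cauchy_seqP => n /=; exact: rmorph1.
move=> x y; have [c ->] := compl_surj x; have [d ->] := compl_surj y.
rewrite -rmorphM !compl_mapE -rmorphM; congr (\pi_(completion w2) _).
by apply: cauchy_seqP => n /=; exact: rmorphM.
Qed.

HB.instance Definition _ :=
  GRing.isZmodMorphism.Build (completion w1) (completion w2) compl_map_fun compl_map_zmod.
HB.instance Definition _ :=
  GRing.isMonoidMorphism.Build (completion w1) (completion w2) compl_map_fun compl_map_monoid.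

Definition compl_map : {rmorphism completion w1 -> completion w2} := compl_map_fun.

Lemma compl_abs_map z : compl_abs w2 (compl_map z) = compl_abs w1 z.
Proof.
have [c ->] := compl_surj z; rewrite /compl_map /= compl_mapE; apply: compl_abs_unique => /=.
by under eq_fun do rewrite fw; exact: (@compl_absE _ _ w1 c).
Qed.

Lemma compl_map_emb x : compl_map (compl_emb w1 x) = compl_emb w2 (f x).
Proof. by rewrite /compl_map /= compl_mapE; congr (\pi_(completion w2) _); exact: cauchy_seqP. Qed.

End CompletionMap.

Section RationalCompletion.
Local Open Scope quotient_scope.

(** The closure of the rational numbers in the completion of [K] at [w] is the
    image of the completion of the field of rational numbers. *)
Lemma rational_completionE (R : realType) (K : fieldType) (a : absval R rat)
  (w : place R K) (f : {rmorphism rat -> K}) (fw : forall x, w (f x) = a x) :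
  @rational_completion R K w = range (compl_map fw).
Proof.
have fE x : f x = ratr x.
  rewrite -{1}(divq_num_den x) rmorphM fmorphV !rmorph_int.
  by rewrite /ratr.
apply/seteqP; split=> [z [c [crat ->]]|_ [z _ <-]]; last first.
  have [c ->] := compl_surj z; rewrite /compl_map /= compl_mapE.
  exists (CauchySeq (map_cauchy fw c)); split=> // n /=.
  by exists (c n) => //; rewrite fE.
have /choice[d dc] n : exists d, ratr d = c n.
  by have [d _ <-] := crat n; exists d.
have dcau : d \in is_cauchy a.
  apply/asboolP => e e0; have /asboolP/(_ _ e0)[n0 h] := cauchy_valP c.
  by exists n0 => m n m0 n0n; rewrite -fw rmorphB !fE !dc h.
exists (\pi_(completion a) (CauchySeq dcau)) => //.
rewrite /compl_map /= compl_mapE; congr (\pi_(completion w) _).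
by apply: cauchy_seqP => n /=; rewrite fE dc.
Qed.

End RationalCompletion.

(** * Extension of an absolute value to k[X]/(p) *)

Lemma modp_sum (k : fieldType) (p : {poly k}) (I : Type) (r : seq I)
    (f : I -> {poly k}) :
  (\sum_(i <- r) f i) %% p = \sum_(i <- r) (f i %% p).
Proof.
by elim/big_rec2 : _ => [|i x y _ <-]; rewrite ?mod0p ?modpD.
Qed.

Section ModMatrix.
Context (k : fieldType) (p : {poly k}) (d : nat) (pd : size p = d.+1).

(** Multiplication by [h] on [k[X]/(p)], in the basis of the powers of [X]. *)
Definition modmx (h : {poly k}) : 'M[k]_d :=
  \matrix_(i, j) ((h * 'X^i) %% p)`_j.

(** The norm of the class of [h] in [k[X]/(p)] over [k]. *)
Definition modnorm (h : {poly k}) : k := \det (modmx h).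

Lemma p_neq0 : p != 0. Proof. by rewrite -size_poly_eq0 pd. Qed.

Lemma size_modp h : (size (h %% p)%R <= d)%N.
Proof. by rewrite -ltnS -pd ltn_modp p_neq0. Qed.

Lemma modmxE (u : 'rV[k]_d) h : u *m modmx h = poly_rV ((rVpoly u * h) %% p).
Proof.
rewrite {1 2}[u]row_sum_delta mulmx_suml linear_sum mulr_suml.
rewrite modp_sum.
rewrite linear_sum; apply: eq_bigr => i _.
rewrite linearZ /= rVpoly_delta -scalerAl modpZl linearZ /= -scalemxAl.
congr (_ *: _); rewrite -rowE; apply/rowP => j.
by rewrite !mxE mulrC.
Qed.

Lemma modmxM g h : modmx (g * h) = modmx g *m modmx h.
Proof.
apply/row_matrixP => i; rewrite row_mul.
have rowE' f : row i (modmx f) = poly_rV ((f * 'X^i) %% p).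
  by apply/rowP => j; rewrite !mxE.
rewrite !rowE' modmxE poly_rV_K ?size_modp // [in RHS]mulrC modp_mul.
by congr (poly_rV (_ %% _)); ring.
Qed.

Lemma modmx_mod h : modmx (h %% p) = modmx h.
Proof. by apply/matrixP => i j; rewrite !mxE mulrC modp_mul mulrC. Qed.

Lemma modmxC c : modmx c%:P = c%:M.
Proof.
apply/matrixP => i j; rewrite !mxE mul_polyC modpZl modp_small.
  by rewrite coefZ coefXn -val_eqE eq_sym mulr_natr.
by rewrite size_polyXn pd ltnS.
Qed.

Lemma modmx_sum (z : 'rV[k]_d) i j :
  modmx (rVpoly z) i j = \sum_l z 0 l * modmx 'X^l i j.
Proof.
rewrite !mxE {1}[z]row_sum_delta linear_sum mulr_suml.
rewrite modp_sum.
rewrite coef_sum; apply: eq_bigr => l _.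
by rewrite linearZ /= rVpoly_delta -scalerAl modpZl coefZ mxE.
Qed.

Lemma modnormM g h : modnorm (g * h) = modnorm g * modnorm h.
Proof. by rewrite /modnorm modmxM det_mulmx. Qed.

Lemma modnorm_mod h : modnorm (h %% p) = modnorm h.
Proof. by rewrite /modnorm modmx_mod. Qed.

Lemma modnormC c : modnorm c%:P = c ^+ d.
Proof. by rewrite /modnorm modmxC det_scalar. Qed.

Context (p_irr : irreducible_poly p).

(** If [p] does not divide [h], then [h] is invertible modulo [p] by Bezout, and
    the norm is multiplicative. *)
Lemma modnorm_eq0 h : (modnorm h == 0) = (p %| h).
Proof.
have d0 : (0 < d)%N by rewrite -ltnS -pd; case: p_irr.
apply/idP/idP => [h0|]; last first.
  rewrite -modnorm_mod /dvdp => /eqP ->.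
  by rewrite -[0]/(0%:P) modnormC expr0n eqn0Ngt d0.
apply: contraTT h0 => nph.
have : coprimep h p.
  by rewrite coprimep_sym irreducible_poly_coprime.
move=> /Bezout_eq1_coprimepP[[u v] /= uv].
have := congr1 (fun f => modnorm (f %% p)) uv.
rewrite /= modpD modp_mull addr0 !modnorm_mod modnormM -[1]/(1%:P) modnormC expr1n.
by move=> e; apply/eqP => h0; move/eqP: e; rewrite h0 mulr0 eq_sym oner_eq0.
Qed.

End ModMatrix.

(** The matrix of multiplication by [X] is the companion matrix. *)
Lemma modnormX (k : fieldType) (p : {poly k}) (d : nat) : size p = d.+1 ->
  p \is monic -> modnorm p d 'X = (-1) ^+ d * p`_0.
Proof.
move=> pd pm; have dE : d = (size p).-1 by rewrite pd.
subst d; have p_gt0 : (size p).-1.+1 = size p by rewrite -pd.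
have := char_poly_det (companionmx p); rewrite companionmxK // => ->.
rewrite mulrA -expr2 sqrr_sign mul1r.
congr (\det _); apply/matrixP => i j; rewrite !mxE -exprS.
have [iE|iN] := eqVneq (i : nat) (size p).-2.
  have -> : i.+1 = (size p).-1 by rewrite iE prednK // (leq_ltn_trans _ (ltn_ord i)).
  have -> : 'X^((size p).-1) = p + ('X^((size p).-1) - p) by ring.
  rewrite modpD modpp add0r modp_small.
    by rewrite coefB coefXn ltn_eqF // sub0r.
  rewrite -p_gt0 ltnS; apply/leq_sizeP => l; rewrite leq_eqVlt => /orP[/eqP <-|lp].
    by rewrite coefB coefXn eqxx -lead_coefE (monicP pm) subrr.
  by rewrite coefB coefXn gtn_eqF // nth_default ?subr0 // -p_gt0.
rewrite modp_small ?coefXn 1?eq_sym //.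
apply: (@leq_trans (size p).-1.+1); last by rewrite p_gt0.
rewrite size_polyXn ltnS ltn_neqAle ltn_ord andbT.
by apply: contra iN => /eqP e; apply/eqP/succn_inj; rewrite e prednK // -e.
Qed.

Section LocalNorm.
Context (R : realType) (k : fieldType) (a : absval R k).
Hypothesis k_complete : complete_absval a.
Hypothesis k_bounded : forall e : R, 0 < e ->
  exists s : seq k, forall z, a z <= 1 -> exists2 c, c \in s & a (z - c) < e.

(** An ultrafilter containing the tails chooses one ball of every finite
    covering, for all coordinates at once; the centres form a Cauchy sequence. *)
Lemma cluster_point d (z : nat -> 'rV[k]_d) : (forall m i, a (z m 0 i) <= 1) ->
  exists l : 'rV[k]_d, forall (e : R) (m0 : nat), 0 < e ->
    exists2 m, (m0 <= m)%N & forall i, a (z m 0 i - l 0 i) < e.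
Proof.
move=> z1.
have [G [GU G_oo]] := @ultraFilterLemma _ \oo _.
have pigeon (I : eqType) (s : seq I) (A : I -> set nat) :
    G [set m | exists2 c, c \in s & A c m] -> exists c, G (A c).
  elim: s => [|c s IH].
    move=> /filter_ex[m [c]]; by rewrite in_nil.
  have [|Gc] := in_ultra_setVsetC (A c) GU; first by exists c.
  move=> Gs; apply: IH; apply: filterS2 Gc Gs => m nA [c'].
  by rewrite inE => /orP[/eqP ->//|c's Ac']; exists c'.
have center i (e : R) : 0 < e -> exists c, G [set m | a (z m 0 i - c) < e].
  move=> /k_bounded[s hs]; apply: (pigeon _ s) => //.
  by apply: filterS filterT => m _; exact/hs/z1.
have inv0 n : 0 < n.+1%:R^-1 :> R by rewrite invr_gt0.
have coord i : exists l, forall e : R, 0 < e -> G [set m | a (z m 0 i - l) < e].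
  have /choice[c hc] n := center i _ (inv0 n).
  have [|l hl] := k_complete (u := c).
    apply/asboolP => e e0; have [|n0 h] := @inv_succ_lt R (e / 2); first by rewrite divr_gt0.
    exists n0 => m n /h hm /h hn.
    have [q [qm qn]] := filter_ex (filterI (hc m) (hc n)).
    have -> : c m - c n = (z q 0 i - c n) - (z q 0 i - c m) by ring.
    apply: le_lt_trans (absvalB _ _ _) _; rewrite [e]splitr.
    by apply: ltrD; [apply: lt_trans qn hn|apply: lt_trans qm hm].
  exists l => e e0; have e20 : 0 < e / 2 by rewrite divr_gt0.
  have [n1 h1] := inv_succ_lt e20; have [n2 h2] := hl _ e20.
  have Gn := hc (maxn n1 n2); apply: filterS Gn => m /= zm.
  have -> : z m 0 i - l = (z m 0 i - c (maxn n1 n2)) + (c (maxn n1 n2) - l) by ring.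
  apply: le_lt_trans (absvalD _ _ _) _; rewrite [e]splitr ltrD //.
    by apply: lt_trans zm (h1 _ (leq_maxl _ _)).
  exact/h2/leq_maxr.
have /choice[l hl] := coord.
exists (\row_i l i) => e m0 e0.
have Gall : \forall m \near G, forall i, a (z m 0 i - (\row_i l i) 0 i) < e.
  by apply: filter_forall => i; apply: filterS (hl i e e0) => m /=; rewrite mxE.
have Gm0 : G [set m | (m0 <= m)%N] by apply: G_oo; exists m0.
by have [m [? ?]] := filter_ex (filterI Gm0 Gall); exists m.
Qed.

(** Functions of the coordinates that are continuous at a point form a ring;
    this covers determinants. *)
Definition cont_at d (l : 'rV[k]_d) (G : 'rV[k]_d -> k) :=
  forall e : R, 0 < e -> exists2 e' : R, 0 < e' &
    forall z : 'rV[k]_d, (forall i, a (z 0 i - l 0 i) < e') -> a (G z - G l) < e.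

Lemma cont_cst d (l : 'rV[k]_d) c : cont_at l (fun=> c).
Proof. by move=> e e0; exists 1 => // z _; rewrite subrr absval0. Qed.

Lemma cont_coord d (l : 'rV[k]_d) i : cont_at l (fun z => z 0 i).
Proof. by move=> e e0; exists e. Qed.

Lemma contD d (l : 'rV[k]_d) F G :
  cont_at l F -> cont_at l G -> cont_at l (fun z => F z + G z).
Proof.
move=> hF hG e e0; have e20 : 0 < e / 2 by rewrite divr_gt0.
have [e1 e10 h1] := hF _ e20; have [e2 e20' h2] := hG _ e20.
exists (Num.min e1 e2) => [|z hz]; first by rewrite lt_min e10.
have -> : F z + G z - (F l + G l) = (F z - F l) + (G z - G l) by ring.
apply: le_lt_trans (absvalD _ _ _) _; rewrite [e]splitr ltrD //.
  by apply: h1 => i; have := hz i; rewrite lt_min => /andP[].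
by apply: h2 => i; have := hz i; rewrite lt_min => /andP[].
Qed.

Lemma contM d (l : 'rV[k]_d) F G :
  cont_at l F -> cont_at l G -> cont_at l (fun z => F z * G z).
Proof.
move=> hF hG e e0.
pose A := a (F l) + 1; pose B := a (G l) + 1.
have A0 : 0 < A by rewrite ltr_wpDl ?absval_ge0.
have B0 : 0 < B by rewrite ltr_wpDl ?absval_ge0.
have eB : 0 < e / 2 / B by rewrite !divr_gt0.
have eA : 0 < e / 2 / A by rewrite !divr_gt0.
have [e1 e10 h1] := hF _ eB; have [e2 e20 h2] := hG _ eA.
have [e3 e30 h3] := hG _ ltr01.
exists (Num.min e1 (Num.min e2 e3)) => [|z hz]; first by rewrite !lt_min e10 e20.
have [{}h1 {}h2 {}h3] : [/\ a (F z - F l) < e / 2 / B, a (G z - G l) < e / 2 / A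
    & a (G z - G l) < 1].
  by split; [apply: h1|apply: h2|apply: h3] => i; have := hz i;
    rewrite !lt_min => /and3P[].
have -> : F z * G z - F l * G l = (F z - F l) * G z + F l * (G z - G l) by ring.
apply: le_lt_trans (absvalD _ _ _) _; rewrite [e]splitr !absvalM ltrD //.
  apply: (@le_lt_trans _ _ (a (F z - F l) * B)); last by rewrite -ltr_pdivlMr.
  rewrite ler_wpM2l ?absval_ge0 // -[G z](subrK (G l)).
  by apply: le_trans (absvalD _ _ _) _; rewrite addrC lerD2l ltW.
rewrite mulrC; apply: (@le_lt_trans _ _ (a (G z - G l) * A)); last by rewrite -ltr_pdivlMr.
by rewrite ler_wpM2l ?absval_ge0 // lerDl.
Qed.

Lemma cont_sum d (l : 'rV[k]_d) (I : Type) (r : seq I) (F : I -> 'rV[k]_d -> k) :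
  (forall i, cont_at l (F i)) -> cont_at l (fun z => \sum_(i <- r) F i z).
Proof.
move=> hF; elim: r => [|i r IH].
  by under eq_fun do rewrite big_nil; exact: cont_cst.
by under eq_fun do rewrite big_cons; exact: contD.
Qed.

Lemma cont_prod d (l : 'rV[k]_d) (I : Type) (r : seq I) (F : I -> 'rV[k]_d -> k) :
  (forall i, cont_at l (F i)) -> cont_at l (fun z => \prod_(i <- r) F i z).
Proof.
move=> hF; elim: r => [|i r IH].
  by under eq_fun do rewrite big_nil; exact: cont_cst.
by under eq_fun do rewrite big_cons; exact: contM.
Qed.

Section Irreducible.
Context (p : {poly k}) (d : nat) (pd : size p = d.+1) (p_irr : irreducible_poly p).

Let d_gt0 : (0 < d)%N. Proof. by rewrite -ltnS -pd; case: p_irr. Qed.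

Lemma cont_modnorm l : cont_at l (fun z : 'rV[k]_d => modnorm p d (rVpoly z)).
Proof.
rewrite /modnorm /determinant; apply: cont_sum => s; apply: contM; first exact: cont_cst.
apply: cont_prod => i; under eq_fun do rewrite modmx_sum.
by apply: cont_sum => j; apply: contM; [exact: cont_coord|exact: cont_cst].
Qed.

(** By compactness: otherwise a sequence of vectors with a coordinate equal to 1
    and norms tending to 0 would cluster at a nonzero element of the field
    [k[X]/(p)] with norm zero. *)
Lemma modnorm_lower : exists2 C : R, 0 < C &
  forall h (i : 'I_d), a (h %% p)`_i ^+ d <= C * a (modnorm p d h).
Proof.
apply: contrapT => no.
have {no} bad n : exists z : 'rV[k]_d,
    [/\ forall i, a (z 0 i) <= 1, exists i, z 0 i = 1
      & a (modnorm p d (rVpoly z)) < n.+1%:R^-1].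
  apply: contrapT => noz; apply: no; exists n.+1%:R => // h i.
  rewrite leNgt; apply/negP => hi.
  pose u := poly_rV (h %% p) : 'rV[k]_d.
  have uE j : u 0 j = (h %% p)`_j by rewrite mxE.
  (* Division by the largest coordinate. *)
  pose j := [arg max_(j > i) a (u 0 j)]%O.
  have jmax l : a (u 0 l) <= a (u 0 j).
    by rewrite /j; case: arg_maxP => // j' _; apply.
  have {}hi : n.+1%:R * a (modnorm p d h) < a (u 0 j) ^+ d.
    by apply: lt_le_trans hi _; rewrite -uE lerXn2r ?nnegrE ?absval_ge0.
  have uj0 : u 0 j != 0.
    apply/eqP => uj; move: hi; rewrite uj absval0 expr0n eqn0Ngt d_gt0 /=.
    by apply/negP; rewrite -leNgt mulr_ge0 ?absval_ge0.
  apply: noz; exists ((u 0 j)^-1 *: u); split.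
  - move=> l; rewrite mxE absvalM absvalV // ler_pdivrMl ?absval_gt0 // mulr1.
    exact: jmax.
  - by exists j; rewrite mxE mulVf.
  - rewrite linearZ /= -mul_polyC (modnormM pd) (modnormC pd).
    rewrite poly_rV_K ?(size_modp pd) // (modnorm_mod p d) absvalM absvalX absvalV // exprVn.
    rewrite mulrC ltr_pdivrMr ?exprn_gt0 ?absval_gt0 // mulrC ltr_pdivlMr //.
    by rewrite mulrC.
have /choice[z hz] := bad.
have [|l hl] := @cluster_point d z; first by move=> m i; case: (hz m).
have : rVpoly l != 0.
  apply/eqP => l0; have [|m _ hm] := hl (1 / 2) 0%N; first by rewrite divr_gt0.
  have [_ [i zi] _] := hz m; have := hm i; rewrite zi.
  have -> : l 0 i = 0 by rewrite -coef_rVpoly_ord l0 coef0.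
  by rewrite subr0 absval1; lra.
apply/negP; rewrite negbK.
have : modnorm p d (rVpoly l) = 0.
  apply: (absval_eq0_small (w := a)) => e e0.
  have [|e' e'0 he'] := @cont_modnorm l (e / 2); first by rewrite divr_gt0.
  have [m me hm] := hl e' (Num.bound (e / 2)^-1) e'0.
  have := he' _ hm; have [_ _ zm] := hz m => h.
  rewrite -[modnorm _ _ _](subKr (modnorm p d (rVpoly (z m)))).
  apply: le_lt_trans (absvalB _ _ _) _; rewrite [e]splitr addrC ltrD //.
  apply: lt_trans zm _; rewrite invf_plt ?posrE ?divr_gt0 //.
  apply: lt_le_trans (archi_boundP _) _; first by rewrite invr_ge0 ltW // divr_gt0.
  by rewrite ler_nat ltnW.
move/eqP; rewrite (modnorm_eq0 pd p_irr) /dvdp modp_small //.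
by rewrite pd ltnS (leq_trans (size_poly _ _)).
Qed.

(** The norm is homogeneous of degree [d] in the coordinates. *)
Lemma modnorm_upper : exists2 C : R, 0 < C & forall h (M : R),
  (forall i : 'I_d, a (h %% p)`_i <= M) -> a (modnorm p d h) <= C * M ^+ d.
Proof.
pose B := 1 + \sum_i \sum_j \sum_(l < d) a (modmx p d 'X^l i j).
have B0 : 0 < B by rewrite ltr_pwDl // !sumr_ge0 // => *; rewrite !sumr_ge0 // => *;
  rewrite !sumr_ge0 // => *; exact: absval_ge0.
exists (#|{perm 'I_d}|%:R * B ^+ d).
  rewrite mulr_gt0 ?exprn_gt0 // ltr0n; apply/card_gt0P; by exists (perm_one _).
move=> h M hM.
have M0 : 0 <= M by apply: le_trans (hM (Ordinal d_gt0)); exact: absval_ge0.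
have entry i j : a (modmx p d h i j) <= B * M.
  rewrite -(modmx_mod p d) -[h %% p](@poly_rV_K _ d) ?(size_modp pd) // modmx_sum.
  apply: le_trans (absval_sum _ _ _ _) _.
  apply: (@le_trans _ _ (\sum_(l < d) M * a (modmx p d 'X^l i j))).
    by apply: ler_sum => l _; rewrite absvalM ler_wpM2r ?absval_ge0 // mxE.
  rewrite -mulr_sumr mulrC ler_wpM2r // /B.
  apply: (@le_trans _ _ (\sum_j \sum_(l < d) a (modmx p d 'X^l i j))).
    rewrite [leRHS](bigD1 j) //= lerDl sumr_ge0 // => *.
    by rewrite sumr_ge0 // => *; exact: absval_ge0.
  apply: ler_wpDl => //; rewrite [leRHS](bigD1 i) //= lerDl sumr_ge0 // => *.
  by rewrite sumr_ge0 // => *; rewrite sumr_ge0 // => *; exact: absval_ge0.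
rewrite -mulrA -exprMn /modnorm /determinant.
apply: le_trans (absval_sum _ _ _ _) _.
rewrite mulr_natl -sumr_const; apply: ler_sum => s _.
rewrite absvalM absvalX absvalN absval1 expr1n mul1r absval_prod.
rewrite -[d in leRHS]card_ord -prodr_const; apply: ler_prod => i _.
by rewrite absval_ge0 entry.
Qed.

(** The unique extension of [a] to the field [k[X]/(p)], composed with the
    projection from [k[X]]. *)
Definition ext_abs (h : {poly k}) : R := a (modnorm p d h) `^ d%:R^-1.

Lemma ext_abs_ge0 h : 0 <= ext_abs h. Proof. exact: powR_ge0. Qed.

Lemma ext_absXd h : ext_abs h ^+ d = a (modnorm p d h).
Proof.
rewrite -powR_mulrn ?ext_abs_ge0 // -powRrM mulVf ?pnatr_eq0 -?lt0n //.
by rewrite powRr1 // absval_ge0.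
Qed.

Lemma ext_abs_uniq h (x : R) : 0 <= x -> x ^+ d = a (modnorm p d h) -> ext_abs h = x.
Proof.
by move=> x0 xd; apply/eqP; rewrite -(@eqrXn2 _ d) ?ext_abs_ge0 // ext_absXd xd.
Qed.

Lemma ext_absM g h : ext_abs (g * h) = ext_abs g * ext_abs h.
Proof. by rewrite /ext_abs (modnormM pd) absvalM powRM ?absval_ge0. Qed.

Lemma ext_absC c : ext_abs c%:P = a c.
Proof. by apply: ext_abs_uniq; rewrite ?absval_ge0 // (modnormC pd) absvalX. Qed.

Lemma ext_absX h n : ext_abs (h ^+ n) = ext_abs h ^+ n.
Proof.
by elim: n => [|n IH]; rewrite ?expr0 -?[1]/(1%:P) ?ext_absC ?absval1 // !exprS ext_absM IH.
Qed.

Lemma ext_abs_mod h : ext_abs (h %% p) = ext_abs h.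
Proof. by rewrite /ext_abs (modnorm_mod p d). Qed.

Lemma ext_abs_lower : exists2 C : R, 0 < C &
  forall h (i : 'I_d), a (h %% p)`_i <= C * ext_abs h.
Proof.
have [C C0 hC] := modnorm_lower; exists (1 + C); first by rewrite addr_gt0.
move=> h i; rewrite -(@ler_pXn2r _ d) ?nnegrE ?absval_ge0 ?mulr_ge0 ?ext_abs_ge0 ?addr_ge0 ?(ltW C0) //.
apply: le_trans (hC h i) _; rewrite exprMn ext_absXd ler_wpM2r ?absval_ge0 //.
apply: (@le_trans _ _ (1 + C)); first by rewrite lerDr.
by rewrite ler_eXnr // lerDl ltW.
Qed.

Lemma ext_abs_upper : exists2 C : R, 0 < C & forall h (M : R),
  (forall i : 'I_d, a (h %% p)`_i <= M) -> ext_abs h <= C * M.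
Proof.
have [C C0 hC] := modnorm_upper; exists (1 + C); first by rewrite addr_gt0.
move=> h M hM.
have M0 : 0 <= M by apply: le_trans (hM (Ordinal d_gt0)); exact: absval_ge0.
rewrite -(@ler_pXn2r _ d) ?nnegrE ?mulr_ge0 ?ext_abs_ge0 ?addr_ge0 ?(ltW C0) //.
rewrite ext_absXd; apply: le_trans (hC h M hM) _; rewrite exprMn ler_wpM2r ?exprn_ge0 //.
apply: (@le_trans _ _ (1 + C)); first by rewrite lerDr.
by rewrite ler_eXnr // lerDl ltW.
Qed.

(** Expand a high power of the sum and compare with the coordinates, on which
    the triangle inequality is that of [a]: the constants disappear in the
    limit. *)
Lemma ext_absD g h : ext_abs (g + h) <= ext_abs g + ext_abs h.
Proof.
have [C1 C10 h1] := ext_abs_lower; have [C2 C20 h2] := ext_abs_upper.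
apply: (@ler_of_powers _ _ _ (C2 * C1)); rewrite ?addr_ge0 ?ext_abs_ge0 // => m.
rewrite -ext_absX -mulrA; apply: h2 => i.
rewrite exprDn modp_sum coef_sum; apply: le_trans (absval_sum _ _ _ _) _.
rewrite exprDn mulr_sumr; apply: ler_sum => j _.
rewrite -mulr_natl -(rmorph_nat polyC) mul_polyC modpZl coefZ absvalM.
rewrite -[X in _ <= C1 * X]mulr_natl [leRHS]mulrCA ler_pM ?absval_ge0 ?absval_nat //.
by apply: le_trans (h1 _ _) _; rewrite ext_absM !ext_absX.
Qed.

(** The constant [C] disappears on comparing high powers: any other extension of
    [a] is dominated by [ext_abs] in this way. *)
Lemma ext_abs_dominates (b : {poly k} -> R) (C : R) :
  (forall h, 0 <= b h) -> (forall h n, b (h ^+ n) = b h ^+ n) ->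
  (forall h M, (forall i : 'I_d, a (h %% p)`_i <= M) -> b h <= C * M) ->
  forall h, b h <= ext_abs h.
Proof.
move=> b0 bX bC h; have [C1 C10 h1] := ext_abs_lower.
apply: (@ler_of_powers _ _ _ (C * C1)); rewrite ?ext_abs_ge0 // => m.
by rewrite -bX -mulrA -ext_absX; apply: bC => i; exact: h1.
Qed.

End Irreducible.
End LocalNorm.

(** * The places of the field of rational numbers *)

Section RationalPlaces.
Context (R : realType).
Implicit Type v : place_Q.
Local Notation nv v := (normalized_abs R v : int -> R).

Lemma nabs_p (p : nat) (pp : prime p) (n : int) : n != 0 ->
  nv (finite_place pp) n = p%:R ^- logn p `|n|%N.
Proof. by move=> n0 /=; rewrite (negbTE n0). Qed.

Lemma nabs0 v : nv v 0 = 0.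
Proof. by case: v => [|p pp] /=; rewrite ?normr0. Qed.

Lemma nabs1 v : nv v 1 = 1.
Proof. by case: v => [|p pp] /=; rewrite ?normr1 // logn1 expr0 invr1. Qed.

Lemma nabs_ge0 v n : 0 <= nv v n.
Proof.
case: v => [|p pp] /=; first by rewrite ler0z.
by case: ifP => // _; rewrite invr_ge0 exprn_ge0.
Qed.

Lemma nabs_gt0 v n : n != 0 -> 0 < nv v n.
Proof.
move=> n0; case: v => [|p pp]; first by rewrite /= ltr0z normr_gt0.
by rewrite nabs_p // invr_gt0 exprn_gt0 // ltr0n prime_gt0.
Qed.

Lemma nabsM v m n : nv v (m * n) = nv v m * nv v n.
Proof.
case: v => [|p pp]; first by rewrite /= normrM rmorphM.
have [->|m0] := eqVneq m 0; first by rewrite mul0r !nabs0 mul0r.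
have [->|n0] := eqVneq n 0; first by rewrite mulr0 !nabs0 mulr0.
rewrite !nabs_p ?mulf_neq0 // abszM lognM ?absz_gt0 // exprD.
by rewrite invfM.
Qed.

(** The power of [p] that divides both integers divides their sum. *)
Lemma nabs_ultra p (pp : prime p) m n :
  nv (finite_place pp) (m + n) <=
    Num.max (nv (finite_place pp) m) (nv (finite_place pp) n).
Proof.
have p0 : 0 < p%:R :> R by rewrite ltr0n prime_gt0.
have p1 : 1 <= p%:R :> R by rewrite ler1n prime_gt0.
wlog : m n / nv (finite_place pp) n <= nv (finite_place pp) m.
  move=> W; have /orP[] := le_total (nv (finite_place pp) n) (nv (finite_place pp) m).
    exact: W.
  by move/W; rewrite addrC maxC.
have [->|n0] := eqVneq n 0; first by move=> _; rewrite addr0 le_max lexx.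
have [->|m0] := eqVneq m 0; first by move=> _; rewrite add0r le_max lexx orbT.
have [->|s0] := eqVneq (m + n) 0.
  by move=> _; rewrite nabs0 le_max nabs_ge0.
rewrite le_max !nabs_p // => h; apply/orP; left; move: h.
rewrite !lef_pV2 ?posrE ?exprn_gt0 // => h.
have {}h : (logn p `|m| <= logn p `|n|)%N.
  by move: h; rewrite ler_eXn2l // ltr1n prime_gt1.
apply: ler_weXn2l => //.
rewrite -pfactor_dvdn ?absz_gt0 //.
have : ((p ^ logn p `|m|)%N%:Z %| m + n)%Z.
  by apply: rpredD; rewrite dvdzE /= pfactor_dvdn ?absz_gt0.
by rewrite dvdzE.
Qed.

Lemma nabsD v m n : nv v (m + n) <= nv v m + nv v n.
Proof.
case: v => [|p pp]; first by rewrite /= -rmorphD ler_int ler_normD.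
apply: le_trans (nabs_ultra _ _ _) _.
by rewrite ge_max lerDl lerDr !nabs_ge0.
Qed.

Lemma nabs_le1 p (pp : prime p) n : nv (finite_place pp) n <= 1.
Proof.
have [->|n0] := eqVneq n 0; first by rewrite nabs0.
rewrite nabs_p // invf_le1 ?exprn_gt0 ?ltr0n ?prime_gt0 //.
by rewrite exprn_ege1 // ler1n prime_gt0.
Qed.

Lemma normalized_abs_inj v v' : (forall n, nv v n = nv v' n) -> v = v'.
Proof.
have pE p (pp : prime p) : nv (finite_place pp) p = p%:R^-1.
  by rewrite nabs_p ?eqz_nat -?lt0n ?prime_gt0 //= (logn_prime p pp) eqxx expr1.
have p1 p (pp : prime p) : p%:R^-1 < 1 :> R.
  by rewrite invf_lt1 ?ltr1n ?ltr0n ?prime_gt1 ?prime_gt0.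
case: v v' => [|p pp] [|q qq] // h.
- have := h q; rewrite pE /= => e; have := p1 q qq; rewrite -e.
  by rewrite ltNge ler1n prime_gt0.
- have := h p; rewrite pE /= => e; have := p1 p pp; rewrite e.
  by rewrite ltNge ler1n prime_gt0.
have e : p = q.
  apply/eqP; apply: contraT => npq; have := h p; rewrite pE nabs_p ?eqz_nat -?lt0n ?prime_gt0 //.
  by rewrite /= logn_prime // eq_sym (negbTE npq) expr0 invr1 => e; have := p1 p pp; rewrite e ltxx.
by subst q; rewrite (Prop_irrelevance pp qq).
Qed.

Definition absQ_fun v (x : rat) : R := nv v (numq x) / nv v (denq x).

Lemma rat_den (x : rat) : x * (denq x)%:~R = (numq x)%:~R.
Proof. by rewrite -{1}(divq_num_den x) divfK // intr_eq0 denq_neq0. Qed.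

(** The value may be read on any fraction, not only on the reduced one. *)
Lemma absQE v (x : rat) (m d : int) : d != 0 -> x * d%:~R = m%:~R ->
  absQ_fun v x = nv v m / nv v d.
Proof.
move=> d0 xd; apply/eqP.
rewrite /absQ_fun eqr_div; [|exact/lt0r_neq0/nabs_gt0/denq_neq0|exact/lt0r_neq0/nabs_gt0].
apply/eqP; rewrite -!nabsM; congr (normalized_abs R v _); apply: (@intr_inj rat).
by rewrite !rmorphM /= -xd -rat_den mulrAC.
Qed.

Lemma absQ_ge0 v x : 0 <= absQ_fun v x.
Proof. by rewrite /absQ_fun divr_ge0 ?nabs_ge0. Qed.

Lemma absQ_eq0 v x : absQ_fun v x = 0 <-> x = 0.
Proof.
split=> [/eqP|->]; last by rewrite (@absQE _ _ 0 1) ?mul0r // nabs0 mul0r.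
rewrite mulf_eq0 invr_eq0 [X in _ || X]gt_eqF ?nabs_gt0 ?denq_neq0 // orbF.
move=> x0; apply/eqP; rewrite -numq_eq0; apply: contraT => /(nabs_gt0 v).
by rewrite (eqP x0) ltxx.
Qed.

Lemma absQM v x y : absQ_fun v (x * y) = absQ_fun v x * absQ_fun v y.
Proof.
rewrite (@absQE _ _ (numq x * numq y) (denq x * denq y)) ?mulf_neq0 ?denq_neq0 //.
  by rewrite !nabsM /absQ_fun mulf_div.
by rewrite !rmorphM /= mulrACA !rat_den.
Qed.

Lemma absQD v x y : absQ_fun v (x + y) <= absQ_fun v x + absQ_fun v y.
Proof.
rewrite (@absQE _ _ (numq x * denq y + numq y * denq x) (denq x * denq y))
  ?mulf_neq0 ?denq_neq0 //; last first.
  by rewrite rmorphD !rmorphM /= -!rat_den; ring.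
have x0 := nabs_gt0 v (denq_neq0 x); have y0 := nabs_gt0 v (denq_neq0 y).
rewrite ler_pdivrMr ?nabs_gt0 ?mulf_neq0 ?denq_neq0 //.
apply: le_trans (nabsD _ _ _) _; rewrite !nabsM /absQ_fun.
move: x0 y0 => /lt0r_neq0 x0 /lt0r_neq0 y0.
rewrite le_eqVlt; apply/orP; left; apply/eqP.
by field; rewrite x0 y0.
Qed.

Definition absQ v : absval R rat :=
  AbsVal (absQ_ge0 v) (absQ_eq0 v) (absQM v) (absQD v).

Lemma absQ_int v (n : int) : absQ v n%:~R = nv v n.
Proof.
by rewrite /= (@absQE _ _ n 1) ?nabs1 ?divr1 // mulr1.
Qed.

Lemma absval_extends_absQ (K : fieldType) (w : absval R K) v (f : {rmorphism rat -> K}) :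
  (forall n : int, w n%:~R = nv v n) -> forall x, w (f x) = absQ v x.
Proof.
move=> wv x; rewrite -{1}(divq_num_den x) rmorphM fmorphV !rmorph_int absvalM.
rewrite absvalV ?wv //; have := nabs_gt0 v (denq_neq0 x); rewrite -wv.
by move/gt_eqF/negbT; apply: contra => /eqP ->; rewrite absval0.
Qed.

Lemma absQ_infinite x : absQ infinite_place x = `|ratr x|.
Proof.
by rewrite /= /absQ_fun /= !intr_norm /ratr normf_div.
Qed.

(** The unit ball of the rational numbers is totally bounded at every place:
    subdivide [-1, 1] at the infinite place, reduce modulo a power of [p] at
    [p]. *)
Lemma absQ_bounded v (e : R) : 0 < e ->
  exists s : seq rat, forall x, absQ v x <= 1 -> exists2 c, c \in s & absQ v (x - c) < e.
Proof.
move=> e0; case: v => [|p pp].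
  pose N := (Num.bound e^-1).+1.
  have N0 : 0 < N%:R :> R by rewrite ltr0n.
  have Ne : N%:R^-1 < e.
    rewrite invf_plt ?posrE //; apply: lt_le_trans (archi_boundP _) _.
      by rewrite invr_ge0 ltW.
    by rewrite ler_nat.
  exists [seq (i%:Z - N%:Z)%:~R / N%:R | i <- iota 0 (N + N).+1] => x.
  rewrite absQ_infinite => x1.
  pose y : R := ratr x.
  have y1 : -1 <= y <= 1 by rewrite -ler_norml.
  pose j := Num.floor (y * N%:R).
  have [j1 j2] : j%:~R <= y * N%:R /\ y * N%:R < (j + 1)%:~R.
    by split; [exact: floor_le|exact: floorD1_gt].
  have jlow : - N%:Z <= j.
    rewrite -ltzD1 -(ltr_int R); apply: le_lt_trans j2.
    by rewrite rmorphN /= -mulN1r ler_wpM2r ?(ltW N0); case/andP: y1.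
  have jup : j <= N%:Z.
    rewrite -(ler_int R); apply: le_trans j1 _.
    by rewrite -[leRHS]mul1r ler_wpM2r ?(ltW N0) //; case/andP: y1.
  exists (j%:~R / N%:R).
    apply/mapP; exists (absz (j + N%:Z)).
      rewrite mem_iota add0n ltnS /= -lez_nat gez0_abs; first by rewrite PoszD lerD2r.
      by rewrite -lerBlDr sub0r.
    by rewrite gez0_abs ?addrK // -lerBlDr sub0r.
  rewrite absQ_infinite rmorphB rmorphM fmorphV /= ratr_int ratr_nat -/y.
  apply: le_lt_trans Ne.
  have -> : y - j%:~R / N%:R = (y * N%:R - j%:~R) / N%:R.
    by rewrite mulrBl mulfK ?gt_eqF.
  rewrite normf_div ger0_norm ?subr_ge0 // (ger0_norm (ler0n R N)).
  rewrite ler_pdivrMr // mulVf ?gt_eqF // lerBlDr.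
  by move: j2; rewrite rmorphD /= addrC => /ltW.
have p0 : 0 < p%:R :> R by rewrite ltr0n prime_gt0.
have p1 : 1 < p%:R :> R by rewrite ltr1n prime_gt1.
have [M Me] : exists M, p%:R ^- M < e.
  exists (Num.bound e^-1); rewrite invf_plt ?posrE ?exprn_gt0 //.
  apply: lt_trans (archi_boundP _) _; first by rewrite invr_ge0 ltW.
  by rewrite -natrX ltr_nat ltn_expl ?prime_gt1.
(* [u] inverts the denominator of [x] modulo [p ^ M], and [j] is the residue of
   [x]. *)
exists [seq i%:R | i <- iota 0 (p ^ M)] => x x1.
have npd : ~~ (p %| `|denq x|)%N.
  apply/negP => pd.
  have np : ~~ (p %| `|numq x|)%N.
    apply/negP => pn; have := coprime_num_den x.
    rewrite /coprime => /eqP g; have := dvdn_gcd p `|numq x| `|denq x|.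
    by rewrite g pn pd dvdn1 => /eqP p1'; have := prime_gt1 pp; rewrite p1'.
  have num0 : numq x != 0 by apply: contraNneq np => ->.
  move: x1; rewrite /= /absQ_fun ler_pdivrMr ?nabs_gt0 ?denq_neq0 // mul1r.
  rewrite !nabs_p ?denq_neq0 // lognE (negbTE np) !andbF expr0 invr1.
  rewrite invf_ge1 ?exprn_gt0 // leNgt => /negP; apply.
  by rewrite exprn_egt1 // -lt0n logn_gt0 mem_primes pp absz_gt0 denq_neq0.
have [u uE] : exists u, (`|denq x| * u)%N = 1 %[mod p ^ M].
  have : coprime `|denq x| (p ^ M).
    by rewrite coprimeXr // coprime_sym prime_coprime.
  rewrite /coprime; have d0 : (0 < `|denq x|)%N by rewrite absz_gt0 denq_neq0.
  case: (egcdnP (p ^ M) d0) => km kn e1 _ /eqP g1; exists km.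
  by rewrite mulnC e1 g1 modnMDl.
have [j jE] : exists j, j = (numq x * u%:Z %% (p ^ M)%N%:Z)%Z by eexists.
have pM0 : (p ^ M)%N%:Z != 0 by rewrite -lt0n expn_gt0 prime_gt0.
have j0 : 0 <= j by rewrite jE modz_ge0.
exists (j%:~R).
  apply/mapP; exists `|j|%N.
    rewrite mem_iota add0n leq0n /= -ltz_nat gez0_abs //.
    by rewrite jE ltz_pmod // ltz_nat expn_gt0 prime_gt0.
  by rewrite -{1}(gez0_abs j0).
apply: le_lt_trans Me.
rewrite /= (@absQE _ _ (numq x - j * denq x) (denq x)) ?denq_neq0 //; last first.
  by rewrite mulrBl rat_den rmorphB /= rmorphM.
have -> : nv (finite_place pp) (denq x) = 1.
  rewrite nabs_p ?denq_neq0 // lognE (negbTE npd) !andbF.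
  by rewrite expr0 invr1.
rewrite divr1.
have : ((p ^ M)%N%:Z %| numq x - j * denq x)%Z.
  have [q qE] : exists q, j = numq x * u%:Z - q * (p ^ M)%N%:Z.
    exists (numq x * u%:Z %/ (p ^ M)%N%:Z)%Z.
    by rewrite jE [X in _ = X - _](divz_eq _ (p ^ M)%N%:Z) addrAC subrr add0r.
  have -> : numq x - j * denq x =
      numq x * (1 - denq x * u%:Z) + q * denq x * (p ^ M)%N%:Z by rewrite qE; ring.
  rewrite rpredD ?dvdz_mull ?dvdzz // -eqz_mod_dvd.
  rewrite -[denq x]gez0_abs ?denq_ge0 // -PoszM !modz_nat eqz_nat.
  by rewrite uE.
have [->|z0] := eqVneq (numq x - j * denq x) 0.
  by rewrite nabs0 invr_ge0 exprn_ge0 // ltW.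
rewrite nabs_p // dvdzE [absz (Posz _)]/= pfactor_dvdn ?absz_gt0 // => h.
rewrite lef_pV2 ?posrE ?exprn_gt0 // ler_weXn2l // ltW //.
Qed.

End RationalPlaces.

HB.instance Definition _ := gen_eqMixin place_Q.
HB.instance Definition _ := gen_choiceMixin place_Q.

Definition prime_place (p : nat) : option place_Q :=
  omap (fun q : {q | prime q} => finite_place (valP q)) (insub p).

Lemma prime_placeT p (pp : prime p) : prime_place p = Some (finite_place pp).
Proof.
rewrite /prime_place insubT /=; congr (Some (finite_place _)).
exact: Prop_irrelevance.
Qed.

Lemma prime_placeF p : ~~ prime p -> prime_place p = None.
Proof. by move=> npp; rewrite /prime_place insubN. Qed.

(** The infinite place and the primes less than [n]: an exhaustion of all places
    by finite lists. *)
Definition places_upto (n : nat) : seq place_Q :=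
  infinite_place :: pmap prime_place (iota 0 n).

Lemma places_upto_uniq n : uniq (places_upto n).
Proof.
rewrite /places_upto /=; apply/andP; split.
  apply/negP; rewrite mem_pmap => /mapP[p _].
  by have [pp|npp] := boolP (prime p); [rewrite (prime_placeT pp)|rewrite prime_placeF].
elim: n 0%N => //= n IH m.
have [pm|npm] := boolP (prime m); last by rewrite prime_placeF //=.
rewrite (prime_placeT pm) /= IH andbT mem_pmap; apply/negP => /mapP[q].
rewrite mem_iota => /andP[mq _].
have [pq|npq] := boolP (prime q); last by rewrite prime_placeF.
by rewrite (prime_placeT pq) => -[e]; move: mq; rewrite -e ltnn.
Qed.

Lemma mem_places_upto v : exists n0, forall n, (n0 <= n)%N -> v \in places_upto n.
Proof.
case: v => [|p pp]; first by exists 0%N => n _; rewrite inE eqxx.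
exists p.+1 => n pn; rewrite inE; apply/orP; right.
rewrite mem_pmap; apply/mapP; exists p; first by rewrite mem_iota.
by rewrite prime_placeT.
Qed.

Section ProductFormulaQ.
Context (R : realType).

Lemma sum_pmap_places (F : place_Q -> R) s :
  \sum_(v <- pmap prime_place s) F v = \sum_(p <- s) oapp F 0 (prime_place p).
Proof.
elim: s => [|p s IH]; first by rewrite !big_nil.
by rewrite /= big_cons; case: (prime_place p) => [v|] /=; rewrite ?big_cons IH ?add0r.
Qed.

(** The logarithm of the factorization of [m] into primes. *)
Lemma product_formula_int (m : int) (n : nat) : m != 0 -> (`|m| < n)%N ->
  \sum_(v <- places_upto n) ln (normalized_abs R v m) = 0.
Proof.
move=> m0 mn; rewrite big_cons sum_pmap_places /=.
have mE : `|m|%N = (\prod_(0 <= p < n) p ^ logn p `|m|)%N.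
  case: n mn => // n; rewrite ltnS => mn.
  by rewrite -[LHS]partnT ?absz_gt0 // (@widen_partn n).
have -> : (`|m|%:~R : R) = \prod_(0 <= p < n) (p%:R ^+ logn p `|m|).
  rewrite -abszE -pmulrn [in LHS]mE natr_prod.
  by apply: eq_bigr => p _; rewrite natrX.
rewrite /index_iota subn0.
elim: (iota 0 n) => [|p s IH]; first by rewrite !big_nil ln1 addr0.
have p0 q : 0 < q%:R ^+ logn q `|m| :> R.
  case: q => [|q]; last by rewrite exprn_gt0 // ltr0n.
  by rewrite (_ : logn 0 _ = 0%N) ?expr0 ?ltr01.
have s0 : 0 < \prod_(q <- s) (q%:R ^+ logn q `|m|) :> R.
  by rewrite big_seq prodr_gt0.
rewrite !big_cons lnM ?posrE // addrACA IH addr0.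
have [pp|npp] := boolP (prime p).
  by rewrite (prime_placeT pp) /= (negbTE m0) lnV ?posrE // subrr.
by rewrite prime_placeF //= lognE (negbTE npp) expr0 ln1 addr0.
Qed.

Lemma product_formula_rat (x : rat) : x != 0 -> exists n0, forall n, (n0 <= n)%N ->
  \sum_(v <- places_upto n) ln (absQ R v x) = 0.
Proof.
move=> x0; exists (maxn `|numq x| `|denq x|).+1 => n; rewrite gtn_max => /andP[n1 n2].
have num0 : numq x != 0 by rewrite numq_eq0.
under eq_bigr => v _ do
  rewrite /= /absQ_fun ln_div ?posrE ?nabs_gt0 ?denq_neq0 //.
by rewrite sumrB !product_formula_int ?denq_neq0 // subrr.
Qed.

End ProductFormulaQ.

(** * Bases, factorization and seminorms of polynomials *)

Section Bases.
Context (k L : fieldType) (f : {rmorphism k -> L}).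

(** The change of basis matrices have product 1, which bounds the sizes. *)
Lemma has_basis_le n m : has_basis (range f) n -> has_basis (range f) m -> (n <= m)%N.
Proof.
move=> [b hb] [c hc].
have coords (l : nat) (e : 'I_l -> L) (he : forall y, exists! a : {ffun 'I_l -> L},
    (forall i, range f (a i)) /\ y = \sum_i a i * e i) (q : nat) (g : 'I_q -> L) :
    exists A : 'M[k]_(q, l), forall i, g i = \sum_j f (A i j) * e j.
  have /choice[A hA] i : exists A : 'I_l -> k, g i = \sum_j f (A j) * e j.
    have [a [[ar ->] _]] := he (g i).
    have /choice[A hA] j : exists x, f x = a j by have [x _ <-] := ar j; exists x.
    by exists A; apply: eq_bigr => j _; rewrite hA.
  by exists (\matrix_(i, j) A i j) => i; rewrite hA; apply: eq_bigr => j _; rewrite mxE.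
have [A hA] := coords _ c hc _ b; have [B hB] := coords _ b hb _ c.
apply: (@mulmx1_min k n m A B); apply/matrixP => i l.
have [a [_ au]] := hb (b i).
have e1 : a = [ffun l => f ((A *m B) i l)].
  apply: au; split=> [j|]; first by rewrite ffunE; exists ((A *m B) i j).
  rewrite {1}hA; under eq_bigr => j _ do rewrite hB mulr_sumr.
  rewrite exchange_big /=; apply: eq_bigr => j _.
  rewrite ffunE mxE rmorph_sum mulr_suml; apply: eq_bigr => q _.
  by rewrite rmorphM mulrA.
have e2 : a = [ffun l => f (i == l)%:R].
  apply: au; split=> [j|]; first by rewrite ffunE; exists (i == j)%:R.
  rewrite (bigD1 i) //= ffunE eqxx rmorph1 mul1r big1 ?addr0 // => j ji.
  by rewrite ffunE eq_sym (negbTE ji) rmorph0 mul0r.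
have /ffunP/(_ l) : [ffun l => f ((A *m B) i l)] = [ffun l => f (i == l)%:R] :> {ffun _ -> _}.
  by rewrite -e1 e2.
by rewrite !ffunE => /fmorph_inj ->; rewrite !mxE.
Qed.

Lemma degree_overE n : has_basis (range f) n -> degree_over (range f) = n.
Proof.
move=> hn; rewrite /degree_over; case: xgetP => [m _ hm|/(_ n)//].
by apply/eqP; rewrite eqn_leq !has_basis_le.
Qed.

(** Reduction modulo [p] writes every element on the powers of [x]; two writings
    differ by a multiple of [p] of smaller degree. *)
Lemma power_basis (p : {poly k}) (x : L) d : size p = d.+1 ->
  (forall h, (map_poly f h).[x] = 0 <-> p %| h) ->
  (forall y, exists h, y = (map_poly f h).[x]) -> has_basis (range f) d.
Proof.
move=> pd px gen; exists (fun i => x ^+ i) => y.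
have evalE (u : 'rV[k]_d) : (map_poly f (rVpoly u)).[x] = \sum_i f (u 0 i) * x ^+ i.
  rewrite {1}[u]row_sum_delta linear_sum rmorph_sum horner_sum; apply: eq_bigr => i _.
  by rewrite linearZ /= rVpoly_delta map_polyZ map_polyXn hornerZ hornerXn.
have [h ->] := gen y.
have hE : (map_poly f h).[x] = (map_poly f (h %% p)).[x].
  have p0 : (map_poly f p).[x] = 0 by apply/px.
  by rewrite {1}(divp_eq h p) rmorphD rmorphM hornerD hornerM p0 mulr0 add0r.
exists [ffun i : 'I_d => f (h %% p)`_i]; split.
  split=> [i|]; first by rewrite ffunE; exists (h %% p)`_i.
  rewrite hE -[h %% p](@poly_rV_K _ d) ?(size_modp pd) // evalE.
  by apply: eq_bigr => i _; rewrite ffunE coef_rVpoly_ord.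
move=> a [ar aE].
have /choice[A hA] j : exists c, f c = a j by have [c _ <-] := ar j; exists c.
have : p %| h %% p - rVpoly (\row_i A i).
  apply/px; rewrite rmorphB hornerD hornerN -hE aE evalE.
  apply/eqP; rewrite subr_eq0; apply/eqP/eq_bigr => i _.
  by rewrite mxE hA.
rewrite /dvdp modp_small; last first.
  rewrite pd ltnS (leq_trans (size_polyD _ _)) // size_polyN geq_max.
  by rewrite (size_modp pd) size_poly.
rewrite subr_eq0 => /eqP e; apply/ffunP => i.
by rewrite ffunE e coef_rVpoly_ord mxE hA.
Qed.

End Bases.

Section Factorization.
Context (k : fieldType).

(** A divisor of least degree among those of positive degree. *)
Lemma irreducible_factor (P : {poly k}) : (1 < size P)%N ->
  exists2 q, irreducible_poly q & q %| P.
Proof.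
move=> P1.
have ex : exists n, `[< exists q : {poly k}, [/\ (1 < size q)%N, q %| P & size q = n] >].
  by exists (size P); apply/asboolP; exists P.
case: (ex_minnP ex) => n /asboolP[q [q1 qP qn]] nmin; exists q => //; split=> // r r1 rq.
have q0 : q != 0 by rewrite -size_poly_gt0 (ltn_trans _ q1).
have r0 : r != 0 by apply: contraTneq rq => ->; rewrite dvd0p.
rewrite -dvdp_size_eqp // eqn_leq dvdp_leq //= qn; apply: nmin; apply/asboolP.
exists r; split=> //; last exact: dvdp_trans rq qP.
by rewrite ltn_neqAle eq_sym r1 size_poly_gt0.
Qed.


Lemma irreducible_factorization (P : {poly k}) : P \is monic ->
  exists2 s : seq {poly k}, (forall p, p \in s -> p \is monic /\ irreducible_poly p)
    & P = \prod_(p <- s) p.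
Proof.
have [n] := ubnP (size P); elim: n P => // n IH P; rewrite ltnS => Pn Pm.
have [P1|P1] := leqP (size P) 1.
  exists [::] => //; rewrite big_nil; move: Pm; rewrite (size1_polyC P1) monicE.
  by rewrite lead_coefC => /eqP ->.
have [q [q1 qi] qP] := irreducible_factor P1.
have q0 : q != 0 by rewrite -size_poly_gt0 (ltn_trans _ q1).
have lq : lead_coef q != 0 by rewrite lead_coef_eq0.
pose r := (lead_coef q)^-1 *: q.
have rm : r \is monic by rewrite monicE lead_coefZ mulVf.
have qr : r %= q by rewrite eqp_scale // invr_eq0.
have rP : r %| P by rewrite (eqp_dvdl _ qr).
have szr : size r = size q := eqp_size qr.
have ri : irreducible_poly r.
  split=> [|u u1 ur]; first by rewrite szr.
  by rewrite (eqp_trans (qi _ u1 _)) 1?eqp_sym // -(eqp_dvdr _ qr).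
have PE : P = P %/ r * r by rewrite divpK.
have Qm : P %/ r \is monic by rewrite -(monicMr _ rm) -PE.
have [|//|s hs sE] := IH (P %/ r).
  rewrite (leq_trans _ Pn) // size_divp ?monic_neq0 // szr.
  by rewrite ltn_subrL -subn1 subn_gt0 q1 (ltn_trans _ P1).
exists (r :: s); last by rewrite big_cons -sE mulrC.
by move=> p; rewrite inE => /orP[/eqP ->//|/hs].
Qed.

(** A repeated factor would be coprime to itself. *)
Lemma separable_factors_uniq (s : seq {poly k}) :
  (forall p, p \in s -> irreducible_poly p) ->
  separable_poly (\prod_(p <- s) p) -> uniq s.
Proof.
move=> irr /separable_polyP[sep _].
elim: s irr sep => //= p s IH irr sep; rewrite IH ?andbT; last 2 first.
- by move=> q qs; apply: irr; rewrite inE qs orbT.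
- move=> u v uv; apply: sep; rewrite big_cons; exact: dvdp_mull.
apply/negP => ps; have := sep p p; rewrite big_cons (big_rem p) //= => /(_ _).
rewrite mulrA dvdp_mulr // => /(_ isT); rewrite coprimepp.
by have [p1 _] := irr p (mem_head _ _); move/eqP => p1'; rewrite p1' in p1.
Qed.

Lemma monic_irreducible_coprime (p q : {poly k}) : p \is monic -> q \is monic ->
  irreducible_poly p -> irreducible_poly q -> p != q -> coprimep p q.
Proof.
move=> pm qm pi qi; apply: contraR; rewrite irreducible_poly_coprime // negbK => pq.
rewrite -eqp_monic //; case: qi => _; apply=> //.
by case: pi => p1 _; rewrite gtn_eqF.
Qed.

End Factorization.

Section PolySeminorm.
Context (R : realType) (k : fieldType) (a : absval R k) (c : {poly k} -> R).
Hypothesis cD : forall g h, c (g + h) <= c g + c h.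
Hypothesis cM : forall g h, c (g * h) = c g * c h.
Hypothesis cC : forall x, c x%:P = a x.
Hypothesis c_ge0 : forall g, 0 <= c g.

(** The Horner scheme: a multiplicative seminorm on polynomials is bounded by the
    coefficients. *)
Lemma poly_seminorm_bound n (h : {poly k}) (M : R) : (size h <= n)%N ->
  (forall i, (i < n)%N -> a h`_i <= M) -> c h <= M * \sum_(i < n) c 'X ^+ i.
Proof.
have c0 : c 0 = 0 by rewrite -[0]/(0%:P) cC absval0.
elim: n h => [|n IH] h hn hM.
  by move: hn; rewrite leqn0 size_poly_eq0 => /eqP ->; rewrite big_ord0 mulr0 c0.
have M0 : 0 <= M by apply: le_trans (hM 0%N _); rewrite ?absval_ge0.
have [q [b hE]] : exists q b, h = q * 'X + b%:P.
  by elim/poly_ind : (h) => [|q b _]; [exists 0, 0; rewrite mul0r addr0|exists q, b].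
rewrite hE; apply: le_trans (cD _ _) _; rewrite cM cC big_ord_recl expr0 mulrDr mulr1 addrC.
apply: lerD; first by have := hM 0%N (ltn0Sn _); rewrite hE coefD coefMX coefC add0r.
have -> : \sum_(i < n) c 'X ^+ bump 0 i = (\sum_(i < n) c 'X ^+ i) * c 'X.
  by rewrite mulr_suml; apply: eq_bigr => i _; rewrite /bump add1n exprSr.
rewrite mulrA ler_wpM2r //; apply: IH.
  have [->|q0] := eqVneq q 0; first by rewrite size_poly0.
  by move: hn; rewrite hE size_MXaddC (negbTE q0).
move=> i ilt; have := hM i.+1 ilt; rewrite hE coefD coefMX coefC /=.
by rewrite addr0.
Qed.

End PolySeminorm.

(** * Places above a place of Q and irreducible factors over the completion *)

Section LocalField.
Context (R : realType) (v : place_Q).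
Local Notation a := (absQ R v).
Local Notation k := (completion (absQ R v)).
Local Notation ca := (compl_abs (absQ R v)).

Lemma absQ_large : exists2 u : rat, u != 0 & 2 <= a u.
Proof.
case: v => [|p pp]; first by exists 2%:R => //; rewrite absQ_infinite ratr_nat ger0_norm.
exists (p%:R^-1); first by rewrite invr_eq0 pnatr_eq0 -lt0n prime_gt0.
rewrite absvalV ?pnatr_eq0 -?lt0n ?prime_gt0 // -[p%:R]/((p%:Z)%:~R) absQ_int.
rewrite nabs_p ?eqz_nat -?lt0n ?prime_gt0 //= (logn_prime p pp) eqxx expr1 invrK.
by rewrite ler_nat prime_gt1.
Qed.

(** Approximate an element of the unit ball by a rational number of absolute value
    at most 2, which falls in the unit ball of the rational numbers after division
    by some [u] with [2 <= |u|]. *)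
Lemma completion_bounded (e : R) : 0 < e ->
  exists s : seq k, forall z, ca z <= 1 -> exists2 c, c \in s & ca (z - c) < e.
Proof.
move=> e0; have [u u0 u2] := absQ_large.
have au0 : 0 < a u by apply: lt_le_trans u2.
have eu : 0 < e / 2 / a u by apply: divr_gt0 => //; exact: divr_gt0.
have [s hs] := absQ_bounded v eu.
exists [seq compl_emb a (u * c) | c <- s] => z z1.
have [|x hx] := @compl_emb_dense _ _ a z (Num.min 1 (e / 2)); first by rewrite lt_min ltr01 divr_gt0.
move: hx; rewrite lt_min => /andP[x1 x2].
have ax : a x <= 2.
  rewrite -compl_abs_emb -[compl_emb a x](subKr z); apply: le_trans (absvalB _ _ _) _.
  by move: z1 x1; lra.
have [|c cs hc] := hs (x / u).
  by rewrite absvalM absvalV // ler_pdivrMr // mul1r (le_trans ax).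
exists (compl_emb a (u * c)); first exact: map_f.
have -> : z - compl_emb a (u * c) = (z - compl_emb a x) + compl_emb a (u * (x / u - c)).
  by rewrite mulrBr [u * (x / u)]mulrC divfK // rmorphB addrA subrK.
apply: le_lt_trans (absvalD _ _ _) _; rewrite [e]splitr ltrD // compl_abs_emb absvalM.
by rewrite mulrC -ltr_pdivlMr.
Qed.

End LocalField.

Section PlacesAbove.
Context (R : realType) (K : fieldType) (f : {rmorphism rat -> K}).
Context (x0 : K) (P : {poly rat}).
Hypothesis rootP : forall g, (map_poly f g).[x0] = 0 <-> P %| g.
Hypothesis gen : forall y, exists g, y = (map_poly f g).[x0].
Context (v : place_Q).
Local Notation a := (absQ R v).
Local Notation k := (completion (absQ R v)).
Local Notation ca := (compl_abs (absQ R v)).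
Local Notation i0 := (compl_emb (absQ R v)).

Definition above (w : absval R K) :=
  forall n : int, w n%:~R = normalized_abs R v n.

Definition compl_poly : {poly k} := map_poly i0 P.

Section Factor.
Context (p : {poly k}) (d : nat) (pd : size p = d.+1) (p_irr : irreducible_poly p).

Let k_complete := @compl_abs_complete R rat a.
Let k_bounded := @completion_bounded R v.
Local Notation E := (ext_abs ca p d).

Lemma ext_abs_cong g h : p %| g - h -> E g = E h.
Proof.
move=> pgh; rewrite -(ext_abs_mod ca p d g) -(ext_abs_mod ca p d h); congr (E _).
by rewrite -{1}(subrK h g) modpD (eqP pgh) add0r.
Qed.

Context (pP : p %| compl_poly).

(** The absolute value of [k[X]/(p)] pulled back along the embedding of [K] that
    sends [x0] to the class of [X]: every element of [K] is a polynomial in [x0]. *)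
Definition ext_place_fun (y : K) : R :=
  E (map_poly i0 (xget 0 [set g | y = (map_poly f g).[x0]])).

Lemma ext_place_funE g : ext_place_fun (map_poly f g).[x0] = E (map_poly i0 g).
Proof.
apply: ext_abs_cong; case: xgetP => [h _ /= gh|/(_ g)/(_ erefl)//].
apply: dvdp_trans pP _; rewrite -rmorphB dvdp_map; apply/rootP.
by rewrite rmorphB hornerD hornerN -gh subrr.
Qed.

Lemma ext_place_ge0 y : 0 <= ext_place_fun y.
Proof. exact: ext_abs_ge0. Qed.

Lemma ext_placeM y z : ext_place_fun (y * z) = ext_place_fun y * ext_place_fun z.
Proof.
have [g ->] := gen y; have [h ->] := gen z.
by rewrite -hornerM -rmorphM !ext_place_funE rmorphM ext_absM.
Qed.

Lemma ext_placeD y z : ext_place_fun (y + z) <= ext_place_fun y + ext_place_fun z.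
Proof.
have [g ->] := gen y; have [h ->] := gen z.
by rewrite -hornerD -rmorphD !ext_place_funE rmorphD ext_absD.
Qed.

Lemma ext_placeC (c : rat) : ext_place_fun (f c) = a c.
Proof.
have -> : f c = (map_poly f c%:P).[x0] by rewrite map_polyC hornerC.
by rewrite ext_place_funE map_polyC ext_absC // compl_abs_emb.
Qed.

Lemma ext_place_eq0 y : ext_place_fun y = 0 <-> y = 0.
Proof.
split=> [y0|->]; last by rewrite -(rmorph0 f) ext_placeC absval0.
apply/eqP; apply: contraT => yn0; have := ext_placeM y y^-1.
rewrite y0 mul0r mulfV // -(rmorph1 f) ext_placeC absval1 => /eqP.
by rewrite oner_eq0.
Qed.

Definition ext_absval : absval R K :=
  AbsVal ext_place_ge0 ext_place_eq0 ext_placeM ext_placeD.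

Lemma ext_absval_above : above ext_absval.
Proof. by move=> n; rewrite -(rmorph_int f) /= ext_placeC absQ_int. Qed.

Definition ext_place : place R K := Place (ex_intro _ v ext_absval_above).

End Factor.

Section Place.
Context (w : place R K) (hw : above w).

Let fw : forall x, w (f x) = a x := absval_extends_absQ f hw.
Local Notation j := (compl_map fw).
Local Notation Kw := (completion w).
Local Notation xw := (compl_emb w x0).

Definition eval_at (h : {poly k}) : Kw := (map_poly j h).[xw].

Lemma eval_at_rat g : eval_at (map_poly i0 g) = compl_emb w (map_poly f g).[x0].
Proof.
rewrite /eval_at -map_poly_comp -horner_map -map_poly_comp; congr (_ .[_]).
by apply: eq_map_poly => x /=; exact: compl_map_emb.
Qed.

Lemma eval_at_compl_poly : eval_at compl_poly = 0.
Proof.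
rewrite eval_at_rat; have /rootP -> : P %| P by [].
exact: rmorph0.
Qed.

Lemma eval_atD g h : eval_at (g + h) = eval_at g + eval_at h.
Proof. by rewrite /eval_at rmorphD hornerD. Qed.
Lemma eval_atB g h : eval_at (g - h) = eval_at g - eval_at h.
Proof. by rewrite /eval_at rmorphB hornerD hornerN. Qed.
Lemma eval_atM g h : eval_at (g * h) = eval_at g * eval_at h.
Proof. by rewrite /eval_at rmorphM hornerM. Qed.
Lemma eval_atC c : eval_at c%:P = j c.
Proof. by rewrite /eval_at map_polyC hornerC. Qed.
Lemma eval_at_prod s : eval_at (\prod_(q <- s) q) = \prod_(q <- s) eval_at q.
Proof. by rewrite /eval_at rmorph_prod horner_prod. Qed.

Definition eval_abs (h : {poly k}) : R := compl_abs w (eval_at h).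

Lemma eval_abs_ge0 h : 0 <= eval_abs h. Proof. exact: absval_ge0. Qed.
Lemma eval_absD g h : eval_abs (g + h) <= eval_abs g + eval_abs h.
Proof. by rewrite /eval_abs eval_atD absvalD. Qed.
Lemma eval_absM g h : eval_abs (g * h) = eval_abs g * eval_abs h.
Proof. by rewrite /eval_abs eval_atM absvalM. Qed.
Lemma eval_absC c : eval_abs c%:P = ca c.
Proof. by rewrite /eval_abs eval_atC compl_abs_map. Qed.
Lemma eval_abs_rat g : eval_abs (map_poly i0 g) = w (map_poly f g).[x0].
Proof. by rewrite /eval_abs eval_at_rat compl_abs_emb. Qed.

Context (p : {poly k}) (d : nat) (pd : size p = d.+1) (p_monic : p \is monic).
Context (p_irr : irreducible_poly p).
Let k_complete := @compl_abs_complete R rat a.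
Let k_bounded := @completion_bounded R v.
Local Notation E := (ext_abs ca p d).

Section Root.
Hypothesis p_root : eval_at p = 0.

Lemma eval_at_mod h : eval_at (h %% p) = eval_at h.
Proof. by rewrite {2}(divp_eq h p) eval_atD eval_atM p_root mulr0 add0r. Qed.

(** The factor [p] is the minimal polynomial of [x0] over [k]: an [h] that it does
    not divide is coprime to it, and Bezout excludes a common root. *)
Lemma eval_at_eq0 h : eval_at h = 0 <-> p %| h.
Proof.
split=> [h0|ph]; last by rewrite -eval_at_mod (eqP ph) -[0]/(0%:P) eval_atC rmorph0.
apply: contraT => nph; have : coprimep h p.
  by rewrite coprimep_sym irreducible_poly_coprime.
move=> /Bezout_eq1_coprimepP[[r s] /= rs].
have := congr1 eval_at rs; rewrite eval_atD !eval_atM h0 p_root !mulr0 addr0.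
by rewrite -[1]/(1%:P) eval_atC rmorph1 => /eqP; rewrite eq_sym oner_eq0.
Qed.

Lemma eval_abs_bound h M : (forall i : 'I_d, ca (h %% p)`_i <= M) ->
  eval_abs h <= (\sum_(i < d) eval_abs 'X ^+ i) * M.
Proof.
move=> hM; rewrite /eval_abs -eval_at_mod mulrC.
apply: (poly_seminorm_bound eval_absD eval_absM eval_absC eval_abs_ge0); first exact: size_modp.
by move=> i il; exact: (hM (Ordinal il)).
Qed.

Lemma eval_abs_le_ext h : eval_abs h <= E h.
Proof.
apply: (ext_abs_dominates k_complete k_bounded pd p_irr eval_abs_ge0 _ eval_abs_bound).
by move=> g n; elim: n => [|n IH]; rewrite ?expr0 -?[1]/(1%:P) ?eval_absC ?absval1 // !exprS eval_absM IH.
Qed.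

(** Both sides are absolute values of [K], and the left one is dominated by the
    right one; inverses give the equality. *)
Lemma place_ext g : w (map_poly f g).[x0] = E (map_poly i0 g).
Proof.
have pP : p %| compl_poly by apply/eval_at_eq0/eval_at_compl_poly.
have [w' w'E] : exists w' : absval R K,
    forall g, w' (map_poly f g).[x0] = E (map_poly i0 g).
  by exists (ext_absval pd p_irr pP) => h; exact: ext_place_funE.
have le y : w y <= w' y.
  by have [h ->] := gen y; rewrite w'E; apply: le_trans (eval_abs_le_ext _); rewrite eval_abs_rat.
rewrite -w'E; move: (_.[x0]) => y.
have [->|y0] := eqVneq y 0; first by rewrite !absval0.
apply/eqP; rewrite eq_le le /=; have := le y^-1.
by rewrite !absvalV // lef_pV2 ?posrE ?absval_gt0.
Qed.

(** The coordinates of a Cauchy sequence of [K] modulo [p] are Cauchy sequences of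
    [k]; their limits are the coordinates of the limit. *)
Lemma completion_gen (z : Kw) : exists h, z = eval_at h.
Proof.
have [c ->] := compl_surj z.
have /choice[g hg] m : exists g, c m = (map_poly f g).[x0] by exact: gen.
pose h m := map_poly i0 (g m) %% p.
have [C C0 hC] := ext_abs_lower k_complete k_bounded pd p_irr.
have d0 : (0 < d)%N by rewrite -ltnS -pd; case: p_irr.
have /choice[l hl] (i : 'I_d) : exists l, cvgs ca (fun m => (h m)`_i) l.
  apply: k_complete; apply/asboolP => e e0.
  have /asboolP/(_ (e / C)) := cauchy_valP c; rewrite divr_gt0 // => /(_ isT)[n0 hn0].
  exists n0 => m n m0 nn0.
  have -> : (h m)`_i - (h n)`_i = (map_poly i0 (g m - g n) %% p)`_i.
    by rewrite rmorphB /h modpD modpN coefB.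
  apply: le_lt_trans (hC _ _) _; rewrite -place_ext rmorphB hornerD hornerN -!hg.
  by rewrite mulrC -ltr_pdivlMr ?hn0.
exists (rVpoly (\row_i l i)); apply/eqP; rewrite -subr_eq0; apply/eqP.
apply: (absval_eq0_small (w := compl_abs w)) => e e0.
have e20 : 0 < e / 2 by rewrite divr_gt0.
pose S := 1 + \sum_(i < d) eval_abs 'X ^+ i.
have S0 : 0 < S by rewrite ltr_pwDl // sumr_ge0 // => i _; rewrite exprn_ge0 ?eval_abs_ge0.
have [n1 h1] := compl_abs_approx c e20.
have /choice[n2 h2] i := hl i (e / 2 / S) (divr_gt0 e20 S0).
pose n := maxn n1 (\max_i n2 i).
have -> : \pi_(completion w)%qT c - eval_at (rVpoly (\row_i l i)) =
   - (compl_emb w (c n) - \pi_(completion w)%qT c) +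
   eval_at (map_poly i0 (g n) - rVpoly (\row_i l i)).
  by rewrite eval_atB eval_at_rat -hg; ring.
apply: le_lt_trans (absvalD _ _ _) _; rewrite [e]splitr absvalN ltr_leD //.
  by rewrite h1 // leq_maxl.
have M0 : 0 <= e / 2 / S by rewrite ltW // divr_gt0.
apply: (@le_trans _ _ (S * (e / 2 / S))); last by rewrite mulrC divfK ?gt_eqF.
apply: le_trans (eval_abs_bound (M := e / 2 / S) _) _; last by rewrite ler_wpM2r // lerDr.
move=> i; rewrite modpD modpN -/(h n) coefB.
rewrite (@modp_small _ (rVpoly _)) ?pd ?ltnS ?size_poly // coef_rVpoly_ord mxE.
by apply/ltW/h2; rewrite (leq_trans _ (leq_maxr _ _)) // leq_bigmax.
Qed.

Lemma local_degree : degree_over (@rational_completion R K w) = d.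
Proof.
rewrite (rational_completionE fw); apply: degree_overE.
apply: (power_basis pd (x := xw)); first exact: eval_at_eq0.
exact: completion_gen.
Qed.

(** The norm of the class of [X] in [k[X]/(p)] is the constant term of [p], up to
    sign. *)
Lemma local_norm : w x0 ^+ d = ca p`_0.
Proof.
have := place_ext 'X; rewrite !map_polyX hornerX => ->.
by rewrite ext_absXd // modnormX // absvalM absvalX absvalN absval1 expr1n mul1r.
Qed.

End Root.

(** The place attached to a factor is a root of it: both seminorms on [k[X]]
    agree on the dense subring [Q[X]], hence on [p]. *)
Lemma root_of_ext : (forall g, w (map_poly f g).[x0] = E (map_poly i0 g)) ->
  eval_at p = 0.
Proof.
move=> wE; apply: (absval_eq0_small (w := compl_abs w)) => e e0.
have [c cE] : exists c, forall h, c h = E h by exists E.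
have cD g h : c (g + h) <= c g + c h by rewrite !cE; exact: ext_absD.
have cM g h : c (g * h) = c g * c h by rewrite !cE; exact: ext_absM.
have cC x : c x%:P = ca x by rewrite cE; exact: ext_absC.
have c_ge0 h : 0 <= c h by rewrite cE; exact: ext_abs_ge0.
have S1_ge0 : 0 <= \sum_(i < d.+1) eval_abs 'X ^+ i.
  by rewrite sumr_ge0 // => i _; rewrite exprn_ge0 ?eval_abs_ge0.
have S2_ge0 : 0 <= \sum_(i < d.+1) c 'X ^+ i.
  by rewrite sumr_ge0 // => i _; rewrite exprn_ge0 ?c_ge0.
have [S S0 SE] : exists2 S : R, 0 < S &
    \sum_(i < d.+1) eval_abs 'X ^+ i + \sum_(i < d.+1) c 'X ^+ i <= S.
  exists (1 + (\sum_(i < d.+1) eval_abs 'X ^+ i + \sum_(i < d.+1) c 'X ^+ i)).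
    by rewrite ltr_pwDl // addr_ge0.
  by rewrite lerDr.
have eS : 0 < e / 2 / S by rewrite !divr_gt0.
have /choice[q hq] i : exists q, ca (p`_i - i0 q) < e / 2 / S by exact: compl_emb_dense.
pose g := \poly_(i < d.+1) q i.
pose r := p - map_poly i0 g.
have rs : (size r <= d.+1)%N.
  rewrite (leq_trans (size_polyD _ _)) // size_polyN geq_max pd leqnn.
  by rewrite (leq_trans (size_poly _ _)) // size_poly.
have rM i : (i < d.+1)%N -> ca r`_i <= e / 2 / S.
  by move=> il; rewrite coefB coef_map coef_poly il ltW.
have r1 := poly_seminorm_bound eval_absD eval_absM eval_absC eval_abs_ge0 rs rM.
have r2 := poly_seminorm_bound cD cM cC c_ge0 rs rM.
have cg : c (map_poly i0 g) = c r.
  have -> : c r = c (- r) by rewrite -mulN1r cM -[-1]/(- 1%:P) -polyCN cC absvalN absval1 mul1r.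
  by rewrite !cE; apply: ext_abs_cong; rewrite opprK addrC subrK.
have : eval_abs p <= eval_abs r + c r.
  by rewrite -cg cE -wE -eval_abs_rat -{1}[p](subrK (map_poly i0 g)) eval_absD.
rewrite -/(eval_abs p) => h; apply: (le_lt_trans h); apply: (le_lt_trans (lerD r1 r2)).
rewrite -mulrDr; apply: (@le_lt_trans _ _ (e / 2 / S * S)).
  by rewrite ler_wpM2l ?(ltW eS).
by rewrite divfK ?gt_eqF // ltr_pdivrMr // ltr_pMr // ltr1n.
Qed.

End Place.

Lemma factor_place (p : {poly k}) d : size p = d.+1 -> irreducible_poly p ->
  p %| compl_poly -> exists (w : place R K) (hw : above w), eval_at hw p = 0.
Proof.
move=> pd pi pP.
have [w hw wE] : exists2 w : place R K, above w &
    forall g, w (map_poly f g).[x0] = ext_abs ca p d (map_poly i0 g).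
  exists (ext_place pd pi pP); first exact: ext_absval_above.
  by move=> g; exact: ext_place_funE.
by exists w, hw; exact: (root_of_ext hw pd pi wE).
Qed.

End PlacesAbove.

(** * Local degrees and local norms above a place of Q *)

Lemma size_prod_monic (k : fieldType) (s : seq {poly k}) :
  (forall p, p \in s -> p \is monic) ->
  (\sum_(p <- s) (size p).-1 = (size (\prod_(p <- s) p)%R).-1)%N.
Proof.
elim: s => [|p s IH] sm; first by rewrite !big_nil size_poly1.
have pm := sm _ (mem_head p s).
have sm' q : q \in s -> q \is monic by move=> qs; apply: sm; rewrite inE qs orbT.
have Sm : \prod_(q <- s) q \is monic by rewrite big_seq; apply: monic_prod.
rewrite !big_cons IH // size_monicM ?monic_neq0 //.
have : (0 < size p)%N by rewrite size_poly_gt0 monic_neq0.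
have : (0 < size (\prod_(q <- s) q)%R)%N by rewrite size_poly_gt0 monic_neq0.
by case: (size p) (size _) => [|m] [|l] //= _ _; rewrite addnS.
Qed.

Lemma place_ext_eq (R : realType) (K : fieldType) (w1 w2 : place R K) :
  (forall y, w1 y = w2 y) -> w1 = w2.
Proof.
case: w1 w2 => [a1 h1] [a2 h2] /= /absval_ext e; subst a2.
by rewrite (Prop_irrelevance h1 h2).
Qed.

Definition local_deg (R : realType) (K : fieldType) (w : place R K) : nat :=
  degree_over (@rational_completion R K w).

Section LocalPlaces.
Context (R : realType) (K : fieldType) (f : {rmorphism rat -> K}).
Context (x0 : K) (P : {poly rat}) (P_monic : P \is monic).
Hypothesis rootP : forall g, (map_poly f g).[x0] = 0 <-> P %| g.
Hypothesis gen : forall y, exists g, y = (map_poly f g).[x0].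
Context (v : place_Q).
Local Notation a := (absQ R v).
Local Notation k := (completion (absQ R v)).
Local Notation i0 := (compl_emb (absQ R v)).

(** The polynomials that vanish at [x0] form a prime ideal. *)
Lemma min_poly_irreducible : irreducible_poly P.
Proof.
have P0 : P != 0 := monic_neq0 P_monic.
have szP : (1 < size P)%N.
  rewrite ltn_neqAle eq_sym size_poly_gt0 P0 andbT; apply/negP => /size_poly1P[c c0 Pc].
  have : (map_poly f 1).[x0] = 0
    by apply/rootP/dvdpP; exists (c^-1)%:P; rewrite Pc -polyCM mulVf.
  by rewrite rmorph1 hornerC => /eqP; rewrite oner_eq0.
split=> // q q1 /dvdpP[r PE].
have r0 : r != 0 by apply: contraNneq P0 => r0; rewrite PE r0 mul0r.
have q0 : q != 0 by apply: contraNneq P0 => q0; rewrite PE q0 mulr0.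
have qP : q %| P by rewrite PE dvdp_mull.
have rP : r %| P by rewrite PE dvdp_mulr.
have : (map_poly f r).[x0] * (map_poly f q).[x0] = 0.
  by rewrite -hornerM -rmorphM -PE; apply/rootP.
move/eqP; rewrite mulf_eq0 => /orP[/eqP/rootP Pr|/eqP/rootP Pq]; last first.
  by rewrite /eqp qP Pq.
have : size r = size P by apply/eqP; rewrite eqn_leq !dvdp_leq.
rewrite PE size_mul // => e; move: q1; have : (0 < size r)%N by rewrite size_poly_gt0.
have : (0 < size q)%N by rewrite size_poly_gt0.
case: (size q) e => [//|[//|m]]; rewrite !addnS /= => e _ _ _.
by have := ltnn (size r); rewrite {2}e ltnS leq_addr.
Qed.

Lemma min_poly_separable : separable_poly P.
Proof.
have [P1 _] := min_poly_irreducible; have P0 : P != 0 := monic_neq0 P_monic.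
rewrite separable_poly.unlock irreducible_poly_coprime; last exact: min_poly_irreducible.
apply/negP => /dvdp_leq; rewrite leqNgt lt_size_deriv // => h.
have /h // : P^`() != 0.
apply/negP => /eqP/(congr1 (fun q : {poly rat} => q`_(size P).-2)).
rewrite coef_deriv coef0 prednK -?subn1 ?subn_gt0 // subn1 -lead_coefE (monicP P_monic).
by move/eqP; rewrite pnatr_eq0; case: (size P) P1 => [|[|]].
Qed.

(** A place above [v] is determined by the irreducible factor of [P] that vanishes
    at [x0] in its completion, each factor occurs, and no factor is repeated as
    [P] is separable. Degrees and constant terms of the factors then give the sum
    of the local degrees and the product of the local norms. *)
Lemma local_places : exists T : seq (place R K),
  [/\ uniq T, forall w : place R K, w \in T <-> above v w,
      (\sum_(w <- T) local_deg w = (size P).-1)%N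
    & \prod_(w <- T) w x0 ^+ local_deg w = a P`_0].
Proof.
have Pkm : compl_poly R P v \is monic by rewrite monic_map.
have [s hs sE] := irreducible_factorization Pkm.
have s_uniq : uniq s.
  apply: separable_factors_uniq => [p /hs[]//|].
  by rewrite -sE separable_map; exact: min_poly_separable.
have szp p : p \in s -> size p = (size p).-1.+1.
  by move=> /hs[pm _]; rewrite prednK // size_poly_gt0 monic_neq0.
pose rt (w : place R K) p := exists hw : above v w, eval_at f x0 hw p = 0.
have exw p : p \in s -> exists w, rt w p.
  move=> ps; have [pm pi] := hs p ps.
  have pP : p %| compl_poly R P v by rewrite sE (big_rem p) //= dvdp_mulr.
  have [w [hw wp]] := factor_place rootP gen (szp p ps) pi pP.
  by exists w, hw.
have [p0 p0s] : exists p, p \in s.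
  move: sE; case: (s) => [|p s' _]; last by exists p; rewrite mem_head.
  rewrite big_nil => /(congr1 (fun q : {poly k} => size q)); rewrite size_poly1 size_map_poly.
  by case: min_poly_irreducible => P1 _ P1'; rewrite P1' in P1.
have [w0 _] := exw p0 p0s.
have /choice[W hW] p : exists w, p \in s -> rt w p.
  by have [/exw[w]|_] := boolP (p \in s); [exists w|exists w0].
have rt_uniq w p q : p \in s -> q \in s -> rt w p -> rt w q -> p = q.
  move=> ps qs [hw wp] [hw' wq]; rewrite (Prop_irrelevance hw' hw) in wq.
  have [pm pi] := hs p ps; have [qm qi] := hs q qs.
  apply/eqP; apply: contraT => pq.
  have := monic_irreducible_coprime pm qm pi qi pq.
  rewrite irreducible_poly_coprime // => /negP; case.
  by apply/(eval_at_eq0 pi wp).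
have rt_ext w p : p \in s -> rt w p -> W p = w.
  move=> ps [hw wp]; have [hw' wp'] := hW p ps; have [pm pi] := hs p ps.
  apply: place_ext_eq => y; have [g ->] := gen y.
  rewrite (place_ext rootP gen (szp p ps) pi wp').
  by rewrite (place_ext rootP gen (szp p ps) pi wp).
have T_uniq : uniq [seq W p | p <- s].
  rewrite map_inj_in_uniq // => p q ps qs Wpq.
  by apply: (rt_uniq (W p)) => //; [|rewrite Wpq]; exact: hW.
have Wdeg p : p \in s -> local_deg (W p) = (size p).-1.
  move=> ps; have [hw wp] := hW p ps; have [pm pi] := hs p ps.
  exact: (local_degree rootP gen (szp p ps) pi wp).
exists [seq W p | p <- s]; split=> //.
- move=> w; split=> [/mapP[p ps ->]|hw]; first by have [] := hW p ps.
  have := eval_at_compl_poly rootP hw; rewrite sE eval_at_prod => /eqP.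
  rewrite prodf_seq_eq0 => /hasP[p ps /= /eqP wp].
  by apply/mapP; exists p => //; apply/esym/rt_ext => //; exists hw.
- rewrite big_map big_seq (eq_bigr _ Wdeg) -big_seq size_prod_monic => [|p /hs[]//].
  by rewrite -sE size_map_poly.
- rewrite big_map big_seq.
  have /(eq_bigr _) -> p : p \in s -> W p x0 ^+ local_deg (W p) = compl_abs a p`_0.
    move=> ps; rewrite Wdeg //; have [hw wp] := hW p ps; have [pm pi] := hs p ps.
    exact: (local_norm rootP gen (szp p ps) pm pi wp).
  have e0 : i0 P`_0 = (compl_poly R P v)`_0 by rewrite coef_map.
  rewrite -big_seq -absval_prod -(compl_abs_emb a) e0 sE.
  congr (compl_abs _ _); elim: (s) => [|p t IH]; first by rewrite !big_nil coef1.
  by rewrite !big_cons IH coef0M.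
Qed.

End LocalPlaces.

(** * The product formula in a number field *)

Section NumberField.
Context (K : fieldType) (sigma : {rmorphism K -> algC}).

Lemma sigma_ratr (x : rat) : sigma (ratr x) = ratr x.
Proof. by rewrite /ratr fmorph_div !rmorph_int. Qed.

Lemma ratK_zmod : zmod_morphism (@ratr K).
Proof.
by move=> x y; apply: (fmorph_inj sigma); rewrite [RHS]rmorphB !sigma_ratr rmorphB.
Qed.

Lemma ratK_monoid : monoid_morphism (@ratr K).
Proof.
split=> [|x y]; apply: (fmorph_inj sigma); first by rewrite sigma_ratr !rmorph1.
by rewrite [RHS]rmorphM !sigma_ratr rmorphM.
Qed.

Definition ratK (x : rat) : K := ratr x.
HB.instance Definition _ := GRing.isZmodMorphism.Build rat K ratK ratK_zmod.
HB.instance Definition _ := GRing.isMonoidMorphism.Build rat K ratK ratK_monoid.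

(** The embedding of the rational numbers, as a ring morphism: [K] has
    characteristic zero because it embeds in the algebraic numbers. *)
Definition rat_emb : {rmorphism rat -> K} := ratK.
Local Notation f := rat_emb.

Lemma sigma_horner g x : sigma (map_poly f g).[x] = (map_poly ratr g).[sigma x].
Proof.
rewrite -horner_map -map_poly_comp; congr (_ .[_]).
by apply: eq_map_poly => c /=; exact: sigma_ratr.
Qed.

Lemma exists_min_poly (x : K) : exists2 P : {poly rat}, P \is monic &
  forall g, (map_poly f g).[x] = 0 <-> P %| g.
Proof.
have [P [_ Pm] hP] := minCpolyP (sigma x); exists P => // g.
rewrite -hP; split=> [g0|/rootP g0]; first by apply/rootP; rewrite -sigma_horner g0 rmorph0.
by apply: (fmorph_inj sigma); rewrite sigma_horner rmorph0.
Qed.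

Definition polyval (z y : K) := exists g, y = (map_poly f g).[z].

Lemma polyvalD z x y : polyval z x -> polyval z y -> polyval z (x + y).
Proof. by move=> [g ->] [h ->]; exists (g + h); rewrite rmorphD hornerD. Qed.

Lemma polyvalM z x y : polyval z x -> polyval z y -> polyval z (x * y).
Proof. by move=> [g ->] [h ->]; exists (g * h); rewrite rmorphM hornerM. Qed.

Lemma polyvalC z c : polyval z (f c).
Proof. by exists c%:P; rewrite map_polyC hornerC. Qed.

Lemma polyval_trans z x y : polyval z x -> polyval x y -> polyval z y.
Proof.
by move=> [g ->] [h ->]; exists (h \Po g); rewrite map_comp_poly horner_comp.
Qed.

(** The Bezout relation between a polynomial and the minimal polynomial of [z] gives
    the inverse. *)
Lemma polyvalV z x : polyval z x -> polyval z x^-1.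
Proof.
have [->|x0] := eqVneq x 0; first by rewrite invr0.
move=> [g xE]; have [P Pm hP] := exists_min_poly z.
have Pirr := min_poly_irreducible Pm hP.
have : coprimep g P.
  rewrite coprimep_sym irreducible_poly_coprime //; apply/negP => /hP.
  by rewrite -xE => /eqP; rewrite (negbTE x0).
move=> /Bezout_eq1_coprimepP[[r s] /= rs]; exists r.
have := congr1 (fun h => (map_poly f h).[z]) rs.
rewrite /= rmorphD !rmorphM hornerD !hornerM rmorph1 hornerC -xE.
have /hP -> : P %| P by [].
by rewrite mulr0 addr0 => e; rewrite -[LHS]mul1r -e mulfK.
Qed.

(** The primitive element theorem, transferred from the algebraic numbers. *)
Lemma primitive_combination (s : seq K) : exists (a : nat ^ size s),
  forall y, y \in s -> polyval (\sum_(i < size s) s`_i *+ a i) y.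
Proof.
have [z] := algC_PET [seq sigma y | y <- s].
rewrite size_map => -[a zE] [ps psE]; exists a => y ys.
set t := \sum_(i < _) _; have tE : sigma t = z.
  rewrite zE rmorph_sum; apply: eq_bigr => i _.
  by rewrite rmorphMn /= (nth_map 0).
have : sigma y \in [seq (map_poly ratr p).[z] | p <- ps] by rewrite -psE map_f.
move=> /mapP[g _ gE]; exists g; apply: (fmorph_inj sigma).
by rewrite gE -tE sigma_horner.
Qed.

Context (n : nat) (K_basis : has_basis (rationals K) n).

Lemma rationalsE : rationals K = range f. Proof. by []. Qed.

Definition primitive (z : K) := forall y, polyval z y.

Lemma exists_primitive : exists z, primitive z.
Proof.
have [b hb] := K_basis; have [a ha] := primitive_combination [seq b i | i <- enum 'I_n].
eexists => y; have [c [[crat ->] _]] := hb y.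
elim/big_ind : _ => [|u u' hu hu'|i _]; [|exact: polyvalD hu hu'|].
  by rewrite -(rmorph0 f); exact: polyvalC.
apply: polyvalM; first by have [q _ <-] := crat i; exact: polyvalC.
by apply: ha; rewrite map_f ?mem_enum.
Qed.

Lemma size_min_poly z P : primitive z -> P \is monic ->
  (forall g, (map_poly f g).[z] = 0 <-> P %| g) -> size P = n.+1.
Proof.
move=> zp Pm hP; have P0 : (0 < size P)%N by rewrite size_poly_gt0 monic_neq0.
have sz : size P = (size P).-1.+1 by rewrite prednK.
have hb := power_basis sz hP zp; rewrite sz; congr S.
by apply/eqP; rewrite eqn_leq !(has_basis_le (f := f)).
Qed.

Lemma basis_gt0 : (0 < n)%N.
Proof.
have [z zp] := exists_primitive; have [P Pm hP] := exists_min_poly z.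
have [P1 _] := min_poly_irreducible Pm hP.
by move: P1; rewrite (size_min_poly zp Pm hP).
Qed.

Context (R : realType).

Lemma exists_places_above (v : place_Q) : exists T : seq (place R K),
  [/\ uniq T, forall w : place R K, w \in T <-> above v w
    & (\sum_(w <- T) local_deg w = n)%N].
Proof.
have [z zp] := exists_primitive; have [P Pm hP] := exists_min_poly z.
have [T [Tu hT Ts _]] := local_places R Pm hP zp v; exists T; split=> //.
by rewrite Ts (size_min_poly zp Pm hP).
Qed.

Definition places_above (v : place_Q) : seq (place R K) :=
  projT1 (cid (exists_places_above v)).

Lemma places_above_uniq v : uniq (places_above v).
Proof. by rewrite /places_above; case: cid => T []. Qed.

Lemma mem_places_above v (w : place R K) : w \in places_above v <-> above v w.
Proof. by rewrite /places_above; case: cid => T /= []. Qed.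

Lemma sum_local_deg v : (\sum_(w <- places_above v) local_deg w = n)%N.
Proof. by rewrite /places_above; case: cid => T /= []. Qed.

(** The logarithm of the product of the local norms of [x] above [v]. *)
Definition total_log (v : place_Q) (x : K) : R :=
  \sum_(w <- places_above v) (local_deg w)%:R * ln (w x).

(** [x] has a norm: a rational number [c] whose absolute value at each place [v]
    is the product of the local norms of [x] above [v]. *)
Definition has_norm (x : K) :=
  exists2 c : rat, c != 0 & forall v, total_log v x = ln (absQ R v c).

Lemma has_norm_div x y : x != 0 -> y != 0 -> has_norm x -> has_norm y -> has_norm (x / y).
Proof.
move=> x0 y0 [c c0 hc] [d d0 hd]; exists (c / d).
  by rewrite mulf_neq0 ?invr_eq0.
move=> v; rewrite absvalM absvalV // ln_div ?posrE ?absval_gt0 // -hc -hd -sumrB.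
apply: eq_bigr => w _.
by rewrite absvalM absvalV // ln_div ?posrE ?absval_gt0 // mulrBr.
Qed.

Lemma has_norm_rat q : q != 0 -> has_norm (f q).
Proof.
move=> q0; exists (q ^+ n); first by rewrite expf_neq0.
move=> v; rewrite absvalX lnXn ?absval_gt0 // -[in RHS](sum_local_deg v).
rewrite /total_log big_seq (eq_bigr (fun w => (local_deg w)%:R * ln (absQ R v q))).
  by rewrite -big_seq -mulr_suml -natr_sum mulr_natl.
by move=> w /mem_places_above wv; rewrite (absval_extends_absQ f wv).
Qed.

(** The norm is the constant term of the minimal polynomial, by [local_places]. *)
Lemma has_norm_primitive z : z != 0 -> primitive z -> has_norm z.
Proof.
move=> z0 zp; have [P Pm hP] := exists_min_poly z.
have Pn v : absQ R v P`_0 = \prod_(w <- places_above v) w z ^+ local_deg w.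
  have [T [Tu hT _ <-]] := local_places R Pm hP zp v.
  apply: perm_big; apply: uniq_perm => //; first exact: places_above_uniq.
  by move=> w; apply/idP/idP => [/hT/mem_places_above|/mem_places_above/hT].
have w_gt0 (w : place R K) : 0 < w z ^+ local_deg w by rewrite exprn_gt0 ?absval_gt0.
exists P`_0 => [|v].
  apply/eqP => P00; have := Pn infinite_place; rewrite P00 absval0.
  move/eqP; rewrite lt_eqF //; elim: (places_above _) => [|w s IH].
    by rewrite big_nil.
  by rewrite big_cons mulr_gt0.
rewrite Pn /total_log; elim: (places_above v) => [|w s IH]; first by rewrite !big_nil ln1.
have s0 : 0 < \prod_(u <- s) u z ^+ local_deg u.
  by elim: (s) => [|u t IHt]; rewrite ?big_nil ?big_cons ?mulr_gt0.
by rewrite !big_cons IH lnM ?posrE // lnXn ?absval_gt0 // mulr_natl.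
Qed.

(** If [z] is primitive, then so is some combination [t] of [x * z] and [x] whose
    field contains both. If [t = 0], then [x] is rational; otherwise [x] is the
    quotient of [t] by the same combination of [z] and 1, which is primitive or
    rational. *)
Lemma has_norm_all x : x != 0 -> has_norm x.
Proof.
move=> x0; have [z zp] := exists_primitive.
have [a ha] := primitive_combination [:: x * z; x].
set t := \sum_(i < _) _ in ha.
have [m0 [m1 tE]] : exists m0 m1, t = x * (z *+ m0 + m1%:R).
  rewrite /t !big_ord_recl big_ord0 addr0 /=.
  by do 2!eexists; rewrite mulrDr mulr_natr mulrnAr.
have xt : polyval t x by apply: ha; rewrite !inE eqxx orbT.
have zt : polyval t z.
  have -> : z = x^-1 * (x * z) by rewrite mulKf.
  by apply: polyvalM; [exact: polyvalV|apply: ha; rewrite inE eqxx].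
have tp : primitive t by move=> y; exact: polyval_trans zt (zp y).
have [t0|t0] := eqVneq t 0.
  have [g xE] := xt; rewrite t0 -(rmorph0 f) horner_map in xE.
  by rewrite xE; apply: has_norm_rat; apply: contraNneq x0 => g0; rewrite xE g0 rmorph0.
pose y := z *+ m0 + m1%:R.
have y0 : y != 0 by apply: contraNneq t0 => y0; rewrite tE -/y y0 mulr0.
have -> : x = t / y by rewrite tE mulfK.
apply: has_norm_div => //; first exact: has_norm_primitive.
have fa (m : nat) : f m%:R = m%:R by rewrite rmorph_nat.
have [a0|a0] := eqVneq m0 0%N.
  have yE : y = f m1%:R by rewrite /y a0 mulr0n add0r fa.
  by rewrite yE; apply: has_norm_rat; apply: contraNneq y0 => a1; rewrite yE a1 rmorph0.
apply: has_norm_primitive => // u; apply: polyval_trans (zp u).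
have a0' : f m0%:R != 0 by rewrite fmorph_eq0 pnatr_eq0.
have -> : z = (y + f (- m1%:R)) * f (m0%:R^-1).
  by rewrite rmorphN fmorphV !fa addrK -[z *+ m0]mulr_natr mulfK // -fa.
apply: polyvalM; last exact: polyvalC.
by apply: polyvalD; [exists 'X; rewrite map_polyX hornerX|exact: polyvalC].
Qed.

End NumberField.

(** * Sums over places and heights *)

Section LimsupSum.
Context (R : realType) (I : choiceType).


Lemma sum_sub_le (s t : seq I) (g : I -> R) : (forall i, 0 <= g i) -> uniq s ->
  (forall i, i \in s -> i \in t) -> \sum_(i <- s) g i <= \sum_(i <- t) g i.
Proof.
move=> g0; elim: s t => [|i s IH] t /=; first by move=> _ _; rewrite big_nil sumr_ge0.
move=> /andP[nis su] sub; rewrite big_cons (perm_big _ (perm_to_rem (sub i (mem_head _ _)))).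
rewrite big_cons lerD2l; apply: IH => // j js.
have ji : j != i by apply: contraNneq nis => <-.
have : j \in t by apply: sub; rewrite inE js orbT.
by rewrite (perm_mem (perm_to_rem (sub i (mem_head _ _)))) inE (negbTE ji).
Qed.

Lemma limsup_sum_ge (P : set I) (a : I -> R) (s : seq I) : (forall i, 0 <= a i) ->
  uniq s -> ((\sum_(i <- s | i \in P) a i)%:E <= limsup_sum P a)%E.
Proof.
move=> a0 su; apply/ereal_infP => _ [J0 _ <-].
pose J := (J0 `|` [fset i | i in s])%fset.
apply: (@le_trans _ _ (\sum_(i <- J | i \in P) a i)%:E); last first.
  by apply: ereal_sup_ubound; exists J => //=; exact: fsubsetUl.
rewrite lee_fin -big_filter -[leRHS]big_filter; apply: sum_sub_le => //.
  exact: filter_uniq.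
move=> i; rewrite !mem_filter => /andP[-> /= si].
by rewrite inE; apply/orP; right; apply/imfsetP; exists i.
Qed.

Lemma limsup_sum_le (P : set I) (a : I -> R) (B : \bar R) :
  (forall J : {fset I}, ((\sum_(i <- J | i \in P) a i)%:E <= B)%E) ->
  (limsup_sum P a <= B)%E.
Proof.
move=> h; apply: (@le_trans _ _ (ereal_sup
   [set (\sum_(i <- J | i \in P) a i)%:E | J in [set J : {fset I} | (fset0 `<=` J)%fset]])).
  by apply: ereal_inf_lbound; exists fset0.
by apply/ereal_supP => _ [J _ <-].
Qed.

End LimsupSum.

Section Logs.
Context (R : realType).
Implicit Type y : R.

Lemma lnp_ge0 y : 0 <= lnp y. Proof. by rewrite /lnp le_max lexx orbT. Qed.

(** The decomposition of the logarithm into its positive and negative parts. *)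
Lemma lnp_sub y : 0 < y -> ln y = lnp y - lnp y^-1.
Proof.
move=> y0; rewrite /lnp lnV ?posrE //.
case: (leP (ln y) 0) => h; case: (leP (- ln y) 0) => h'; lra.
Qed.

Lemma abs_ln y : 0 < y -> `|ln y| = lnp y + lnp y^-1.
Proof.
move=> y0; rewrite /lnp lnV ?posrE //.
case: (leP (ln y) 0) => h; case: (leP (- ln y) 0) => h'; rewrite ?(ler0_norm h) ?(gtr0_norm h); lra.
Qed.

Lemma lnp_mono y y' : y <= y' -> lnp y <= lnp y'.
Proof.
move=> yy'; rewrite /lnp ge_max !le_max lexx orbT andbT.
have [y0|y0] := leP y 0; first by rewrite ln0 // lexx orbT.
by rewrite ler_ln ?posrE ?yy' // (lt_le_trans y0).
Qed.

End Logs.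

Section PlaceBelow.
Context (R : realType) (K : fieldType).

Definition below (w : place R K) : place_Q := projT1 (cid (place_normalized w)).

Lemma above_below w : above (below w) w.
Proof. by rewrite /below; case: cid. Qed.

Lemma above_uniq v (w : place R K) : above v w -> v = below w.
Proof.
move=> vw; apply: (@normalized_abs_inj R) => n.
by rewrite -vw -above_below.
Qed.

Lemma local_weight_ge0 (w : place R K) : 0 <= local_weight w.
Proof. by rewrite /local_weight divr_ge0. Qed.

Lemma local_weight0 (w : place R K) :
  ~ (exists n, has_basis (rationals K) n) -> local_weight w = 0.
Proof.
move=> nb; rewrite /local_weight [degree_over (rationals K)]/degree_over.
case: xgetP => [n _ hn|_]; last by rewrite invr0 mulr0.
by exfalso; apply: nb; exists n.
Qed.

End PlaceBelow.

Section Sums.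
Context (R : realType) (K : fieldType) (sigma : {rmorphism K -> algC}).
Local Notation pl := (place R K).

Section Finite.
Context (n : nat) (K_basis : has_basis (rationals K) n).
Local Notation T := (places_above sigma K_basis R).

Let n_gt0 : 0 < n%:R :> R. Proof. by rewrite ltr0n (basis_gt0 sigma K_basis). Qed.

Lemma local_weightE (w : pl) : local_weight w = (local_deg w)%:R / n%:R.
Proof.
by rewrite /local_weight (rationalsE sigma) (degree_overE (f := rat_emb sigma) K_basis).
Qed.

Lemma sum_local_weight v : \sum_(w <- T v) local_weight w = 1.
Proof.
under eq_bigr => w _ do rewrite local_weightE.
by rewrite -mulr_suml -natr_sum sum_local_deg mulfV // gt_eqF.
Qed.

Lemma sum_below_le (J : seq pl) (S : seq place_Q) (g : pl -> R) : (forall w, 0 <= g w) ->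
  uniq J -> (forall w, w \in J -> below w \notin S -> g w = 0) ->
  \sum_(w <- J) g w <= \sum_(v <- undup S) \sum_(w <- T v) g w.
Proof.
move=> g0 Ju gJ.
apply: (@le_trans _ _ (\sum_(v <- undup S) \sum_(w <- J | below w == v) g w)); last first.
  apply: ler_sum => v _; rewrite -big_filter; apply: sum_sub_le => //.
    exact: filter_uniq.
  move=> w; rewrite mem_filter => /andP[/eqP <- _].
  exact/mem_places_above/above_below.
rewrite (exchange_big_dep predT) //= big_seq [leRHS]big_seq; apply: ler_sum => w wJ.
have [wS|wS] := boolP (below w \in S); last first.
  by rewrite (gJ w wJ wS) sumr_ge0.
rewrite (big_rem (below w)) ?mem_undup //= eqxx lerDl sumr_ge0 //.
Qed.

(** The weights of the places above [v] add up to 1. *)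
Lemma sum_local_bounded (J : seq pl) (S : seq place_Q) (D : place_Q -> R) :
  (forall v, 0 <= D v) -> (forall v, v \notin S -> D v = 0) -> uniq J ->
  \sum_(w <- J) local_weight w * D (below w) <= \sum_(v <- undup S) D v.
Proof.
move=> D0 DS Ju; apply: (le_trans (sum_below_le (S := S) _ Ju _)).
- by move=> w; rewrite mulr_ge0 ?local_weight_ge0.
- by move=> w _ /DS ->; rewrite mulr0.
apply: ler_sum => v _; rewrite big_seq (eq_bigr (fun w => local_weight w * D v)).
  by rewrite -big_seq -mulr_suml sum_local_weight mul1r.
by move=> w /mem_places_above/above_uniq <-.
Qed.

Lemma flatten_places_uniq S : uniq S -> uniq (flatten [seq T v | v <- S]).
Proof.
elim: S => //= v S IH /andP[vS Su]; rewrite cat_uniq places_above_uniq IH // andbT.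
apply/hasPn => w /flattenP[_ /mapP[v' v'S ->]] /mem_places_above/above_uniq wv'.
apply/negP => /mem_places_above/above_uniq wv.
by move: vS; rewrite wv -wv' v'S.
Qed.

(** The product formula bounds the negative parts of the logarithms of [x] by
    their positive parts. *)
Lemma negative_part_le (J : seq pl) (x : K) : uniq J -> x != 0 ->
  exists2 J' : seq pl, uniq J' &
    \sum_(w <- J) local_weight w * lnp (w x)^-1 <=
    \sum_(w <- J') local_weight w * lnp (w x).
Proof.
move=> Ju x0; have [c c0 xc] := has_norm_all sigma K_basis R x0.
have [n1 h1] := product_formula_rat R c0.
have [n2 h2] : exists n2, forall m, (n2 <= m)%N ->
    forall w, w \in J -> below w \in places_upto m.
  elim: (J) => [|w s [m hm]]; first by exists 0%N.
  have [m' hm'] := mem_places_upto (below w).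
  exists (maxn m m') => q; rewrite geq_max => /andP[mq mq'] u.
  by rewrite inE => /orP[/eqP ->|]; [exact: hm'|exact: hm].
pose S := places_upto (maxn n1 n2).
have Su : uniq S := places_upto_uniq _.
exists (flatten [seq T v | v <- S]); first exact: flatten_places_uniq.
apply: (le_trans (sum_below_le (S := S) _ Ju _)).
- by move=> w; rewrite mulr_ge0 ?local_weight_ge0 ?lnp_ge0.
- by move=> w wJ; rewrite h2 ?leq_maxr.
rewrite undup_id // big_flatten big_map -subr_ge0 -sumrB.
rewrite (eq_bigr (fun v => n%:R^-1 * ln (absQ R v c))).
  by rewrite -mulr_sumr h1 ?leq_maxl // mulr0.
move=> v _; rewrite -xc /total_log mulr_sumr -sumrB; apply: eq_bigr => w _.
rewrite -mulrBr -lnp_sub ?absval_gt0 // local_weightE; ring.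
Qed.

End Finite.

(** Without a finite basis over the rational numbers, all weights are zero. *)
Lemma sum_bounded (S : seq place_Q) (D : place_Q -> R) (J : seq pl) :
  (forall v, 0 <= D v) -> (forall v, v \notin S -> D v = 0) -> uniq J ->
  \sum_(w <- J) local_weight w * D (below w) <= \sum_(v <- undup S) D v.
Proof.
move=> D0 DS Ju; have [[n hn]|nb] := pselect (exists n, has_basis (rationals K) n).
  exact: (sum_local_bounded hn).
rewrite big1 ?sumr_ge0 // => w _; by rewrite local_weight0 ?mul0r.
Qed.

Lemma height_ge0 (I : finType) (x : I -> K) : (0 <= height R x)%E.
Proof.
apply: le_trans (limsup_sum_ge (s := [::]) _ _ _) => //; first by rewrite big_nil.
by move=> w; rewrite mulr_ge0 ?local_weight_ge0 ?lnp_ge0.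
Qed.

Lemma height_max (I : finType) (x : I -> K) (J : seq pl) : uniq J ->
  ((\sum_(w <- J) local_weight w * lnp (\big[Num.max/0]_i w (x i)))%:E <= height R x)%E.
Proof.
move=> Ju; have := @limsup_sum_ge R _ [set: pl]
  (fun w => local_weight w * lnp (\big[Num.max/0]_i w (x i))) J.
under eq_bigl => w do rewrite in_setT.
by apply=> // w; rewrite mulr_ge0 ?local_weight_ge0 ?lnp_ge0.
Qed.

Lemma sum_negative_height (I : finType) (x : I -> K) (i : I) (J : seq pl) :
  uniq J -> x i != 0 ->
  ((\sum_(w <- J) local_weight w * lnp (w (x i))^-1)%:E <= height R x)%E.
Proof.
move=> Ju xi; have [[n hn]|nb] := pselect (exists n, has_basis (rationals K) n).
  have [J' J'u] := negative_part_le hn Ju xi; rewrite -lee_fin => /le_trans; apply.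
  apply: le_trans (height_max x J'u); rewrite lee_fin; apply: ler_sum => w _.
  by rewrite ler_wpM2l ?local_weight_ge0 // lnp_mono // le_bigmax.
rewrite big1 ?height_ge0 // => w _; by rewrite local_weight0 ?mul0r.
Qed.

(** The absolute value of a logarithm is the sum of its positive part, bounded by
    the maximum in the height, and of its negative part, bounded by the product
    formula. *)
Lemma sum_abs_log_height (I : finType) (x : I -> K) (J : seq pl) : uniq J ->
  (forall i, x i != 0) ->
  ((\sum_(w <- J) local_weight w * \big[Num.max/0]_i `|ln (w (x i))|)%:E <=
    (1 + #|I|%:R)%:E * height R x)%E.
Proof.
move=> Ju x0.
have c0 : 0 < 1 + #|I|%:R :> R by rewrite ltr_pwDl.
have [hoo|hfin] := eqVneq (height R x) +oo%E.
  by rewrite hoo gt0_muley ?leey.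
have h0 := height_ge0 x.
have hE : height R x = (fine (height R x))%:E.
  by rewrite fineK // ge0_fin_numE // lt_neqAle hfin leey.
pose H := fine (height R x); rewrite -/H in hE; rewrite hE -EFinM lee_fin.
have pos : \sum_(w <- J) local_weight w * lnp (\big[Num.max/0]_i w (x i)) <= H.
  by rewrite -lee_fin -hE; exact: height_max.
have neg i : \sum_(w <- J) local_weight w * lnp (w (x i))^-1 <= H.
  by rewrite -lee_fin -hE; exact: sum_negative_height.
apply: (@le_trans _ _ (\sum_(w <- J) local_weight w *
    (lnp (\big[Num.max/0]_i w (x i)) + \sum_i lnp (w (x i))^-1))).
  apply: ler_sum => w _; rewrite ler_wpM2l ?local_weight_ge0 //.
  apply/bigmax_leP; split=> [|i _].
    by rewrite addr_ge0 ?lnp_ge0 // sumr_ge0 // => *; exact: lnp_ge0.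
  rewrite abs_ln ?absval_gt0 //; apply: lerD.
    by rewrite lnp_mono // le_bigmax.
  by rewrite (bigD1 i) //= lerDl sumr_ge0 // => *; exact: lnp_ge0.
under eq_bigr => w _ do rewrite mulrDr mulr_sumr.
rewrite big_split /= exchange_big mulrDl mul1r lerD //=.
rewrite mulr_natl -sumr_const; exact: ler_sum.
Qed.

End Sums.

(** * A neighbourhood of the trivial absolute value in the spectrum of Z *)

Section Seminorms.
Context (R : realType).
Local Notation ptw := {ptws int -> R}.

Lemma eval_continuous (n : int) : continuous (fun a : ptw => a n).
Proof. exact: (@proj_continuous int (fun=> R) n). Qed.

Lemma ptw_hausdorff : hausdorff_space ptw.
Proof. by apply: (@hausdorff_product int (fun=> R)) => n; exact: Rhausdorff. Qed.

Lemma ptw_cvg (T : Type) (F : set_system T) (u : T -> ptw) (l : ptw) : Filter F ->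
  (forall n : int, u t n @[t --> F] --> l n) -> u t @[t --> F] --> l.
Proof.
have surj (n : int) (W : set R) : W `<=` (fun a : ptw => a n) @` [set a | W (a n)].
  by move=> x Wx; exists (fun=> x).
move=> FF h; apply/cvg_sup => n; apply/cvg_image.
  by apply/seteqP; split=> // x _; exists (fun=> x).
move=> W /h hW; exists [set a : ptw | W (a n)]; first exact: hW.
by apply/seteqP; split=> [_ [a Wa <-]//|]; exact: surj.
Qed.

Lemma closed_eqf (T : topologicalType) (g h : T -> R) :
  continuous g -> continuous h -> closed [set x | g x = h x].
Proof.
move=> gc hc; have -> : [set x | g x = h x] = (fun x => g x - h x) @^-1` [set 0].
  by apply/seteqP; split=> x /= => [->|/eqP]; rewrite ?subrr // subr_eq0 => /eqP.
apply: preimage_closed; last exact: closed_eq.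
by move=> x _; apply: cvgB; [exact: gc|exact: hc].
Qed.

Lemma closed_lef (T : topologicalType) (g h : T -> R) :
  continuous g -> continuous h -> closed [set x | g x <= h x].
Proof.
move=> gc hc; have -> : [set x | g x <= h x] = (fun x => h x - g x) @^-1` [set y | 0 <= y].
  by apply/seteqP; split=> x /=; rewrite subr_ge0.
apply: preimage_closed; last exact: closed_ge.
by move=> x _; apply: cvgB; [exact: hc|exact: gc].
Qed.

Lemma continuous_addf (T : topologicalType) (g h : T -> R) :
  continuous g -> continuous h -> continuous (fun x => g x + h x).
Proof. by move=> gc hc x; apply: cvgD; [exact: gc|exact: hc]. Qed.

Lemma continuous_mulf (T : topologicalType) (g h : T -> R) :
  continuous g -> continuous h -> continuous (fun x => g x * h x).
Proof. by move=> gc hc x; apply: cvgM; [exact: gc|exact: hc]. Qed.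

(** The seminorms with [a M >= 1/2] form a compact neighbourhood of the trivial
    absolute value inside the open set where [M] does not vanish. *)
Definition large_at (M : int) : set ptw := [set a | berkovich_Z R a /\ 1 / 2 <= a M].

(** A closed subset of the product of the intervals [[0, |n|]], which is compact by
    Tychonoff's theorem. *)
Lemma large_at_compact M : compact (large_at M).
Proof.
have ccst (c : R) : continuous (fun _ : ptw => c) := @cst_continuous ptw R c.
have cD := @continuous_addf ptw; have cM := @continuous_mulf ptw.
have ev := eval_continuous.
pose box : set ptw := [set a | forall n : int, `[0, `|n|%:~R]%classic (a n)].
have box_compact : compact box.
  exact: (@tychonoff int (fun=> R) (fun n => `[0, `|n|%:~R]%classic)
    (fun n => @segment_compact R _ _)).
pose C := [set a : ptw | a 0 = 0] `&` [set a : ptw | a 1 = 1] `&`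
  (\bigcap_(mn in [set: int * int]) [set a : ptw | a (mn.1 * mn.2) = a mn.1 * a mn.2]) `&`
  (\bigcap_(mn in [set: int * int]) [set a : ptw | a (mn.1 + mn.2) <= a mn.1 + a mn.2]) `&`
  [set a : ptw | 1 / 2 <= a M].
have C_closed : closed C.
  apply: closedI; last exact: closed_lef.
  apply: closedI; last by apply: closed_bigI => mn _; apply: closed_lef => //; exact: cD.
  apply: closedI; last by apply: closed_bigI => mn _; apply: closed_eqf => //; exact: cM.
  by apply: closedI; exact: closed_eqf.
have -> : large_at M = box `&` C.
  apply/seteqP; split=> a.
    move=> [[[a0 a1] aM aD ab] h]; split.
      by move=> n /=; rewrite in_itv /= ab.
    by split=> //; split; [split|] => // -[m n] _ /=; rewrite ?aM ?aD.
  move=> [ab [[[[a0 a1] aM] aD] h]]; split=> //; split=> // [m n|m n].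
  - exact: (aM (m, n)).
  - exact: (aD (m, n)).
exact: compact_closedI.
Qed.

Lemma near_trivial_large M : M != 0 ->
  nbhs (trivial_abs R) [set a : ptw | 1 / 2 < a M].
Proof.
move=> M0; have half : nbhs (trivial_abs R M) [set x : R | 1 / 2 < x].
  apply: open_nbhs_nbhs; split; first exact: open_gt.
  by rewrite /trivial_abs M0 /=; lra.
have h := @eval_continuous M (trivial_abs R).
have h' := h _ half.
exact: h'.
Qed.

Lemma powR_cvg1 (x : R) : 0 < x -> x `^ e @[e --> 0^'+] --> (1 : R).
Proof.
move=> x0; have -> : (fun e => x `^ e) = (fun e => expR (e * ln x)).
  by apply/funext => e; rewrite /powR gt_eqF.
rewrite -expR0; apply: continuous_cvg; first exact: continuous_expR.
rewrite -[X in _ --> X](mul0r (ln x)); apply: cvgM; last exact: cvg_cst.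
exact: cvg_at_right_filter.
Qed.

(** The powers of a place tend to the trivial absolute value when the exponent
    tends to 0. *)
Lemma small_powers_near_trivial v (O : set ptw) : nbhs (trivial_abs R) O ->
  exists2 e0 : R, 0 < e0 &
    forall e, 0 < e -> e < e0 -> O (fun n => normalized_abs R v n `^ e).
Proof.
move=> Onb.
have : (fun n => normalized_abs R v n `^ e) @[e --> 0^'+] --> trivial_abs R.
  apply: ptw_cvg => n; rewrite /trivial_abs; have [->|n0] := eqVneq n 0.
    rewrite nabs0; apply: cvg_near_cst.
    by near=> e; rewrite powR0 // gt_eqF.
  by apply: powR_cvg1; exact: nabs_gt0.
move=> /(_ _ Onb) [e0 /= e00 h]; exists e0 => // e ep ee0.
by apply: (h e) => //=; rewrite sub0r normrN gtr0_norm.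
Unshelve. all: by end_near. Qed.

(** For a prime larger than [|n|], all powers take the value 1 at [n]. So a sequence
    of powers of places at larger and larger primes tends to the trivial absolute
    value, whatever the exponents. *)
Lemma large_primes_near_trivial (O : set ptw) : nbhs (trivial_abs R) O ->
  exists n0, forall p (pp : prime p) (e : R), (n0 <= p)%N -> 0 < e ->
    O (fun n => normalized_abs R (finite_place pp) n `^ e).
Proof.
move=> Onb; apply: contrapT => no.
have bad n : exists u : ptw, ~ O u /\ exists p (pp : prime p) (e : R),
    [/\ (n <= p)%N, 0 < e & u = (fun n => normalized_abs R (finite_place pp) n `^ e)].
  apply: contrapT => h; apply: no; exists n => p pp e np e0.
  apply: contrapT => nO; apply: h; exists (fun n => normalized_abs R (finite_place pp) n `^ e).
  by split=> //; exists p, pp, e.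
have /choice[u hu] := bad.
have : u m @[m --> \oo] --> trivial_abs R.
  apply: ptw_cvg => n; apply: cvg_near_cst.
  exists `|n|.+1 => // m /= nm; have [_ [p [pp [e [mp e0 ->]]]]] := hu m.
  rewrite /trivial_abs; have [->|n0] := eqVneq n 0.
    by rewrite nabs0 powR0 // gt_eqF.
  rewrite nabs_p // (_ : logn p `|n| = 0%N) ?expr0 ?invr1 ?powR1 //.
  apply/eqP; rewrite -leqn0 leqNgt logn_gt0 mem_primes; apply/negP => /and3P[_ n0' pn].
  by have := dvdn_leq n0' pn; rewrite leqNgt (leq_trans nm mp).
move=> /(_ _ Onb)[m _ /(_ m (leqnn m))] /= Ou.
by have [nO _] := hu m.
Qed.

End Seminorms.

(** * Scaling the points of the analytification *)

Section Ultrametric.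
Context (R : realType) (K : fieldType) (w : absval R K).
Hypothesis w_int : forall n : int, w n%:~R <= 1.

(** Expand a high power of the sum: the binomial coefficients have absolute value
    at most 1. *)
Lemma absval_ultra x y : w (x + y) <= Num.max (w x) (w y).
Proof.
set M := Num.max _ _.
have M0 : 0 <= M by rewrite le_max absval_ge0.
have key m : w (x + y) ^+ m <= m.+1%:R * M ^+ m.
  rewrite -absvalX exprDn; apply: le_trans (absval_sum _ _ _ _) _.
  rewrite -[m.+1 in leRHS]card_ord mulr_natl -sumr_const; apply: ler_sum => i _.
  rewrite -mulr_natl absvalM !absvalM !absvalX -[leRHS]mul1r.
  have im : (i <= m)%N by rewrite -ltnS ltn_ord.
  rewrite ler_pM ?absval_ge0 ?mulr_ge0 ?exprn_ge0 ?absval_ge0 //.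
    by have := w_int 'C(m, i); rewrite -pmulrn.
  have -> : M ^+ m = M ^+ (m - i) * M ^+ i by rewrite -exprD subnK.
  rewrite ler_pM ?exprn_ge0 ?absval_ge0 //;
    by rewrite lerXn2r ?nnegrE ?absval_ge0 // /M le_max lexx ?orbT.
exact: ler_of_powers_linear (absval_ge0 _ _) M0 key.
Qed.

Context (e : R) (e0 : 0 < e).

Lemma absval_ultra_powD x y : w (x + y) `^ e <= w x `^ e + w y `^ e.
Proof.
have e0' := ltW e0.
apply: (@le_trans _ _ (Num.max (w x) (w y) `^ e)).
  by apply: ge0_ler_powR; rewrite ?nnegrE ?absval_ultra ?le_max ?absval_ge0.
by rewrite /Num.max; case: ifP => _; rewrite ?lerDl ?lerDr powR_ge0.
Qed.

Lemma absval_ultra_pow_eq0 x : w x `^ e = 0 <-> x = 0.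
Proof.
split=> [/powR_eq0_eq0/absval_eq0//|->].
by rewrite absval0 powR0 // gt_eqF.
Qed.

Lemma absval_ultra_powM x y : w (x * y) `^ e = w x `^ e * w y `^ e.
Proof. by rewrite absvalM powRM ?absval_ge0. Qed.

(** An ultrametric absolute value may be raised to powers greater than 1. *)
Definition absval_ultra_pow : absval R K :=
  AbsVal (fun x => powR_ge0 (w x) e) absval_ultra_pow_eq0 absval_ultra_powM
    absval_ultra_powD.

End Ultrametric.

Section Scaling.
Context (R : realType) (X : scheme).
Local Notation Y := (analytification R X).

(** For an exponent [e > 1], the point [y] is the power of exponent [1/e] of the
    scaled point [y'], which determines the values of log-floating functions at
    [y']. *)
Lemma scale_point (y : Y) (e : R) : 0 < e ->
  e <= 1 \/ (forall n : int, pr y n <= 1) ->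
  exists y' : Y, [/\ pr y' = (fun n => pr y n `^ e),
    forall F : Y -> R, log_floating F -> F y' = e * F y
    & forall g : Y -> \bar R, log_floatinge g -> g y' = (e%:E * g y)%E].
Proof.
move=> e0 h; have [e1|e1] := leP e 1.
  have e01 : 0 < e <= 1 by rewrite e0.
  by exists (an_pow y e01); split=> // [F|g] ->.
case: h => [|yn]; first by rewrite leNgt e1.
have ei01 : 0 < e^-1 <= 1 by rewrite invr_gt0 e0 invf_le1 // ltW.
case: y yn => x w yn; pose y' : Y := AnPoint (absval_ultra_pow (w := w) yn e0).
have yE : an_pow y' ei01 = AnPoint w.
  rewrite /an_pow /y' /=; congr AnPoint.
  by apply: absval_ext => u /=; rewrite -powRrM mulfV ?gt_eqF // powRr1 // absval_ge0.
exists y'; split=> // [F Ff|g gf].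
  by rewrite -[in RHS]yE Ff mulrA mulfV ?gt_eqF // mul1r.
by rewrite -[in RHS]yE gf muleA -EFinM mulfV ?gt_eqF // mul1e.
Qed.

End Scaling.

(** * The local inequality *)

Section KeyInequality.
Context (R : realType) (X : scheme) (NY : int) (NY0 : NY != 0).
Local Notation Y := (analytification R X).
Context (E f1 f2 : Y -> R) (g1 : Y -> \bar R).
Hypothesis pr_range : range (@pr R X) = nonvanishing R NY.
Hypothesis E_ge0 : forall y, 0 <= E y.
Hypotheses (E_cont : continuous E) (f2_cont : continuous f2).
Hypotheses (E_float : log_floating E) (f1_float : log_floating f1).
Hypotheses (f2_float : log_floating f2) (g1_float : log_floatinge g1).

Definition sublevel (s t : R) : set Y :=
  [set y | f1 y <= s] `&` [set y | (g1 y <= (t * f2 y)%:E)%E].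

Hypothesis sublevel_proper : forall s t : R, 0 < s -> 0 < t ->
  proper_on (sublevel s t) (nonvanishing R NY) (@pr R X).

Context (A : R) (B : place_Q -> R) (A_gt0 : 0 < A).
Hypothesis B_finite : finite_set [set v | B v != 0].
Hypothesis g1_le : forall v (y : Y), pr y = normalized_abs R v ->
  (g1 y <= (A * f1 y + B v)%:E)%E.

Context (r0 : R) (tau : R -> R) (r0_gt0 : 0 < r0).
Hypothesis tau_oo : tau r @[r --> +oo] --> +oo.
Hypothesis E_trivial : forall r (y : Y), r0 <= r -> (g1 y <= (tau r * f2 y)%:E)%E ->
  pr y = trivial_abs R -> r^-1 * f2 y <= E y.

Lemma pr_nonvanishing (y : Y) : nonvanishing R NY (pr y).
Proof. by rewrite -pr_range; exists y. Qed.

(** Above a fixed place, [f2] is bounded where [f1] is: where [f2 >= 1], the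
    bound on [g1] confines the point to a compact set. *)
Lemma f2_bounded v (M : R) : 0 < M -> exists2 D : R, 0 <= D &
  forall y : Y, pr y = normalized_abs R v -> f1 y <= M -> f2 y <= D.
Proof.
(* [t] bounds [g1] above [v] where [f1 <= M]. *)
move=> M0; pose t := A * M + `|B v| + 1.
have t0 : 0 < t by rewrite ltr_pwDr // addr_ge0 ?mulr_ge0 ?(ltW A_gt0) ?(ltW M0).
pose C := sublevel M t `&` @pr R X @^-1` [set normalized_abs R v].
have [[y0 [y0v y0M y01]]|none] := pselect (exists y : Y,
    [/\ pr y = normalized_abs R v, f1 y <= M & 1 <= f2 y]); last first.
  exists 1 => // y yv yM; rewrite leNgt; apply/negP => y1.
  by apply: none; exists y; split=> //; exact: ltW.
have inC (y : Y) : pr y = normalized_abs R v -> f1 y <= M -> 1 <= f2 y -> C y.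
  move=> yv yM y1; split=> //; split=> //=; apply: le_trans (g1_le yv) _.
  rewrite lee_fin; apply: (@le_trans _ _ t); last by rewrite ler_peMr // ltW.
  have := ler_norm (B v); have := ler_wpM2l (ltW A_gt0) yM; rewrite /t; lra.
have C_compact : compact C.
  have [_ _ h] := sublevel_proper M0 t0; apply: h; last exact: compact_set1.
  by move=> _ ->; rewrite -y0v; exact: pr_nonvanishing.
have C0 : C !=set0 by exists y0; exact: inC.
have [|c _ hc] := @compact_EVT_max _ R f2 C C0 C_compact.
  exact: continuous_subspaceT.
exists (Num.max 1 (f2 c)) => [|y yv yM]; first by rewrite le_max ler01.
rewrite le_max; have [//|y1] := leP (f2 y) 1; apply/orP; right.
by apply: hc; rewrite inE; apply: inC => //; exact: ltW.
Qed.

(** The image of the points that violate the conclusion is closed by properness,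
    and it misses the trivial absolute value by hypothesis. *)
Lemma near_trivial_fibre (t d r : R) : 0 < t -> 0 < d -> r0 <= r -> t <= tau r ->
  exists2 O : set {ptws int -> R}, nbhs (trivial_abs R) O &
    forall y : Y, O (pr y) -> sublevel 1 t y -> d <= f2 y -> f2 y - d < r * E y.
Proof.
move=> t0 d0 r0r tr; have r_gt0 : 0 < r by apply: lt_le_trans r0r.
pose C := sublevel 1 t `&` @pr R X @^-1` large_at NY.
have [prc _ h] := sublevel_proper ltr01 t0.
have large_sub : large_at NY `<=` @nonvanishing R NY.
  move=> a [ab aN]; split=> // aN0; move: aN; rewrite aN0.
  by apply/negP; rewrite -ltNge divr_gt0.
have C_compact : compact C := h _ large_sub (@large_at_compact R NY).
have Fcl : closed ([set y | d <= f2 y] `&` [set y | r * E y <= f2 y + - d]).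
  have dc : continuous (fun _ : Y => d) := @cst_continuous Y R d.
  have dc' : continuous (fun _ : Y => - d) := @cst_continuous Y R (- d).
  have rc : continuous (fun _ : Y => r) := @cst_continuous Y R r.
  apply: closedI; first exact: closed_lef.
  by apply: closed_lef; [exact: continuous_mulf|exact: continuous_addf].
pose Z := C `&` ([set y | d <= f2 y] `&` [set y | r * E y <= f2 y + - d]).
have Z_compact : compact Z by exact: compact_closedI.
have prZ_closed : closed (@pr R X @` Z).
  apply: compact_closed; first exact: ptw_hausdorff.
  apply: continuous_compact => //; apply: continuous_subspaceW prc.
  by move=> y [[]].
have triv : ~ (@pr R X @` Z) (trivial_abs R).
  move=> [y [[[y1 yt] _] [/= yd yE]] ytriv].
  have f20 : 0 <= f2 y by apply: le_trans yd; exact: ltW.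
  have : r^-1 * f2 y <= E y.
    apply: E_trivial => //; apply: le_trans yt _.
    by rewrite lee_fin ler_wpM2r.
  by rewrite ler_pdivrMl //; move: yE d0; lra.
exists (~` (@pr R X @` Z) `&` [set a | 1 / 2 < a NY]).
  apply: filterI; first by apply: open_nbhs_nbhs; split=> //; exact: closed_openC.
  exact: near_trivial_large.
move=> y [nZ yN] ys yd; rewrite ltNge; apply/negP => yE; apply: nZ.
exists y => //; split=> //; split=> //; split; first by case: (pr_nonvanishing y).
exact: ltW.
Qed.

(** Scale to [f1 = 1] and use the neighbourhood of the trivial absolute value. The
    exceptional set [S] contains the places with [B v <> 0], the infinite place and
    the small primes; for these, [D v] bounds [f2] where [f1] is at most a constant
    [M v] chosen so that beyond it the scaled point is near the trivial absolute
    value. *)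
Lemma key_inequality (d : R) : 0 < d -> exists r (S : seq place_Q) (D : place_Q -> R),
  [/\ 0 < r, forall v, 0 <= D v, forall v, v \notin S -> D v = 0
    & forall v (y : Y), pr y = normalized_abs R v -> 0 < f1 y ->
        f2 y <= r * E y + d * f1 y + D v].
Proof.
move=> d0.
have [S0 S0E] : exists S0 : seq place_Q, forall v, B v != 0 -> v \in S0.
  have /finite_seqP[s hs] := B_finite; exists s => v Bv.
  by have : [set` s] v by rewrite -hs.
pose Bm := \sum_(v <- S0) `|B v|.
have Bm0 : 0 <= Bm by exact: sumr_ge0.
have BBm v : B v <= Bm.
  have [->//|Bv] := eqVneq (B v) 0.
  apply: le_trans (ler_norm _) _; rewrite /Bm (big_rem v) ?S0E //= lerDl.
  exact: sumr_ge0.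
(* Once [f1] is scaled to 1, [g1] is at most [A + Bm], hence at most [t * f2] as
   soon as [f2] is at least [d]. *)
pose t := (A + Bm) / d.
have t0 : 0 < t by rewrite divr_gt0 // ltr_pwDl.
have [r [r0r tr]] : exists r, r0 <= r /\ t <= tau r.
  have : \forall r \near +oo, t <= tau r by exact: (cvgryPge tau).1 tau_oo t.
  move=> h; near (pinfty_nbhs R) => r; exists r; split; near: r => //.
  by apply: nbhs_pinfty_ge; rewrite num_real.
have r_gt0 : 0 < r by apply: lt_le_trans r0r.
have [U Unb hU] := near_trivial_fibre t0 d0 r0r tr.
have [n0 hn0] := large_primes_near_trivial Unb.
have /choice[ev hev] v : exists e0 : R, 0 < e0 /\
    forall e, 0 < e -> e < e0 -> U (fun n => normalized_abs R v n `^ e).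
  by have [e0 ? ?] := small_powers_near_trivial v Unb; exists e0.
pose M v := 1 + (ev v)^-1.
have M0 v : 0 < M v by rewrite ltr_pwDl // invr_ge0 ltW //; case: (hev v).
have /choice[D0 hD0] v : exists D, 0 <= D /\
    forall y : Y, pr y = normalized_abs R v -> f1 y <= M v -> f2 y <= D.
  by have [D ? ?] := f2_bounded v (M0 v); exists D.
pose S := S0 ++ places_upto n0.
pose D v := if v \in S then D0 v else 0.
have D_ge0 v : 0 <= D v by rewrite /D; case: ifP => // _; case: (hD0 v).
exists r, S, D; split=> // [v /negbTE vS|v y yv y0]; first by rewrite /D vS.
have rE : 0 <= r * E y by rewrite mulr_ge0 // ltW.
(* It suffices to treat points that can be scaled to [f1 = 1] near the trivial
   absolute value. *)
have main : U (fun n => normalized_abs R v n `^ (f1 y)^-1) ->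
    B v / f1 y <= Bm -> (f1 y)^-1 <= 1 \/ (forall n, pr y n <= 1) ->
    f2 y <= r * E y + d * f1 y.
  move=> Oy By; have i0 : 0 < (f1 y)^-1 by rewrite invr_gt0.
  move=> /(scale_point i0)[y' [prE fE gE]].
  have [y'd|y'd] := ltP (f2 y') d.
    move: y'd; rewrite (fE _ f2_float) mulrC ltr_pdivrMr // => h.
    by apply: le_trans (ltW h) _; rewrite lerDr.
  have f1y' : f1 y' = 1 by rewrite (fE _ f1_float) mulVf ?gt_eqF.
  have : f2 y' - d < r * E y'.
    apply: hU => //; first by rewrite prE yv.
    split; first by rewrite /= f1y'.
    rewrite /= (gE _ g1_float).
    apply: (@le_trans _ _ ((f1 y)^-1%:E * (A * f1 y + B v)%:E)%E).
      by apply: lee_wpmul2l; [rewrite lee_fin ltW|exact: g1_le].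
    rewrite -EFinM lee_fin mulrDr mulrCA mulVf ?gt_eqF // mulr1 [_ * B v]mulrC.
    apply: (@le_trans _ _ (A + Bm)); first by rewrite lerD2l.
    by rewrite -[leLHS](divfK (lt0r_neq0 d0)) -/t ler_wpM2l // ltW.
  rewrite (fE _ f2_float) (fE _ E_float) => h.
  have unscale z : z = f1 y * ((f1 y)^-1 * z) by rewrite mulrA mulfV ?gt_eqF // mul1r.
  rewrite [f2 y]unscale [E y]unscale.
  by move: h => /ltW; rewrite -(ler_pM2l y0); lra.
have [vS|vS] := boolP (v \in S); last first.
  rewrite /D (negbTE vS) addr0; move: vS; rewrite mem_cat negb_or => /andP[vS0 vn0].
  have Bv : B v = 0 by apply/eqP; apply: contraNT vS0 => /S0E.
  have [p [pp vE]] : exists p (pp : prime p), v = finite_place pp.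
    by case: (v) vn0 => [|p pp]; [rewrite inE eqxx|exists p, pp].
  apply: main; rewrite ?Bv ?mul0r //.
    rewrite vE; apply: hn0; last by rewrite invr_gt0.
    rewrite leqNgt; apply: contra vn0 => pn; rewrite vE inE; apply/orP; right.
    rewrite mem_pmap; apply/mapP; exists p; first by rewrite mem_iota.
    by rewrite prime_placeT.
  by right=> n; rewrite yv vE; exact: nabs_le1.
have DE : D v = D0 v by rewrite /D vS.
have [D0v hDv] := hD0 v; have [ev0 hevv] := hev v.
have [yM|yM] := leP (f1 y) (M v).
  rewrite DE; apply: le_trans (hDv y yv yM) _.
  by rewrite lerDr addr_ge0 // mulr_ge0 ?ltW.
have y1 : 1 < f1 y by apply: le_lt_trans yM; rewrite lerDl invr_ge0 ltW.
apply: (@le_trans _ _ (r * E y + d * f1 y)); last by rewrite lerDl.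
apply: main.
- apply: hevv; first by rewrite invr_gt0.
  by rewrite invf_plt ?posrE //; apply: le_lt_trans yM; rewrite lerDr.
- rewrite ler_pdivrMr //; apply: le_trans (BBm v) _.
  by rewrite ler_peMr // ltW.
- by left; rewrite invf_le1 // ltW.
Unshelve. all: by end_near. Qed.

End KeyInequality.

(** * From the local inequality to heights *)

Lemma gvalue_unit (X : scheme) (s : global_sections X) (x : X) :
  invertible s -> gvalue s x != 0.
Proof.
move=> [t st]; apply/eqP => s0.
have : gvalue s x * gvalue t x = 1.
  rewrite /gvalue /value -rmorphM.
  have -> : germ (U := opensT X) (x := x) Logic.I s * germ (U := opensT X) Logic.I t =
    germ (U := opensT X) Logic.I (s * t) by exact: stalk_mulE.
  by rewrite st; exact: rmorph1.
by rewrite s0 mul0r => /eqP; rewrite eq_sym oner_eq0.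
Qed.

Section Global.
Context (R : realType) (X : scheme).
Local Notation Y := (analytification R X).
Context (E f1 f2 : Y -> R).
Hypotheses (E_ge0 : forall y, 0 <= E y).

Lemma pr_an_place (Q : Qbar_point X) (w : place R (residue_field (Qpt Q))) :
  pr (an_place w) = normalized_abs R (below w).
Proof. by apply/funext => n; exact: above_below. Qed.

Lemma height_of_ge (Q : Qbar_point X) (J : seq (place R (residue_field (Qpt Q)))) :
  uniq J ->
  ((\sum_(w <- J) local_weight w * E (an_place w))%:E <= height_of Q E)%E.
Proof.
move=> Ju; have := @limsup_sum_ge R _ setT (fun w => local_weight w * E (an_place w)) J.
under eq_bigl => w do rewrite in_setT.
by apply=> // w; rewrite mulr_ge0 ?local_weight_ge0.
Qed.

Context (r d : R) (S : seq place_Q) (D : place_Q -> R).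
Hypotheses (r_gt0 : 0 < r) (D_ge0 : forall v, 0 <= D v).
Hypothesis D_supp : forall v, v \notin S -> D v = 0.
Hypothesis local : forall v (y : Y), pr y = normalized_abs R v -> 0 < f1 y ->
  f2 y <= r * E y + d * f1 y + D v.
Hypothesis f1_ge0 : forall y, 0 <= f1 y.
Hypothesis d_ge0 : 0 <= d.

(** The terms with [f1 = 0] are absent from the left side and nonnegative on the
    right side. *)
Lemma sum_local_inequality (Q : Qbar_point X) (J : seq (place R (residue_field (Qpt Q)))) :
  uniq J ->
  \sum_(w <- J | w \in [set w | 0 < f1 (an_place w)]) local_weight w * f2 (an_place w) <=
  r * (\sum_(w <- J) local_weight w * E (an_place w)) +
  d * (\sum_(w <- J) local_weight w * f1 (an_place w)) + \sum_(v <- undup S) D v.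
Proof.
move=> Ju; apply: le_trans (lerD (lexx _) (sum_bounded (Qemb Q) D_ge0 D_supp Ju)).
rewrite !mulr_sumr -!big_split /= big_mkcond; apply: ler_sum => w _.
have lw := local_weight_ge0 w.
rewrite !(mulrCA _ (local_weight w)) -!mulrDr.
case: ifPn => [|_].
  rewrite inE /= => h; rewrite ler_wpM2l //.
  by apply: local h; exact: pr_an_place.
by rewrite !mulr_ge0 ?addr_ge0 // ?mulr_ge0 // ltW.
Qed.

End Global.

Section Units.
Context (R : realType) (X : scheme) (F : unit_family X).
Local Notation Y := (analytification R X).

Lemma abs_at_gt0 i (y : Y) : 0 < abs_at (F i) y.
Proof. by rewrite absval_gt0 // gvalue_unit //; exact: fam_invertible. Qed.

Lemma max_abs_log_ge0 (y : Y) : 0 <= max_abs_log F y.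
Proof.
rewrite /max_abs_log; elim/big_ind : _ => // x z x0 z0; by rewrite le_max x0.
Qed.

Lemma abs_log_le (y : Y) i : `|ln (abs_at (F i) y)| <= max_abs_log F y.
Proof. by rewrite /max_abs_log; exact: (le_bigmax _ (fun i => `|ln (abs_at (F i) y)|)). Qed.

Lemma max_abs_log0 (y : Y) : max_abs_log F y <= 0 -> forall i, abs_at (F i) y = 1.
Proof.
move=> y0 i; have := le_trans (abs_log_le y i) y0; rewrite normr_le0 => /eqP h.
by apply: ln_inj; rewrite ?posrE ?abs_at_gt0 // h ln1.
Qed.

Lemma lnp_max_le (y : Y) : lnp (\big[Num.max/0]_i abs_at (F i) y) <= max_abs_log F y.
Proof.
apply: (@le_trans _ _ (lnp (expR (max_abs_log F y)))).
  apply: lnp_mono; apply/bigmax_leP; split=> [|i _]; first exact: expR_ge0.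
  rewrite -[leLHS]lnK ?posrE ?abs_at_gt0 // ler_expR.
  by apply: le_trans (ler_norm _) _; exact: abs_log_le.
by rewrite /lnp expRK ge_max lexx max_abs_log_ge0.
Qed.

Lemma lnp_max0 (y : Y) : (forall i, abs_at (F i) y = 1) ->
  lnp (\big[Num.max/0]_i abs_at (F i) y) = 0.
Proof.
move=> h; apply/eqP; rewrite eq_le lnp_ge0 andbT.
apply: (@le_trans _ _ (lnp 1)); last by rewrite /lnp ln1 maxxx.
by apply: lnp_mono; apply/bigmax_leP; split=> // i _; rewrite h.
Qed.

Lemma sum_max_abs_log (Q : Qbar_point X) (J : seq (place R (residue_field (Qpt Q)))) :
  uniq J ->
  ((\sum_(w <- J) local_weight w * max_abs_log F (an_place w))%:E <=
    (1 + #|fam_idx F|%:R)%:E * family_height R F Q)%E.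
Proof.
move=> Ju; apply: (@sum_abs_log_height R _ (Qemb Q) _ (fun i => gvalue (F i) (Qpt Q))) => //.
by move=> i; apply: gvalue_unit; exact: fam_invertible.
Qed.

End Units.

Lemma limsup_sum_mono (R : realType) (I : choiceType) (P P' : set I) (a a' : I -> R) :
  (forall J : {fset I}, \sum_(i <- J | i \in P) a i <= \sum_(i <- J | i \in P') a' i) ->
  (limsup_sum P a <= limsup_sum P' a')%E.
Proof.
move=> h; apply/ereal_infP => _ [J0 _ <-].
apply: (@le_trans _ _ (ereal_sup [set (\sum_(i <- J | i \in P) a i)%:E
   | J in [set J : {fset I} | (J0 `<=` J)%fset]])).
  by apply: ereal_inf_lbound; exists J0.
apply/ereal_supP => _ [J J0J <-].
apply: (@le_trans _ _ (\sum_(i <- J | i \in P') a' i)%:E); first by rewrite lee_fin.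
by apply: ereal_sup_ubound; exists J.
Qed.

(** The terms of the height of [F2] vanish where [f1 = 0], and are at most
    [max_abs_log F2] elsewhere. *)
Lemma height_le_positive_sum (R : realType) (X : scheme) (F1 F2 : unit_family X)
    (Q : Qbar_point X) :
  (forall y : analytification R X,
     (forall i, abs_at (F1 i) y = 1) -> forall i, abs_at (F2 i) y = 1) ->
  (family_height R F2 Q <= positive_sum Q (max_abs_log (R := R) F1) (max_abs_log F2))%E.
Proof.
move=> F12; apply: limsup_sum_mono => J.
under eq_bigl => w do rewrite in_setT.
rewrite [leRHS]big_mkcond; apply: ler_sum => w _.
have lw := local_weight_ge0 w.
case: ifPn => [_|].
  by rewrite ler_wpM2l //; exact: (lnp_max_le F2 (an_place w)).
rewrite notin_setE /= => /negP; rewrite -leNgt => f10.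
have h := lnp_max0 (F12 _ (max_abs_log0 f10)).
rewrite (_ : lnp _ = 0) ?mulr0 //; exact: h.
Qed.

(** The rearrangement common to both inequalities; an infinite [h] makes the left
    side [-oo]. *)
Lemma ereal_rearrange (R : realType) (s h e : \bar R) (r eps D : R) :
  0 < r -> 0 < eps -> (0 <= h)%E -> (0 <= e)%E ->
  (h \is a fin_num -> e \is a fin_num -> (s <= (r * fine e + eps * fine h + D)%:E)%E) ->
  ((r^-1)%:E * (s - eps%:E * h) + (- D / r)%:E <= e)%E.
Proof.
move=> r0 eps0 h0 e0 H; have ri0 : 0 < r^-1 by rewrite invr_gt0.
case: e e0 H => [e _|_ _|]//; last by rewrite leey.
case: h h0 => [h _ H|_ _|]//; last first.
  by rewrite gt0_muley ?lte_fin // [(- +oo)%E]/= addeNy gt0_muleNy ?lte_fin // addNye leNye.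
have := H isT isT; case: s {H} => [s||].
- rewrite /= lee_fin => hs.
  rewrite [X in (X <= _)%E](_ : _ = (r^-1 * (s - eps * h) + - D / r)%:E) // lee_fin.
  have -> : r^-1 * (s - eps * h) + - D / r = (s - eps * h - D) / r by field; rewrite gt_eqF.
  by rewrite ler_pdivrMr //; move: hs; lra.
- by rewrite leye_eq.
- by move=> _; rewrite addNye gt0_muleNy ?lte_fin // addNye leNye.
Qed.

Unset Implicit Arguments.
Set Strict Implicit.
Set Printing Implicit Defensive.

Theorem mainTheorem14 (R : realType) (N : int) (N0 : N != 0)
  (X : scheme) (str : {rmorphism Zinv N -> global_sections X})
  (X_lft : locally_of_finite_type str)
  (X_generic : exists x : X, forall n : int, n != 0 ->
     (n%:~R : residue_field x) != 0)
  (NY : int) (NY0 : NY != 0)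
  (pr_range : range (@pr R X) = nonvanishing R NY)
  (E f1 f2 : analytification R X -> R) (g1 : analytification R X -> \bar R)
  (E_ge0 : forall y, 0 <= E y) (f1_ge0 : forall y, 0 <= f1 y)
  (g1_lty : forall y, (g1 y < +oo)%E)
  (E_cont : continuous E) (f1_cont : continuous f1)
  (f2_cont : continuous f2) (g1_cont : continuous g1)
  (E_float : log_floating E) (f1_float : log_floating f1)
  (f2_float : log_floating f2) (g1_float : log_floatinge g1)
  (V := fun s : R => [set y | f1 y <= s])
  (W := fun t : R => [set y | (g1 y <= (t * f2 y)%:E)%E])
  (hyp_a : forall s t : R, 0 < s -> 0 < t ->
     proper_on (V s `&` W t) (nonvanishing R NY) (@pr R X))
  (hyp_b : exists (A : R) (B : place_Q -> R),
     [/\ 0 < A, finite_set [set v | B v != 0]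
       & forall v y, pr y = normalized_abs R v ->
           (g1 y <= (A * f1 y + B v)%:E)%E])
  (hyp_c : exists (r0 : R) (tau : R -> R),
     [/\ 0 < r0, forall r, 0 < r -> 0 < tau r,
         tau r @[r --> +oo%R] --> +oo%R
       & forall r y, r0 <= r -> W (tau r) y -> pr y = trivial_abs R ->
           r^-1 * f2 y <= E y]) :
  forall F1 : unit_family X, f1 = max_abs_log F1 ->
  [/\ forall eps : R, 0 < eps -> exists C D : R, 0 < C /\
        forall Q : Qbar_point X,
          (C%:E * (positive_sum Q f1 f2 - eps%:E * family_height R F1 Q) + D%:E
             <= height_of Q E)%E
    & forall F2 : unit_family X, f2 = max_abs_log F2 ->
      (forall y : analytification R X,
         (forall i, abs_at (F1 i) y = 1) -> forall i, abs_at (F2 i) y = 1) ->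
      (forall eps : R, 0 < eps -> exists C D : R, 0 < C /\
        forall Q : Qbar_point X,
          (C%:E * (family_height R F2 Q - eps%:E * family_height R F1 Q) + D%:E
             <= height_of Q E)%E) /\
      (F1 = F2 -> exists C D : R, 0 < C /\
        forall Q : Qbar_point X,
          (C%:E * family_height R F2 Q + D%:E <= height_of Q E)%E)].
Proof.
move=> F1 f1E.
have [A [B [A0 Bfin gle]]] := hyp_b; have [r0 [tau [r00 _ tauoo Etriv]]] := hyp_c.
have key := key_inequality NY0 pr_range E_ge0 E_cont f2_cont E_float f1_float
  f2_float g1_float hyp_a A0 Bfin gle r00 tauoo Etriv.
have hE0 Q : (0 <= height_of Q E)%E.
  by apply: le_trans (height_of_ge E_ge0 (J := [::]) _); rewrite ?big_nil.
have part_i eps : 0 < eps -> exists C D : R, 0 < C /\ forall (Q : Qbar_point X),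
    (C%:E * (positive_sum Q f1 f2 - eps%:E * family_height R F1 Q) + D%:E
             <= height_of Q E)%E.
  move=> eps0; pose c : R := 1 + #|fam_idx F1|%:R.
  have c0 : 0 < c by rewrite ltr_pwDl.
  have d0 : 0 < eps / c by rewrite divr_gt0.
  have [r [S [D [r_gt0 D0 DS hloc]]]] := key _ d0.
  pose Dt := \sum_(v <- undup S) D v.
  exists r^-1, (- Dt / r); split; first by rewrite invr_gt0.
  move=> Q; apply: ereal_rearrange => //; first exact: height_ge0.
  move=> hfin efin; apply: limsup_sum_le => J; rewrite lee_fin.
  have Ju := fset_uniq J.
  apply: le_trans (sum_local_inequality E_ge0 r_gt0 D0 DS hloc f1_ge0 (ltW d0) Ju) _.
  rewrite lerD2r lerD //.
    by rewrite ler_pM2l // -lee_fin fineK //; exact: height_of_ge.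
  have := sum_max_abs_log F1 Ju; rewrite -[family_height R F1 Q]fineK // -EFinM lee_fin -f1E.
  move=> /(ler_wpM2l (ltW d0)) /le_trans; apply.
  by rewrite /= mulrA -/c divfK ?gt_eqF.
split=> // F2 f2E F12; split=> [eps /part_i[C [D [C0 hCD]]]|F1F2].
  exists C, D; split=> // Q; apply: le_trans (hCD Q).
  apply: leeD2r; apply: lee_wpmul2l; first by rewrite lee_fin ltW.
  apply: leeB => //; rewrite f1E f2E; exact: height_le_positive_sum.
subst F2; have f12 : f1 = f2 by rewrite f1E f2E.
have half : 0 < 1 / 2 :> R by rewrite divr_gt0.
have [r [S [D [r_gt0 D0 DS hloc]]]] := key _ half.
(* As [f1 = f2], half of the left side absorbs the term in [f1]. *)
have hloc' v (y : analytification R X) : pr y = normalized_abs R v -> 0 < f1 y ->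
    f2 y <= (2 * r) * E y + 0 * f1 y + 2 * D v.
  by move=> yv y0; have := hloc v y yv y0; rewrite f12; lra.
have r2 : 0 < 2 * r by rewrite mulr_gt0.
have D0' v : 0 <= 2 * D v by rewrite mulr_ge0.
have DS' v : v \notin S -> 2 * D v = 0 by move=> /DS ->; rewrite mulr0.
pose Dt := \sum_(v <- undup S) 2 * D v.
exists (2 * r)^-1, (- Dt / (2 * r)); split; first by rewrite invr_gt0.
move=> Q; have := @ereal_rearrange R (family_height R F1 Q) 0 (height_of Q E) (2 * r) 1 Dt.
rewrite mule0 sube0; apply=> // _ efin.
apply: (@le_trans _ _ (positive_sum Q f1 f2)).
  by rewrite f1E f2E; exact: height_le_positive_sum.
apply: limsup_sum_le => J; rewrite lee_fin; have Ju := fset_uniq J.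
apply: le_trans (sum_local_inequality E_ge0 r2 D0' DS' hloc' f1_ge0 (lexx _) Ju) _.
rewrite mul0r mulr0 !addr0 lerD2r ler_pM2l // -lee_fin fineK //.
exact: height_of_ge.
Qed.
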